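(* Let $j\in\{1,\dots,n\}$ and consider a family in prenormal form $(x^2-\epsilon)y'=B(\epsilon,x)y$, with $r$ and then $\rho$ sufficiently small, such that for all $\hat\epsilon\in S$ both unfolded Stokes matrices $\hat C_R$ and $\hat C_L$ have trivial $j$-th row (i.e. equal to the $j$-th row of the identity matrix). Then the family is analytically equivalent to a family in prenormal form where the $j$-th equation is independent of the others, hence integrable, i.e. one whose matrix has zero $(j,i)$ entries for all $i\neq j$.
   Context: Systems. A family in prenormal form is a family $(x^2-\epsilon)y'=B(\epsilon,x)y$, $y\in\mathbb{C}^n$, $n\ge2$, $'=d/dx$, with $B=\Lambda(\epsilon,x)+(x^2-\epsilon)R(\epsilon,x)$, $\Lambda(\epsilon,x)=\mathrm{diag}\{\lambda_1(\epsilon,x),\dots,\lambda_n(\epsilon,x)\}=\Lambda_0(\epsilon)+\Lambda_1(\epsilon)x$, $\Lambda_0,\Lambda_1$ diagonal and analytic in $\epsilon$ near $0$, $R$ a matrix of germs of analytic functions of $(\epsilon,x)$ at the origin, and $\Re(\lambda_q(0,0)-\lambda_j(0,0))>0$ for $q<j$. Model system: $(x^2-\epsilon)z'=\Lambda(\epsilon,x)z$. Parameter sector. Let $\theta_0$ be the largest angle (supremum) in $(0,\frac\pi2)$ with $\Re(e^{\pm i\theta_0}(\lambda_q(0,0)-\lambda_j(0,0)))\ge0$ for $q<j$. Fix $\gamma>0$ with $\gamma(1+\frac{2\gamma}{\pi})<\theta_0$ and let $S=\{\hat\epsilon:0<|\hat\epsilon|<\rho,\ \arg\hat\epsilon\in(\pi-2\gamma,3\pi+2\gamma)\}$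 (on the universal covering of $\mathbb{C}^*$; $\epsilon$ is the projection of $\hat\epsilon$). Put $\arg\sqrt{\hat\epsilon}=\frac12\arg\hat\epsilon$, $\hat x_L=\sqrt{\hat\epsilon}$, $\hat x_R=-\sqrt{\hat\epsilon}$. The radius $\rho>0$ is small, in particular so that for some $C>0$, $\Re(e^{\pm i\gamma(1+2\gamma/\pi)}(\lambda_q(\epsilon,\hat x_l)-\lambda_j(\epsilon,\hat x_l)))>C$ for $q<j$, $l=L,R$, $\hat\epsilon\in S$. $S_\cap$ is the auto-intersection of $S$: it consists of the pairs $\bar\epsilon$, $\tilde\epsilon=\bar\epsilon e^{2\pi i}$ both in $S$. Sectorial domains. Fix $r>0$ small, $\mathbb{D}_r=\{|x|<r\}$, $\delta>0$ small, $\Omega_D=\{|x|<r,\,-(\pi+\delta)<\arg x<\delta\}$, $\Omega_U=\{|x|<r,\,-\delta<\arg x<\pi+\delta\}$, such that the closure of $\Omega_D$ (resp. $\Omega_U$) contains no ray $\Re((\lambda_q(0,0)-\lambda_j(0,0))/x)=0$, $q\ne j$, of the upper (resp. lower) half-plane. Use the time $t$ of $\dot x=x^2-\epsilon$: $x(t)=-\sqrt{\hat\epsilon}\coth(\sqrt{\hat\epsilon}\,t)$ if $\epsilon\neq0$ (period $\pi i/\sqrt{\hat\epsilon}$), $x(t)=-1/t$ if $\epsilon=0$. Fix small constants $c_0>0$, $h\in(0,1/r)$, $\kappa\in(0,\frac12)$ independent of $\hat\epsilon$. Let $N_{\hat\epsilon}$ be the connected component containing $t=0$ of $\{t:|x(t)|\ge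 r\}$, $P=-\pi i/\sqrt{\hat\epsilon}$, $\hat\theta=\frac{2\gamma}{\pi}(\pi-\arg\sqrt{\hat\epsilon})$, and $\sigma(u)=0$ if $|u|\le c_0/\sqrt{|\epsilon|}$, $\sigma(u)=(u-\mathrm{sgn}(u)c_0/\sqrt{|\epsilon|})\tan\hat\theta$ otherwise. $\Gamma_D^{\hat\epsilon}$ is the set of $t\notin N_{\hat\epsilon}$ with $\Im t<h+\sigma(\Re t)$ lying above the line $-(\frac12+\kappa)P+\mathbb{R}e^{i\hat\theta}$; $\Gamma_U^{\hat\epsilon}$ is the set of $t\notin N_{\hat\epsilon}$ with $\Im t>-h+\sigma(\Re t)$ lying below the line $(\frac12+\kappa)P+\mathbb{R}e^{i\hat\theta}$. $\Omega_s^{\hat\epsilon}=x(\Gamma_s^{\hat\epsilon})$, $s=D,U$. $\Omega_D^{\hat\epsilon}\cap\Omega_U^{\hat\epsilon}$ has three connected components $\Omega_L^{\hat\epsilon},\Omega_R^{\hat\epsilon},\Omega_C^{\hat\epsilon}$, images of the right and left components of $\Gamma_D^{\hat\epsilon}\cap\Gamma_U^{\hat\epsilon}$ and of $\Gamma_D^{\hat\epsilon}\cap(\Gamma_U^{\hat\epsilon}-P)$; their closures contain respectively $\hat x_L$, $\hat x_R$, and both; $0\in\Omega_C^{\hat\epsilon}$. Model solutions. For $l=L,R$, $\mathcal U_l=\frac1{2\hat x_l}\Lambda(\epsilon,\hat x_l)$. $F(\epsilon,x)=(x-\hat x_R)^{\mathcal U_R}(x-\hat x_L)^{\mathcal U_L}$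 is a fundamental matrix of the model. $F_D(\hat\epsilon,\cdot)$ is its branch on $\Omega_D^{\hat\epsilon}$ (namely $e^{t\Lambda_0}(x^2-\epsilon)^{\Lambda_1/2}$ with $x=x(t)$, $t\in\Gamma_D^{\hat\epsilon}$, converging as $\hat\epsilon\to0$ to $x^{\Lambda_1(0)}e^{-\Lambda_0(0)/x}$ with $-(\pi+\delta)<\arg x<\delta$), and $F_U(\hat\epsilon,\cdot)$ is the analytic continuation of $F_D$ to $\Omega_U^{\hat\epsilon}$ through $\Omega_R^{\hat\epsilon}$. Unfolded Stokes matrices. $H_s(\hat\epsilon,x)$, $s=D,U$, are matrices, analytic for $\hat\epsilon\in S$, $x\in\Omega_s^{\hat\epsilon}$, such that $W_s=H_sF_s$ is a fundamental matrix of solutions of the family on $\Omega_s^{\hat\epsilon}$; $\lim_{x\to\hat x_l,x\in\Omega_s^{\hat\epsilon}}H_s(\hat\epsilon,x)$ ($l=L,R$) is an invertible diagonal matrix independent of $s$, analytic in $\hat\epsilon\in S$ with nonsingular limit at $\epsilon=0$; $|H_s(\bar\epsilon,0)-H_s(\tilde\epsilon,0)|\le c|\bar\epsilon|$ on $S_\cap$ for some $c\ge0$; and $|H_s(\hat\epsilon,0)|$, $|H_s(\hat\epsilon,0)^{-1}|$ are bounded on $S_\cap$. The unfolded Stokes matrices $\hat C_R$ (upper triangular unipotent) and $\hat C_L$ (lower triangular unipotent) are defined by $H_D^{-1}H_U=F_D\hat C_RF_D^{-1}$ on $\Omega_R^{\hat\epsilon}$, $H_D^{-1}H_U=F_D\hat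 C_LF_D^{-1}$ on $\Omega_L^{\hat\epsilon}$ (and $H_D^{-1}H_U=I$ on $\Omega_C^{\hat\epsilon}$). They are unique up to simultaneous conjugation by an invertible diagonal matrix. Two families are (locally) analytically equivalent if an invertible matrix $P_1(\epsilon,x)$ of germs of analytic functions of $(\epsilon,x)$ at the origin exists such that $y=P_1(\epsilon,x)z$ transforms one into the other. *)

(* Defs.v *)
From HB Require Import structures.
From mathcomp Require Import all_boot all_order all_algebra.
From mathcomp Require Import all_classical all_reals all_analysis.
From mathcomp Require Import complex.

Set Implicit Arguments.
Unset Strict Implicit.
Unset Printing Implicit Defensive.

Import Order.TTheory GRing.Theory Num.Theory.
Import numFieldNormedType.Exports.

Local Open Scope classical_set_scope.
Local Open Scope complex_scope.
Local Open Scope ring_scope.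

(* The usual topology and norm on the complex numbers [R[i]]; the norm [`|z|]
   is itself an element of [R[i]], so real bounds are injected by [%:C]. *)
HB.instance Definition _ (R : realType) := NormedModule.copy R[i] R[i]^o.

Section ComplexFunctions.
Variable R : realType.
Local Notation C := R[i].

Definition cexp (z : C) : C :=
  (expR (complex.Re z))%:C * (cos (complex.Im z) +i* sin (complex.Im z)).

Definition expi (a : R) : C := cexp (0 +i* a).

Definition ccosh (z : C) : C := (cexp z + cexp (- z)) / 2.
Definition csinh (z : C) : C := (cexp z - cexp (- z)) / 2.

Variable V : normedModType C.

Definition analytic_at (f : C -> V) (z0 : C) : Prop :=
  exists (a : nat -> V) (d : R), 0 < d /\
    forall z, `|z - z0| < d%:C ->
      series (fun k => (z - z0) ^+ k *: a k) @ \oo --> f z.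

(* Joint analyticity in two variables.  The bound on the coefficients makes
   the double power series absolutely convergent on the open bidisc, so that
   its sum is the limit of the square partial sums. *)
Definition analytic2_at (f : C -> C -> V) (y0 z0 : C) : Prop :=
  exists (a : nat -> nat -> V) (d M : R), [/\ 0 < d,
    forall k l, `|a k l| * (d%:C) ^+ (k + l) <= M%:C &
    forall y z, `|y - y0| < d%:C -> `|z - z0| < d%:C ->
      (fun N => \sum_(0 <= k < N) \sum_(0 <= l < N)
                  ((y - y0) ^+ k * (z - z0) ^+ l) *: a k l) @ \oo --> f y z].

End ComplexFunctions.

Section Systems.
Variables (R : realType) (n : nat).
Local Notation C := R[i].

(* [l0] and [l1] list the diagonal entries of Lambda_0 and Lambda_1. *)
Definition eigval (l0 l1 : C -> 'rV[C]_n) (e x : C) (q : 'I_n) : C := l0 e 0 q + x * l1 e 0 q.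

Definition Lambda (l0 l1 : C -> 'rV[C]_n) (e x : C) : 'M[C]_n :=
  diag_mx (\row_q eigval l0 l1 e x q).

Definition system_mx (l0 l1 : C -> 'rV[C]_n) (Rm : C -> C -> 'M[C]_n)
    (e x : C) : 'M[C]_n :=
  Lambda l0 l1 e x + (x ^+ 2 - e) *: Rm e x.

Definition prenormal (l0 l1 : C -> 'rV[C]_n)
    (Rm : C -> C -> 'M[C]_n) : Prop :=
  [/\ analytic_at l0 0, analytic_at l1 0, analytic2_at Rm 0 0 &
      forall q k : 'I_n, (q < k)%N ->
        0 < complex.Re (eigval l0 l1 0 0 q - eigval l0 l1 0 0 k)].

(* Substituting y = P z in (x^2 - e) y' = B y gives (x^2 - e) z' = B' z. *)
Definition analytically_equivalent (B B' : C -> C -> 'M[C]_n) : Prop :=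
  exists P : C -> C -> 'M[C]_n,
    [/\ analytic2_at P 0 0, P 0 0 \in unitmx &
        \forall e & x \near (0 : C),
          B' e x = invmx (P e x) *m
                     (B e x *m P e x - (x ^+ 2 - e) *: derive1 (P e) x)].

Definition fundamental_on (B : C -> C -> 'M[C]_n) (e : C)
    (A : set C) (W : C -> 'M[C]_n) : Prop :=
  forall x, A x -> W x \in unitmx /\
    exists2 dW : 'M[C]_n, is_derive x (1 : C) W dW &
                          (x ^+ 2 - e) *: dW = B e x *m W x.

Definition theta0 (l0 l1 : C -> 'rV[C]_n) : R :=
  sup [set th : R | 0 < th < pi / 2 /\
    forall q k : 'I_n, (q < k)%N ->
      let D := eigval l0 l1 0 0 q - eigval l0 l1 0 0 k in
      0 <= complex.Re (expi th * D) /\ 0 <= complex.Re (expi (- th) * D)].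

End Systems.

(* A point of the universal covering of C^* is represented by its logarithm
   [w]: its modulus is exp (Re w), its argument is Im w, its projection is
   [cexp w], multiplication by exp (2 pi i) is the translation by 2 pi i, and
   analyticity on the covering is analyticity in [w]. *)
Section Domains.
Variable R : realType.
Local Notation C := R[i].
Implicit Types (w t x : C).

Definition modulus w : R := expR (complex.Re w).
Definition sqrte w : C := cexp (w / 2).
Definition xL w : C := sqrte w.
Definition xR w : C := - sqrte w.
Definition turn w : C := w + (0 +i* (2 * pi)).

Definition sectorS (gam rho : R) : set C :=
  [set w | modulus w < rho /\
           pi - 2 * gam < complex.Im w < 3 * pi + 2 * gam].

(* The pairs (w, turn w) with [w] in this set form the auto-intersection. *)
Definition autointer (gam rho : R) : set C :=
  [set w | sectorS gam rho w /\ sectorS gam rho (turn w)].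

(* The filter of "epsilon -> 0 within S". *)
Definition to_zero (gam rho : R) : set_system C :=
  filter_from [set d : R | 0 < d]
    (fun d => [set w | sectorS gam rho w /\ modulus w < d]).

Definition spectral_gap n (l0 l1 : C -> 'rV[C]_n) (gam rho : R) : Prop :=
  exists2 c : R, 0 < c &
    forall w (q k : 'I_n) x, sectorS gam rho w -> (q < k)%N ->
      x = xL w \/ x = xR w ->
      let a := gam * (1 + 2 * gam / pi) in
      let D := eigval l0 l1 (cexp w) x q - eigval l0 l1 (cexp w) x k in
      c < complex.Re (expi a * D) /\ c < complex.Re (expi (- a) * D).

(* Sectors of the plane at epsilon = 0. *)
Definition sectorD (r del : R) : set C :=
  [set x | exists m a : R,
     [/\ 0 < m < r, - (pi + del) < a < del & x = m%:C * expi a]].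
Definition sectorU (r del : R) : set C :=
  [set x | exists m a : R,
     [/\ 0 < m < r, - del < a < pi + del & x = m%:C * expi a]].

Definition no_opposite_ray n (l0 l1 : C -> 'rV[C]_n) (r del : R) : Prop :=
  forall (q k : 'I_n) x, q != k ->
    complex.Re ((eigval l0 l1 0 0 q - eigval l0 l1 0 0 k) / x) = 0 ->
    (0 < complex.Im x -> ~ closure (sectorD r del) x) /\
    (complex.Im x < 0 -> ~ closure (sectorU r del) x).

(* Solution x(t) of x' = x^2 - epsilon with x(0) = oo. *)
Definition xt w t : C :=
  - sqrte w * ccosh (sqrte w * t) / csinh (sqrte w * t).

Definition period w : C := - (0 +i* pi) / sqrte w.

(* |x(t)| >= r, multiplied out so as to include the poles of x, in
   particular t = 0. *)
Definition hole (r : R) w : set C :=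
  connected_component
    [set t | r%:C * `|csinh (sqrte w * t)|
             <= `|sqrte w * ccosh (sqrte w * t)|] 0.

Definition thetahat (gam : R) w : R := 2 * gam / pi * (pi - complex.Im w / 2).

Definition sigma (gam c0 : R) w (u : R) : R :=
  let c := c0 / Num.sqrt (modulus w) in
  if `|u| <= c then 0 else (u - Num.sg u * c) * tan (thetahat gam w).

Section Fixed.
Variables (gam r c0 h kap : R).

Definition GammaD w : set C :=
  [set t | [/\ ~ hole r w t,
     complex.Im t < h + sigma gam c0 w (complex.Re t) &
     0 < complex.Im ((t + (2^-1 + kap)%:C * period w)
                     * expi (- thetahat gam w))]].

Definition GammaU w : set C :=
  [set t | [/\ ~ hole r w t,
     - h + sigma gam c0 w (complex.Re t) < complex.Im t &
     complex.Im ((t - (2^-1 + kap)%:C * period w)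
                 * expi (- thetahat gam w)) < 0]].

(* Gamma_D at epsilon = 0, where x(t) = -1/t, sigma = 0 and the lower line is
   at infinity. *)
Definition GammaD0 : set C :=
  [set t | (r^-1)%:C < `|t| /\ complex.Im t < h].

Definition GammaDU w : set C := GammaD w `&` GammaU w.

(* The component of the intersection of Gamma_D and Gamma_U extending to
   Re t = +oo (resp. -oo); for small constants there is exactly one of each. *)
Definition GammaRight w : set C :=
  [set t | GammaDU w t /\ forall M : R,
     exists2 t', connected_component (GammaDU w) t t' & M < complex.Re t'].
Definition GammaLeft w : set C :=
  [set t | GammaDU w t /\ forall M : R,
     exists2 t', connected_component (GammaDU w) t t' & complex.Re t' < M].

Definition OmegaD w : set C := xt w @` GammaD w.
Definition OmegaU w : set C := xt w @` GammaU w.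
Definition OmegaL w : set C := xt w @` GammaRight w.
Definition OmegaR w : set C := xt w @` GammaLeft w.
Definition OmegaC w : set C :=
  xt w @` [set t | GammaD w t /\ GammaU w (t + period w)].

Variables (rho del : R).
Local Notation S := (sectorS gam rho).

(* [lg w t] is the branch of log (x(t)^2 - epsilon) / 2 on Gamma_D that is
   continuous in (w, t) and tends to log x, x = -1/t, with
   -(pi + del) < arg x < del, as epsilon -> 0. *)
Definition is_branchD (lg : C -> C -> C) : Prop :=
  [/\ {within [set p : C * C | S p.1 /\ GammaD p.1 p.2],
         continuous (fun p => lg p.1 p.2)},
      forall w t, S w -> GammaD w t ->
        cexp (2 * lg w t) = xt w t ^+ 2 - cexp w &
      forall t, GammaD0 t ->
        exists L : C, [/\ cexp L = - t^-1, - (pi + del) < complex.Im L < del &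
                          lg w t @[w --> to_zero gam rho] --> L]].

Section Stokes.
Variables (n : nat) (l0 l1 : C -> 'rV[C]_n) (Rm : C -> C -> 'M[C]_n).
Implicit Types (FD FU HD HU CR CL : C -> C -> 'M[C]_n).

Definition is_FD FD : Prop :=
  exists2 lg : C -> C -> C, is_branchD lg &
    forall w t, S w -> GammaD w t ->
      FD w (xt w t) =
        diag_mx (\row_q cexp (t * l0 (cexp w) 0 q + lg w t * l1 (cexp w) 0 q)).

Definition is_FU FD FU : Prop := forall w, S w ->
  (forall x, OmegaU w x -> analytic_at (FU w) x) /\
  (forall x, OmegaR w x -> FU w x = FD w x).

Definition diag_limit (xl : C -> C) HD HU : Prop :=
  exists K : C -> 'M[C]_n,
    (forall w, S w ->
       [/\ HD w x @[x --> within (OmegaD w) (nbhs (xl w))] --> K w,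
           HU w x @[x --> within (OmegaU w) (nbhs (xl w))] --> K w,
           is_diag_mx (K w), K w \in unitmx & analytic_at K w]) /\
    exists2 K0 : 'M[C]_n, K0 \in unitmx & K w @[w --> to_zero gam rho] --> K0.

Record normalizing_at (Om : C -> set C) (F H : C -> C -> 'M[C]_n) : Prop := {
  normalizing_analytic : forall w x, S w -> Om w x -> analytic2_at H w x;
  normalizing_solution : forall w, S w ->
    fundamental_on (system_mx l0 l1 Rm) (cexp w) (Om w)
      (fun x => H w x *m F w x);
  normalizing_jump : exists2 c : R, 0 <= c &
    forall w, autointer gam rho w ->
      `|H w 0 - H (turn w) 0| <= (c * modulus w)%:C;
  normalizing_bounded : exists M : R,
    forall w, autointer gam rho w ->
      [/\ `|H w 0| <= M%:C, `|H (turn w) 0| <= M%:C,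
          `|invmx (H w 0)| <= M%:C & `|invmx (H (turn w) 0)| <= M%:C] }.

Definition unfolded_stokes FD HD HU (cR cL : C -> 'M[C]_n) : Prop :=
  forall w, S w ->
    [/\ (forall i k : 'I_n, cR w i i = 1 /\ ((k < i)%N -> cR w i k = 0)),
        (forall i k : 'I_n, cL w i i = 1 /\ ((i < k)%N -> cL w i k = 0)),
        (forall x, OmegaR w x ->
           invmx (HD w x) *m HU w x = FD w x *m cR w *m invmx (FD w x)),
        (forall x, OmegaL w x ->
           invmx (HD w x) *m HU w x = FD w x *m cL w *m invmx (FD w x)) &
        (forall x, OmegaC w x -> invmx (HD w x) *m HU w x = 1%:M)].

End Stokes.
End Fixed.
End Domains.

(* Main.v *)
(* If the [j]-th rows of the Stokes matrices are trivial, the [j]-th rows of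
   [HD^-1] and [HU^-1] glue to a row [v] which is analytic on the disc [|x| < r]
   off the two singular points, bounded near them, and satisfies
   [(x^2 - e) v' = v (lambda_j - B)].  If [v], suitably scaled, is analytic in
   [(e, x)] at the origin, then the inverse of the identity matrix with [j]-th row
   replaced by [v] is the transformation that decouples the [j]-th equation.

   For the latter it suffices to know [v] for [e = a^2] with [a > 0] tending
   to [0], where the [t]-domains are horizontal strips.  By the maximum
   principle the Taylor coefficients of [v] at [x = 0] are dominated by a geometric
   sequence whose ratio does not depend on [a].  The equation for [v], with
   one coefficient left out for each [i <> j], is the fixed point equation of a
   contraction in a space of convergent double series, normalized by
   [v_j(e, 0) = 1].  By uniqueness its solution specializes at [e = a^2] to a
   multiple of the true row; hence the left out coefficients, which are analytic
   in [e], vanish at these points and so identically. *)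

Require Import Defs.
From mathcomp Require Import all_boot all_order all_algebra.
From mathcomp Require Import all_classical all_reals all_analysis.
From mathcomp Require Import complex ring lra.

Set Implicit Arguments.
Unset Strict Implicit.
Unset Printing Implicit Defensive.

Import Order.TTheory GRing.Theory Num.Theory.
Import numFieldNormedType.Exports.

Local Open Scope classical_set_scope.
Local Open Scope complex_scope.
Local Open Scope ring_scope.

(** * Modulus of complex numbers *)

Section Modulus.
Variable R : realType.
Local Notation C := R[i].
Implicit Types (x y z : C).

(** The obstacle is the irregular singularity at [e = 0]: solving for [v] degree by degree diverges
    in general. Equation [k] of [(x^2 - e) v_i' = (v T)_i] can be read as an equation for [v_k],
    through the eigenvalue difference [mu i], or for [v_(k-1)], through [x^2 v']. The first reading
    contracts in low degrees, the second in high degrees; switching at degree [m] loses exactly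
    equation [m], which is the coefficient left out. Accordingly the norm has two radii: [s2]
    depends on the data only, while [s1], used below degree [m], is chosen after [m] and absorbs the
    factors [m] produced by differentiation.

    The true row has to lie in this weighted space for each [a], with a bound that may depend on
    [a]; only the ratio of its growth must be uniform. That ratio is obtained without contour
    integrals: analyticity always means a power series expansion, the maximum principle is proved on
    squares from 2-jets, and the two singular points are removed by applying it to [f^m (x^2 - e)]
    and letting [m] tend to infinity. *)

Definition cmod z : R := complex.Re `|z|.

(** The norm of [R[i]] has its values in [R[i]], which is only partially ordered. Estimates are made
    with the real number [cmod z], within reach of [lra] and [nra], and carried back by this
    equation. *)
Lemma cmodE z : `|z| = (cmod z)%:C.
Proof. by rewrite /cmod normc_def. Qed.

Lemma cmod_def z :
  cmod z = Num.sqrt (complex.Re z ^+ 2 + complex.Im z ^+ 2).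
Proof. by rewrite /cmod normc_def. Qed.

Lemma cmod_ge0 z : 0 <= cmod z.
Proof. by rewrite cmod_def sqrtr_ge0. Qed.

Lemma cmod0 : cmod 0 = 0.
Proof. by rewrite /cmod normr0. Qed.

Lemma cmod1 : cmod 1 = 1.
Proof. by rewrite /cmod normr1. Qed.

Lemma cmodM x y : cmod (x * y) = cmod x * cmod y.
Proof. by apply: complexI; rewrite rmorphM /= -!cmodE normrM. Qed.

Lemma cmodV x : cmod x^-1 = (cmod x)^-1.
Proof. by apply: complexI; rewrite fmorphV /= -!cmodE normfV. Qed.

Lemma cmodX x k : cmod (x ^+ k) = cmod x ^+ k.
Proof. by apply: complexI; rewrite rmorphXn /= -!cmodE normrX. Qed.

Lemma cmodN x : cmod (- x) = cmod x.
Proof. by rewrite /cmod normrN. Qed.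

Lemma cmodB x y : cmod (x - y) = cmod (y - x).
Proof. by rewrite /cmod distrC. Qed.

Lemma cmodD x y : cmod (x + y) <= cmod x + cmod y.
Proof. by rewrite -lecR rmorphD /= -!cmodE ler_normD. Qed.

Lemma cmod_triB x y : cmod (x - y) <= cmod x + cmod y.
Proof. by rewrite -(cmodN y) cmodD. Qed.

Lemma cmod_subl x y : cmod x <= cmod (x - y) + cmod y.
Proof. by rewrite -{1}(subrK y x) cmodD. Qed.

Lemma cmod_tri z x y : cmod (x - y) <= cmod (x - z) + cmod (z - y).
Proof. by rewrite -{1}(subrK z x) -addrA cmodD. Qed.

Lemma cmod_sum I (r : seq I) (P : pred I) (f : I -> C) :
  cmod (\sum_(i <- r | P i) f i) <= \sum_(i <- r | P i) cmod (f i).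
Proof.
elim/big_rec2: _ => [|i y z _ le_yz]; first by rewrite cmod0.
exact: le_trans (cmodD _ _) (lerD (lexx _) le_yz).
Qed.

Lemma cmod_eq0 x : (cmod x == 0) = (x == 0).
Proof.
apply/eqP/eqP => [x0|->]; last exact: cmod0.
by apply/eqP; rewrite -normr_eq0 cmodE x0.
Qed.

Lemma cmod_gt0 x : (0 < cmod x) = (x != 0).
Proof. by rewrite lt_neqAle eq_sym cmod_eq0 cmod_ge0 andbT. Qed.

Lemma cmodR (a : R) : cmod a%:C = `|a|.
Proof. by rewrite cmod_def /= expr0n addr0 sqrtr_sqr. Qed.

Lemma cmod_nat k : cmod k%:R = k%:R.
Proof. by rewrite -[k%:R](rmorph_nat (real_complex R)) cmodR normr_nat. Qed.

Lemma sqr_cmod z : cmod z ^+ 2 = complex.Re z ^+ 2 + complex.Im z ^+ 2.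
Proof. by rewrite cmod_def sqr_sqrtr // addr_ge0 ?sqr_ge0. Qed.

Lemma Re_le_cmod z : `|complex.Re z| <= cmod z.
Proof. by rewrite cmod_def -sqrtr_sqr ler_wsqrtr // lerDl sqr_ge0. Qed.

Lemma Im_le_cmod z : `|complex.Im z| <= cmod z.
Proof. by rewrite cmod_def -sqrtr_sqr ler_wsqrtr // lerDr sqr_ge0. Qed.

Lemma cmod_le_ReIm z : cmod z <= `|complex.Re z| + `|complex.Im z|.
Proof.
rewrite [z in cmod z]complexE; apply: le_trans (cmodD _ _) _.
rewrite cmodM !cmodR; suff -> : cmod 'i = 1 by rewrite mul1r.
by rewrite cmod_def /= expr0n expr1n add0r sqrtr1.
Qed.

Lemma re_add x y : complex.Re (x + y) = complex.Re x + complex.Re y.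
Proof. by case: x y => a b []. Qed.
Lemma im_add x y : complex.Im (x + y) = complex.Im x + complex.Im y.
Proof. by case: x y => a b []. Qed.
Lemma re_opp x : complex.Re (- x) = - complex.Re x.
Proof. by case: x. Qed.
Lemma im_opp x : complex.Im (- x) = - complex.Im x.
Proof. by case: x. Qed.
Lemma re_mul x y : complex.Re (x * y) =
  complex.Re x * complex.Re y - complex.Im x * complex.Im y.
Proof. by case: x y => a b []. Qed.
Lemma im_mul x y : complex.Im (x * y) =
  complex.Re x * complex.Im y + complex.Im x * complex.Re y.
Proof. by case: x y => a b []. Qed.
Lemma re_sum I (r : seq I) (f : I -> C) :
  complex.Re (\sum_(i <- r) f i) = \sum_(i <- r) complex.Re (f i).
Proof. exact: (big_morph _ re_add). Qed.
Lemma im_sum I (r : seq I) (f : I -> C) :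
  complex.Im (\sum_(i <- r) f i) = \sum_(i <- r) complex.Im (f i).
Proof. exact: (big_morph _ im_add). Qed.
Lemma eq_ReIm x y :
  complex.Re x = complex.Re y -> complex.Im x = complex.Im y -> x = y.
Proof. by case: x y => a b [c d] /= -> ->. Qed.

Lemma near_cmod z (P : set C) :
  (\forall y \near z, P y) <->
  exists2 d : R, 0 < d & forall y, cmod (y - z) < d -> P y.
Proof.
split.
  move/nbhs_ballP => [e /= e0 He].
  have [r re] : exists r, e = r%:C.
    by exists (complex.Re e); rewrite RRe_real ?gtr0_real.
  exists r; first by rewrite -ltcR -re.
  move=> y yz; apply: He; rewrite -ball_normE /= distrC cmodE re ltcR //.
move=> [d d0 Hd]; apply/nbhs_ballP; exists d%:C; first by rewrite /= ltcR.
by move=> y; rewrite -ball_normE /= distrC cmodE ltcR => /Hd.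
Qed.

Lemma cvg_cmod (T : Type) (F : set_system T) (FF : Filter F) (f : T -> C) l :
  f @ F --> l <->
  forall e : R, 0 < e -> \forall x \near F, cmod (f x - l) < e.
Proof.
split.
  move=> /cvgrPdist_lt fl e e0.
  have := fl e%:C; rewrite ltcR => /(_ e0).
  by apply: filterS => x; rewrite distrC cmodE ltcR.
move=> H; apply/cvgrPdist_lt => e e0.
have [r re] : exists r, e = r%:C.
  by exists (complex.Re e); rewrite RRe_real ?gtr0_real.
have r0 : 0 < r by rewrite -ltcR -re.
by apply: filterS (H _ r0) => x; rewrite distrC re cmodE ltcR.
Qed.

End Modulus.

(** * Series and power series *)

Section PowerSeries.
Variable R : realType.
Local Notation C := R[i].

(** The standard way of proving an equality of limits below: the distance of the two sides is at
    most [K r^N] for every [N]. *)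
Lemma le_geometric0 (x K r : R) : 0 <= r < 1 ->
  (forall N, x <= K * r ^+ N) -> x <= 0.
Proof.
move=> /andP[r0 r1] H; rewrite leNgt; apply/negP => x0.
have K0 : 0 < K by rewrite (lt_le_trans x0) // (le_trans (H 0%N)) ?expr0 ?mulr1.
have : (fun N => K * r ^+ N) @ \oo --> K * 0.
  apply: cvgM; first exact: cvg_cst.
  by apply: cvg_expr; rewrite ger0_norm.
rewrite mulr0 => /cvgrPdist_lt /(_ x x0) [N _ /(_ N (leqnn N))].
rewrite /= sub0r normrN ger0_norm ?mulr_ge0 ?exprn_ge0 // 1?ltW //.
by rewrite ltNge H.
Qed.

Lemma geometric_sum_le (q : R) m n : 0 <= q < 1 ->
  \sum_(k < n) q ^+ (m + k) <= q ^+ m / (1 - q).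
Proof.
move=> /andP[q0 q1]; rewrite ler_pdivlMr ?subr_gt0 //.
suff -> : (\sum_(k < n) q ^+ (m + k)) * (1 - q) = q ^+ m - q ^+ (m + n).
  by rewrite gerBl exprn_ge0.
elim: n => [|n IH]; first by rewrite big_ord0 mul0r addn0 subrr.
by rewrite big_ord_recr /= mulrDl IH addnS exprS; ring.
Qed.

Definition geodom (q M : R) (u : nat -> C) := forall k, cmod (u k) <= M * q ^+ k.

(** Real and imaginary parts are summed separately, so that convergence is a matter of real series.
    The value is meaningful under [geodom] with [q < 1], which also gives explicit tails. *)
Definition csum (u : nat -> C) : C :=
  limn (series (fun k => complex.Re (u k))) +i*
  limn (series (fun k => complex.Im (u k))).

Lemma geodom_M_ge0 q M u : geodom q M u -> 0 <= M.
Proof. by move/(_ 0%N); rewrite expr0 mulr1; apply: le_trans; exact: cmod_ge0. Qed.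

Lemma geodom_cauchy q M u m n : 0 <= q < 1 -> geodom q M u -> (m <= n)%N ->
  cmod (\sum_(k < n) u k - \sum_(k < m) u k) <= M * q ^+ m / (1 - q).
Proof.
move=> q01 H /subnK <-; rewrite addnC big_split_ord /= addrAC subrr add0r.
apply: le_trans (cmod_sum _ _ _) _.
apply: le_trans (ler_sum _ (fun (k : 'I__) _ => H (m + k)%N)) _.
rewrite -mulr_sumr -mulrA ler_wpM2l ?(geodom_M_ge0 H) //.
exact: geometric_sum_le.
Qed.

Lemma real_geodom_cvg (q M : R) (r : nat -> R) : 0 <= q < 1 ->
  (forall k, `|r k| <= M * q ^+ k) -> cvgn (series r).
Proof.
move=> /andP[q0 q1] H; apply: normed_cvg.
apply: (@series_le_cvg _ _ (geometric M q)) => //.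
- by move=> k; rewrite normr_ge0.
- by move=> k; rewrite /geometric /= (le_trans (normr_ge0 (r k)) (H k)).
- by apply: is_cvg_geometric_series; rewrite ger0_norm.
Qed.

Lemma csum_cvg q M u : 0 <= q < 1 -> geodom q M u ->
  forall e : R, 0 < e ->
  exists N, forall n, (N <= n)%N -> cmod (\sum_(k < n) u k - csum u) < e.
Proof.
move=> q01 H e e0; have e2 : 0 < e / 2 by rewrite divr_gt0.
have H1 := @real_geodom_cvg q M (fun k => complex.Re (u k)) q01
  (fun k => le_trans (Re_le_cmod _) (H k)).
have H2 := @real_geodom_cvg q M (fun k => complex.Im (u k)) q01
  (fun k => le_trans (Im_le_cmod _) (H k)).
move/cvgrPdist_lt : H1 => /(_ _ e2) [N1 _ HN1].
move/cvgrPdist_lt : H2 => /(_ _ e2) [N2 _ HN2].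
exists (maxn N1 N2) => n; rewrite geq_max => /andP[n1 n2].
apply: le_lt_trans (cmod_le_ReIm _) _; rewrite (splitr e) ltrD //.
  have := HN1 _ n1; rewrite /series /= big_mkord distrC.
  by rewrite re_add re_opp re_sum.
have := HN2 _ n2; rewrite /series /= big_mkord distrC.
by rewrite im_add im_opp im_sum.
Qed.

Lemma csum_err q M u n : 0 <= q < 1 -> geodom q M u ->
  cmod (\sum_(k < n) u k - csum u) <= M * q ^+ n / (1 - q).
Proof.
move=> q01 H; apply/ler_addgt0Pr => e e0.
have [N HN] := csum_cvg q01 H e0.
apply: le_trans (cmod_tri (\sum_(k < maxn N n) u k) _ _) _.
apply: lerD; last by apply/ltW/HN/leq_maxl.
by rewrite cmodB; apply: geodom_cauchy => //; exact: leq_maxr.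
Qed.

Lemma csum_le q M u : 0 <= q < 1 -> geodom q M u -> cmod (csum u) <= M / (1 - q).
Proof.
move=> q01 H; have := csum_err 0 q01 H.
by rewrite big_ord0 sub0r cmodN expr0 mulr1.
Qed.

Lemma csum_eq q M u l K r : 0 <= q < 1 -> geodom q M u -> 0 <= r < 1 ->
  (forall n, cmod (\sum_(k < n) u k - l) <= K * r ^+ n) -> csum u = l.
Proof.
move=> q01 H r01 Hl; apply/eqP; rewrite -subr_eq0 -cmod_eq0 eq_le cmod_ge0 andbT.
have [q0 q1] := andP q01; have [r0 r1] := andP r01.
apply: (@le_geometric0 _ (M / (1 - q) + K) (Num.max q r)).
  by rewrite le_max q0 gt_max q1 r1.
move=> n; apply: le_trans (cmod_tri (\sum_(k < n) u k) _ _) _.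
have K0 : 0 <= K by have := Hl 0%N; rewrite expr0 mulr1; apply: le_trans; exact: cmod_ge0.
rewrite mulrDl; apply: lerD.
  rewrite cmodB; apply: le_trans (csum_err n q01 H) _.
  rewrite mulrAC ler_wpM2l ?divr_ge0 ?(geodom_M_ge0 H) ?subr_ge0 ?(ltW q1) //.
  by rewrite lerXn2r ?nnegrE ?le_max ?q0 ?lexx.
apply: le_trans (Hl n) _; rewrite ler_wpM2l //.
by rewrite lerXn2r ?nnegrE ?le_max ?r0 ?lexx ?orbT.
Qed.

Lemma geodomD q M1 M2 u v : geodom q M1 u -> geodom q M2 v ->
  geodom q (M1 + M2) (fun k => u k + v k).
Proof.
by move=> Hu Hv k; rewrite mulrDl; apply: le_trans (cmodD _ _) (lerD (Hu k) (Hv k)).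
Qed.

Lemma geodomZ q M c u : geodom q M u -> geodom q (cmod c * M) (fun k => c * u k).
Proof. by move=> Hu k; rewrite cmodM -mulrA ler_wpM2l ?cmod_ge0. Qed.

Lemma csumD q M1 M2 u v : 0 <= q < 1 -> geodom q M1 u -> geodom q M2 v ->
  csum (fun k => u k + v k) = csum u + csum v.
Proof.
move=> q01 Hu Hv; apply: (csum_eq (K := (M1 + M2) / (1 - q)) q01 (geodomD Hu Hv) q01).
move=> n; rewrite big_split /= opprD addrACA.
apply: le_trans (cmodD _ _) _; rewrite mulrDl mulrDl.
by apply: lerD; rewrite mulrAC; exact: csum_err.
Qed.

Lemma csumZ q M c u : 0 <= q < 1 -> geodom q M u ->
  csum (fun k => c * u k) = c * csum u.
Proof.
move=> q01 Hu; apply: (csum_eq (K := cmod c * (M / (1 - q))) q01 (geodomZ c Hu) q01).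
move=> n; rewrite -mulr_sumr -mulrBr cmodM -mulrA ler_wpM2l ?cmod_ge0 //.
by rewrite mulrAC; exact: csum_err.
Qed.

Lemma csum_ext u v : u =1 v -> csum u = csum v.
Proof. by move=> /funext ->. Qed.

Lemma csum0 : csum (fun=> 0) = 0.
Proof.
have H : geodom 0 0 (fun=> 0) by move=> k; rewrite cmod0 mul0r.
have q01 : (0 <= (0 : R)) && ((0 : R) < 1) by rewrite lexx ltr01.
apply: (csum_eq (K := 0) q01 H q01) => n.
by rewrite big1 // subrr cmod0 mul0r.
Qed.

Lemma csum_fin n u : (forall k, (n <= k)%N -> u k = 0) ->
  csum u = \sum_(k < n) u k.
Proof.
move=> Hu.
have q01 : (0 <= (2^-1 : R)) && ((2^-1 : R) < 1) by apply/andP; split; lra.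
(* A finitely supported sequence is below [s 2^-k]: the [k]-th term of [s] undoes the factor
   [2^-k]. *)
pose s := \sum_(k < n) cmod (u k) * 2 ^+ k.
have H : geodom 2^-1 s u.
  move=> k; have [kn|nk] := ltnP k n; last first.
    by rewrite Hu // cmod0 mulr_ge0 ?exprn_ge0 // sumr_ge0 // => *; rewrite mulr_ge0 ?cmod_ge0 ?exprn_ge0.
  rewrite exprVn ler_pdivlMr ?exprn_gt0 // /s (bigD1 (Ordinal kn)) //= lerDl.
  by apply: sumr_ge0 => *; rewrite mulr_ge0 ?cmod_ge0 ?exprn_ge0.
have E N : (n <= N)%N -> \sum_(k < N) u k = \sum_(k < n) u k.
  move=> /subnK <-; rewrite addnC big_split_ord /= [X in _ + X]big1 ?addr0 //.
  by move=> k _; rewrite Hu // leq_addr.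
apply/eqP; rewrite -subr_eq0 -cmod_eq0 eq_le cmod_ge0 andbT.
apply: (@le_geometric0 _ (s / (1 - 2^-1)) 2^-1) => // N.
apply: le_trans (_ : _ <= s * 2^-1 ^+ maxn n N / (1 - 2^-1)) _.
  by rewrite cmodB -(E _ (leq_maxl n N)); exact: csum_err.
rewrite mulrAC ler_wpM2l ?divr_ge0 ?(geodom_M_ge0 H) //; first lra.
by rewrite ler_wiXn2l ?leq_maxr //; lra.
Qed.

Lemma succ_le_exp2 k : k.+1%:R <= 2 ^+ k :> R.
Proof. by rewrite -natrX ler_nat ltn_expl. Qed.

Lemma sqr_le_exp2 k : k%:R ^+ 2 <= 3 * 2 ^+ k :> R.
Proof.
(* Unlike [k^2], the polynomial [k^2 + 2 k + 3] at most doubles from each [k] to the next, so the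
   induction closes. *)
suff : k%:R ^+ 2 + 2 * k%:R + 3 <= 3 * 2 ^+ k :> R.
  by have : 0 <= k%:R :> R by []; lra.
elim: k => [|k IH]; first by rewrite expr0 expr0n /=; lra.
have k0 : 0 <= k%:R :> R by [].
move: IH k0; rewrite -(@natr1 R k) (exprS (2 : R) k).
by move: (k%:R : R) (2 ^+ k : R) => a b IH a0; have := sqr_ge0 a; nra.
Qed.

Definition cprod (a b : nat -> C) k := \sum_(l < k.+1) a l * b (k - l)%N.

(** The [k + 1] terms of the convolution are absorbed by [k + 1 <= 2^k], which doubles the ratio.
    This is why products are evaluated on a quarter of the disc, sums on a half. *)
Lemma geodom_cprod q M1 M2 a b : 0 <= q -> geodom q M1 a -> geodom q M2 b ->
  geodom (2 * q) (M1 * M2) (cprod a b).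
Proof.
move=> q0 Ha Hb k; apply: le_trans (cmod_sum _ _ _) _.
apply: (@le_trans _ _ (\sum_(l < k.+1) M1 * M2 * q ^+ k)).
  apply: ler_sum => -[l /= lk] _.
  rewrite cmodM (_ : q ^+ k = q ^+ l * q ^+ (k - l)); last by rewrite -exprD subnKC.
  by rewrite mulrACA ler_pM ?cmod_ge0.
rewrite sumr_const card_ord -[_ *+ k.+1]mulr_natl mulrCA exprMn ler_wpM2l //.
  by rewrite mulr_ge0 ?(geodom_M_ge0 Ha) ?(geodom_M_ge0 Hb).
by rewrite ler_wpM2r ?exprn_ge0 // succ_le_exp2.
Qed.

Lemma sum_cprod a b n :
  \sum_(k < n) cprod a b k = \sum_(i < n) a i * \sum_(k < (n - i)%N) b k.
Proof.
elim: n => [|n IH]; first by rewrite !big_ord0.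
rewrite big_ord_recr /= IH [in RHS]big_ord_recr /= subSnn big_ord1 /cprod.
rewrite big_ord_recr /= subnn addrA; congr (_ + _).
rewrite -big_split /=; apply: eq_bigr => i _; rewrite -mulrDr; congr (_ * _).
by rewrite subSn ?big_ord_recr //= ltnW.
Qed.

Lemma csumM q M1 M2 a b : 0 <= q -> 2 * q < 1 ->
  geodom q M1 a -> geodom q M2 b -> csum (cprod a b) = csum a * csum b.
Proof.
move=> q0 q1 Ha Hb.
have q01 : 0 <= q < 1 by rewrite q0 /=; lra.
have q201 : 0 <= 2 * q < 1 by rewrite mulr_ge0.
have M10 := geodom_M_ge0 Ha; have M20 := geodom_M_ge0 Hb.
have q1' : 0 <= (1 - q)^-1 by rewrite invr_ge0; lra.
apply: (csum_eq (K := M1 * M2 / (1 - q) + M1 / (1 - q) * cmod (csum b)) q201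
  (geodom_cprod q0 Ha Hb) q201) => n.
rewrite sum_cprod.
(* Each inner partial sum is replaced by its limit. The error of term [i] is of order
   [q^i q^(n-i) = q^n], and the [n] such terms are absorbed by [n <= 2^n]. *)
have -> : \sum_(i < n) a i * (\sum_(k < (n - i)%N) b k) - csum a * csum b =
  \sum_(i < n) a i * (\sum_(k < (n - i)%N) b k - csum b) +
  (\sum_(i < n) a i - csum a) * csum b.
  under [in RHS]eq_bigr do rewrite mulrBr.
  by rewrite sumrB -mulr_suml; ring.
apply: le_trans (cmodD _ _) _; rewrite [leRHS]mulrDl; apply: lerD.
  apply: le_trans (cmod_sum _ _ _) _.
  apply: (@le_trans _ _ (\sum_(i < n) M1 * M2 / (1 - q) * q ^+ n)).
    apply: ler_sum => -[i /= ni] _; rewrite cmodM.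
    apply: le_trans (ler_pM (cmod_ge0 _) (cmod_ge0 _) (Ha i) (csum_err _ q01 Hb)) _.
    rewrite (_ : q ^+ n = q ^+ i * q ^+ (n - i)); last by rewrite -exprD subnKC // ltnW.
    by rewrite le_eqVlt; apply/orP; left; apply/eqP; ring.
  rewrite sumr_const card_ord -[_ *+ n]mulr_natl mulrCA ler_wpM2l ?mulr_ge0 //.
  rewrite exprMn ler_wpM2r ?exprn_ge0 //.
  by apply: le_trans (succ_le_exp2 n); rewrite ler_nat.
rewrite cmodM mulrAC ler_wpM2r ?cmod_ge0 //.
apply: le_trans (csum_err _ q01 Ha) _.
rewrite mulrAC ler_wpM2l ?mulr_ge0 // exprMn ler_peMl ?exprn_ge0 //.
by rewrite exprn_ege1 // ler1n.
Qed.

End PowerSeries.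

(** * Power series with a Cauchy bound on their coefficients *)

Section Evaluation.
Variable R : realType.
Local Notation C := R[i].
Implicit Types (a b : nat -> C) (c : nat -> nat -> C).

Definition coef_bound (d M : R) a := forall k, cmod (a k) * d ^+ k <= M.

Definition psum a (z : C) : C := csum (fun k => a k * z ^+ k).

Lemma coef_bound_ge0 d M a : coef_bound d M a -> 0 <= M.
Proof. by move/(_ 0%N); rewrite expr0 mulr1; apply: le_trans; exact: cmod_ge0. Qed.

Lemma coef_bound_geodom d M a z q : 0 <= q -> cmod z <= q * d ->
  coef_bound d M a -> geodom q M (fun k => a k * z ^+ k).
Proof.
move=> q0 zq Ha k; rewrite cmodM cmodX.
apply: le_trans (_ : cmod (a k) * (q * d) ^+ k <= _).
  by rewrite ler_wpM2l ?cmod_ge0 // lerXn2r ?nnegrE ?cmod_ge0 // (le_trans (cmod_ge0 z)).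
by rewrite exprMn mulrCA mulrC ler_wpM2r ?exprn_ge0.
Qed.

Lemma half_q01 : (0 <= (2^-1 : R)) && ((2^-1 : R) < 1).
Proof. by apply/andP; split; lra. Qed.

Lemma quarter_q01 : (0 <= (4^-1 : R)) && ((4^-1 : R) < 1).
Proof. by apply/andP; split; lra. Qed.

Lemma coef_bound_half d M a z : cmod z <= d / 2 -> coef_bound d M a ->
  geodom 2^-1 M (fun k => a k * z ^+ k).
Proof. by move=> zd; apply: coef_bound_geodom; rewrite ?invr_ge0 // mulrC. Qed.

Lemma coef_bound_quarter d M a z : cmod z <= d / 4 -> coef_bound d M a ->
  geodom 4^-1 M (fun k => a k * z ^+ k).
Proof. by move=> zd; apply: coef_bound_geodom; rewrite ?invr_ge0 // mulrC. Qed.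

Lemma psum_le d M a z : cmod z <= d / 2 -> coef_bound d M a ->
  cmod (psum a z) <= 2 * M.
Proof.
move=> zd Ha; apply: le_trans (csum_le half_q01 (coef_bound_half zd Ha)) _.
by rewrite le_eqVlt; apply/orP; left; apply/eqP; field.
Qed.

Lemma psum_err d M a z n : cmod z <= d / 2 -> coef_bound d M a ->
  cmod (\sum_(k < n) a k * z ^+ k - psum a z) <= 2 * M * 2^-1 ^+ n.
Proof.
move=> zd Ha; apply: le_trans (csum_err n half_q01 (coef_bound_half zd Ha)) _.
by rewrite le_eqVlt; apply/orP; left; apply/eqP; field.
Qed.

Lemma psumD d M1 M2 a b z : cmod z <= d / 2 -> coef_bound d M1 a ->
  coef_bound d M2 b -> psum (fun k => a k + b k) z = psum a z + psum b z.
Proof.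
move=> zd Ha Hb; rewrite /psum.
rewrite -(csumD half_q01 (coef_bound_half zd Ha) (coef_bound_half zd Hb)).
by apply: csum_ext => k; rewrite mulrDl.
Qed.

Lemma psumZ d M a x z : cmod z <= d / 2 -> coef_bound d M a ->
  psum (fun k => x * a k) z = x * psum a z.
Proof.
move=> zd Ha; rewrite /psum -(csumZ x half_q01 (coef_bound_half zd Ha)).
by apply: csum_ext => k; rewrite mulrA.
Qed.

Lemma coef_boundD d M1 M2 a b : 0 <= d -> coef_bound d M1 a ->
  coef_bound d M2 b -> coef_bound d (M1 + M2) (fun k => a k + b k).
Proof.
move=> d0 Ha Hb k; apply: le_trans (lerD (Ha k) (Hb k)).
by rewrite -mulrDl ler_wpM2r ?exprn_ge0 // cmodD.
Qed.

Lemma coef_boundZ d M x a : coef_bound d M a ->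
  coef_bound d (cmod x * M) (fun k => x * a k).
Proof. by move=> Ha k; rewrite cmodM -mulrA ler_wpM2l ?cmod_ge0. Qed.

Lemma coef_bound_cprod d M1 M2 a b : 0 <= d -> coef_bound d M1 a ->
  coef_bound d M2 b -> coef_bound (d / 2) (M1 * M2) (cprod a b).
Proof.
move=> d0 Ha Hb k.
apply: le_trans (_ : k.+1%:R * (M1 * M2) * 2^-1 ^+ k <= _).
  rewrite exprMn [leLHS]mulrA ler_wpM2r ?exprn_ge0 ?invr_ge0 //.
  apply: le_trans (ler_wpM2r (exprn_ge0 _ d0) (cmod_sum _ _ _)) _.
  rewrite big_distrl /=.
  apply: (@le_trans _ _ (\sum_(l < k.+1) M1 * M2)); last first.
    by rewrite sumr_const card_ord mulr_natl.
  apply: ler_sum => -[l /= lk] _.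
  rewrite cmodM (_ : d ^+ k = d ^+ l * d ^+ (k - l)); last by rewrite -exprD subnKC.
  by rewrite mulrACA ler_pM ?mulr_ge0 ?cmod_ge0 ?exprn_ge0.
rewrite mulrAC ler_piMl ?mulr_ge0 ?(coef_bound_ge0 Ha) ?(coef_bound_ge0 Hb) //.
by rewrite exprVn ler_pdivrMr ?exprn_gt0 // mul1r succ_le_exp2.
Qed.

Lemma psumM d M1 M2 a b z : cmod z <= d / 4 -> coef_bound d M1 a ->
  coef_bound d M2 b -> psum (cprod a b) z = psum a z * psum b z.
Proof.
move=> zd Ha Hb; rewrite /psum.
have q0 : (0 : R) <= 4^-1 by lra.
have q1 : 2 * 4^-1 < 1 :> R by lra.
rewrite -(csumM q0 q1 (coef_bound_quarter zd Ha) (coef_bound_quarter zd Hb)).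
apply: csum_ext => k; rewrite /cprod mulr_suml; apply: eq_bigr => -[l /= lk] _.
by rewrite mulrACA -exprD subnKC.
Qed.

Lemma psum_fin n a z : (forall k, (n <= k)%N -> a k = 0) ->
  psum a z = \sum_(k < n) a k * z ^+ k.
Proof. by move=> Ha; apply: csum_fin => k /Ha ->; rewrite mul0r. Qed.

Lemma psum0 z : psum (fun=> 0) z = 0.
Proof. by rewrite (psum_fin (n := 0)) // big_ord0. Qed.

Lemma psum_at0 a : psum a 0 = a 0%N.
Proof.
rewrite /psum (csum_fin (n := 1)) ?big_ord1 ?expr0 ?mulr1 // => k k0.
by rewrite expr0n -(prednK k0) mulr0.
Qed.

Lemma csum_shift q M (u : nat -> C) : 0 <= q < 1 -> geodom q M u ->
  csum u = u 0%N + csum (fun k => u k.+1).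
Proof.
move=> q01 H; have [q0 q1] := andP q01.
have H' : geodom q (M * q) (fun k => u k.+1).
  by move=> k; rewrite -mulrA -exprS.
set l := u 0%N + _.
have K0 : 0 <= M / (1 - q) by rewrite divr_ge0 ?(geodom_M_ge0 H) // subr_ge0 ltW.
apply: (csum_eq (K := cmod l + M / (1 - q)) q01 H q01) => -[|n].
  by rewrite big_ord0 sub0r cmodN expr0 mulr1 lerDl.
rewrite big_ord_recl /= /l opprD addrACA subrr add0r.
apply: le_trans (csum_err n q01 H') _.
rewrite (_ : M * q * q ^+ n / (1 - q) = M / (1 - q) * q ^+ n.+1); last first.
  by rewrite exprS; ring.
rewrite [leRHS]mulrDl lerDr.
by rewrite mulr_ge0 ?cmod_ge0 ?exprn_ge0.
Qed.

Definition dcoef a k := k.+1%:R * a k.+1.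

Lemma coef_bound_dcoef d M a : 0 < d -> coef_bound d M a ->
  coef_bound (d / 2) (M / d) (dcoef a).
Proof.
move=> d0 Ha k; rewrite /dcoef cmodM cmod_nat exprMn exprVn ler_pdivlMr //.
have -> : k.+1%:R * cmod (a k.+1) * (d ^+ k / 2 ^+ k) * d =
  (k.+1%:R / 2 ^+ k) * (cmod (a k.+1) * d ^+ k.+1) by rewrite exprS; ring.
apply: le_trans (_ : _ <= 1 * M) _; last by rewrite mul1r.
apply: ler_pM; rewrite ?divr_ge0 ?exprn_ge0 ?mulr_ge0 ?cmod_ge0 ?exprn_ge0 ?(ltW d0) //.
by rewrite ler_pdivrMr ?exprn_gt0 // mul1r succ_le_exp2.
Qed.

(** By induction on [k], from [z^(k+1) = z z^k]. The factor [p^2] on the left avoids the exponent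
    [k - 2]; for [k = 0] the truncated [k.-1] is multiplied by [0]. *)
Lemma expr_taylor1 (z h : C) (p : R) k : 0 < p -> cmod z <= p ->
  cmod (z + h) <= p ->
  cmod ((z + h) ^+ k - z ^+ k - h * (k%:R * z ^+ k.-1)) * p ^+ 2 <=
  k%:R ^+ 2 * cmod h ^+ 2 * p ^+ k.
Proof.
move=> p0 zp zhp; have p0' := ltW p0.
elim: k => [|k IH]; first by rewrite !expr0 mul0r mulr0 subr0 subrr cmod0 mul0r mulr_ge0 ?mulr_ge0 ?exprn_ge0 ?cmod_ge0.
have -> : (z + h) ^+ k.+1 - z ^+ k.+1 - h * (k.+1%:R * z ^+ k.+1.-1) =
  (z + h) * ((z + h) ^+ k - z ^+ k - h * (k%:R * z ^+ k.-1)) +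
  h ^+ 2 * (k%:R * z ^+ k.-1).
  case: k {IH} => [|k]; first by rewrite !expr1 !expr0 /=; ring.
  by rewrite /= !exprS -natr1; ring.
apply: le_trans (ler_wpM2r (exprn_ge0 _ p0') (cmodD _ _)) _.
rewrite mulrDl.
set X := (z + h) ^+ k - _ - _ in IH *.
have E1 : cmod ((z + h) * X) * p ^+ 2 <= p * (k%:R ^+ 2 * cmod h ^+ 2 * p ^+ k).
  by rewrite cmodM -mulrA ler_pM ?mulr_ge0 ?cmod_ge0 ?exprn_ge0.
have E2 : cmod (h ^+ 2 * (k%:R * z ^+ k.-1)) * p ^+ 2 <=
   p * (k%:R * cmod h ^+ 2 * p ^+ k).
  rewrite !cmodM !cmodX cmod_nat.
  case: k {X IH E1} => [|k]; first by rewrite !mul0r mulr0 mul0r mulr0.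
  rewrite /=.
  have zk : cmod z ^+ k <= p ^+ k by rewrite lerXn2r ?nnegrE ?cmod_ge0.
  have -> : cmod h ^+ 2 * (k.+1%:R * cmod z ^+ k) * p ^+ 2 =
    cmod h ^+ 2 * k.+1%:R * p ^+ 2 * cmod z ^+ k by ring.
  have -> : p * (k.+1%:R * cmod h ^+ 2 * p ^+ k.+1) =
    cmod h ^+ 2 * k.+1%:R * p ^+ 2 * p ^+ k by rewrite (exprS p k); ring.
  by rewrite ler_wpM2l ?mulr_ge0 ?exprn_ge0 ?cmod_ge0.
apply: le_trans (lerD E1 E2) _.
rewrite -mulrDr -!mulrDl mulrCA -exprS ler_wpM2r ?exprn_ge0 //.
rewrite ler_wpM2r ?exprn_ge0 ?cmod_ge0 // -natr1.
have : 0 <= k%:R :> R by [].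
by move: (k%:R : R) => t; nra.
Qed.

(** Termwise use of [expr_taylor1]. On the disc of radius [d / 8] there is a factor [8^-k], of which
    [2^-k] absorbs the [k^2] and [4^-k] makes the series summable. *)
Lemma psum_taylor1 d M a z h : 0 < d -> coef_bound d M a ->
  cmod z <= d / 8 -> cmod (z + h) <= d / 8 ->
  cmod (psum a (z + h) - psum a z - h * psum (dcoef a) z) <=
  384 * M / d ^+ 2 * cmod h ^+ 2.
Proof.
move=> d0 Ha zd zhd; have M0 := coef_bound_ge0 Ha.
have zd2 : cmod z <= d / 2 by lra.
have zhd2 : cmod (z + h) <= d / 2 by lra.
have G0 := coef_bound_half zd2 Ha; have G1 := coef_bound_half zhd2 Ha.
have zd4 : cmod z <= d / 2 / 2 by lra.
have G2 := coef_bound_half zd4 (coef_bound_dcoef d0 Ha).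
pose u k := a k * (k%:R * z ^+ k.-1).
have G3 : geodom 2^-1 (2 * (M / d)) u.
  case=> [|k]; first by rewrite /u mul0r mulr0 cmod0 expr0 mulr1 mulr_ge0 // divr_ge0 // ltW.
  have := G2 k; rewrite /dcoef /u /= exprS => G.
  rewrite (mulrCA (a _)) mulrA; apply: le_trans G _.
  by rewrite le_eqVlt; apply/orP; left; apply/eqP; field; rewrite gt_eqF // expf_neq0 //; lra.
have -> : psum (dcoef a) z = csum u.
  rewrite (csum_shift half_q01 G3) {1}/u mul0r mulr0 add0r; apply: csum_ext => k.
  by rewrite /u /dcoef /= (mulrCA (a _)) mulrA.
pose E k := (z + h) ^+ k - z ^+ k - h * (k%:R * z ^+ k.-1).
have -> : psum a (z + h) - psum a z - h * csum u = csum (fun k => a k * E k).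
  have -> : psum a (z + h) - psum a z - h * csum u =
     psum a (z + h) + (-1) * psum a z + (- h) * csum u by rewrite mulN1r mulNr.
  rewrite -(csumZ (-1) half_q01 G0) -(csumZ (- h) half_q01 G3).
  rewrite /psum -(csumD half_q01 G1 (geodomZ _ G0)).
  rewrite -(csumD half_q01 (geodomD G1 (geodomZ _ G0)) (geodomZ _ G3)).
  by apply: csum_ext => k; rewrite /E /u; ring.
have p0 : 0 < d / 8 by lra.
have HE : geodom 4^-1 (192 * M / d ^+ 2 * cmod h ^+ 2) (fun k => a k * E k).
  move=> k; have := expr_taylor1 k p0 zd zhd; rewrite -/(E k) => Ek.
  rewrite cmodM; have d80 : 0 < (d / 8) ^+ 2 by rewrite exprn_gt0.
  rewrite -(ler_pM2r d80) -[leLHS]mulrA.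
  apply: le_trans (ler_wpM2l (cmod_ge0 _) Ek) _.
  have -> : cmod (a k) * (k%:R ^+ 2 * cmod h ^+ 2 * (d / 8) ^+ k) =
     (cmod (a k) * d ^+ k) * (k%:R ^+ 2 / 8 ^+ k) * cmod h ^+ 2.
    by rewrite expr_div_n; ring.
  have -> : 192 * M / d ^+ 2 * cmod h ^+ 2 * 4^-1 ^+ k * (d / 8) ^+ 2 =
     M * (3 * 4^-1 ^+ k) * cmod h ^+ 2 by field; rewrite gt_eqF.
  rewrite ler_wpM2r ?exprn_ge0 ?cmod_ge0 //.
  apply: ler_pM; rewrite ?divr_ge0 ?exprn_ge0 ?mulr_ge0 ?cmod_ge0 ?exprn_ge0 ?(ltW d0) //.
  rewrite ler_pdivrMr ?exprn_gt0 // (_ : 8 = 4 * 2); last by ring.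
  by rewrite exprMn mulrA -(mulrA 3) -exprMn mulVf ?expr1n ?mulr1 ?sqr_le_exp2.
apply: le_trans (csum_le quarter_q01 HE) _.
have : 0 <= M / d ^+ 2 * cmod h ^+ 2 by rewrite mulr_ge0 ?divr_ge0 ?exprn_ge0 ?cmod_ge0 // ltW.
set T := M / d ^+ 2 * cmod h ^+ 2 => T0.
rewrite (_ : _ / (1 - 4^-1) = 256 * T); last by rewrite /T; field; rewrite gt_eqF.
by rewrite (_ : 384 * M / d ^+ 2 * cmod h ^+ 2 = 384 * T) ?ler_wpM2r ?ler_nat // /T; ring.
Qed.

(** Differentiability without a quotient, so that [h = 0] is no exception. *)
Definition has_cderiv (f : C -> C) (x D : C) := forall e : R, 0 < e ->
  exists2 r : R, 0 < r &
  forall h, cmod h < r -> cmod (f (x + h) - f x - h * D) <= e * cmod h.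

Lemma psum_deriv d M a z : 0 < d -> coef_bound d M a -> cmod z < d / 8 ->
  has_cderiv (psum a) z (psum (dcoef a) z).
Proof.
move=> d0 Ha zd e e0; have M0 := coef_bound_ge0 Ha.
set K := 384 * M / d ^+ 2.
have K0 : 0 <= K by rewrite divr_ge0 ?mulr_ge0 ?ler0n ?exprn_ge0 ?M0 ?(ltW d0).
exists (Num.min (d / 8 - cmod z) (e / (K + 1))).
  by rewrite lt_min subr_gt0 zd divr_gt0 // ltr_wpDl.
move=> h; rewrite lt_min => /andP[h1 h2].
apply: le_trans (psum_taylor1 d0 Ha (ltW zd) _) _.
  by apply: le_trans (cmodD _ _) _; lra.
rewrite -/K expr2 mulrA ler_wpM2r ?cmod_ge0 //.
move: h2; rewrite ltr_pdivlMr ?ltr_wpDl // => h2.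
by have := cmod_ge0 h; nra.
Qed.

(** Identity theorem. If [a k] were the first nonzero coefficient, [a k z^k] would dominate the
    tail, of order [(|z| / d)^(k+1)], at a zero [z] sufficiently close to the origin. *)
Lemma psum_zero_seq d M a : 0 < d -> coef_bound d M a ->
  (forall r : R, 0 < r -> exists z, [/\ z != 0, cmod z < r & psum a z = 0]) ->
  forall k, a k = 0.
Proof.
move=> d0 Ha Hz k; have M0 := coef_bound_ge0 Ha.
elim/ltn_ind: k => k IH; apply/eqP; rewrite -cmod_eq0 eq_le cmod_ge0 andbT.
rewrite leNgt; apply/negP => ak0.
have [|z [z0 zr pz]] := Hz (Num.min (d / 2) (cmod (a k) * d ^+ k.+1 / (2 * M + 1))).
  by rewrite lt_min !(divr_gt0, mulr_gt0) // ?exprn_gt0 //; lra.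
move: zr; rewrite lt_min => /andP[z1 z2].
have cz : 0 < cmod z by rewrite cmod_gt0.
have q0 : 0 <= cmod z / d by rewrite divr_ge0 ?cmod_ge0 // ltW.
have q1 : cmod z / d <= 2^-1 by rewrite ler_pdivrMr // mulrC; exact: ltW.
have q01 : 0 <= cmod z / d < 1 by rewrite q0 /=; lra.
have zq : cmod z <= cmod z / d * d by rewrite divfK // gt_eqF.
have := csum_err k.+1 q01 (coef_bound_geodom q0 zq Ha).
rewrite -/(psum a z) pz subr0 big_ord_recr big1 /=; last first.
  by move=> -[i /= ik] _; rewrite IH // mul0r.
rewrite add0r cmodM cmodX; apply/negP; rewrite -ltNge.
apply: (@le_lt_trans _ _ (2 * M * (cmod z / d) ^+ k.+1)).
  rewrite ler_pdivrMr; last lra.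
  rewrite (_ : 2 * M * _ * _ = M * (cmod z / d) ^+ k.+1 * (2 * (1 - cmod z / d))); last by ring.
  by rewrite ler_peMr ?mulr_ge0 ?exprn_ge0 //; lra.
rewrite exprMn exprVn exprS.
rewrite [ltLHS](_ : _ = (2 * M * cmod z / d ^+ k.+1) * cmod z ^+ k); last by ring.
rewrite ltr_pM2r ?exprn_gt0 // ltr_pdivrMr ?exprn_gt0 //.
move: z2; rewrite ltr_pdivlMr; last lra.
by apply: le_lt_trans; nra.
Qed.

End Evaluation.

(** * Double power series *)

Section Contraction.
Variables (R : realType) (I : Type) (w : I -> R) (Q : (I -> R[i]) -> I -> R[i]).
Hypothesis w_gt0 : forall i, 0 < w i.
Hypothesis Q_sub : forall u v i, Q (fun k => u k - v k) i = Q u i - Q v i.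
Hypothesis Q_half : forall u K, (forall i, cmod (u i) * w i <= K) ->
  forall i, cmod (Q u i) * w i <= K / 2.

(** Each use of [u = Q u] halves the bound. *)
Lemma contraction_unique u K : (forall i, cmod (u i) * w i <= K) ->
  (forall i, u i = Q u i) -> forall i, u i = 0.
Proof.
move=> uK uQ i; apply/eqP; rewrite -cmod_eq0 eq_le cmod_ge0 andbT.
rewrite -(pmulr_lle0 _ (w_gt0 i)).
apply: (@le_geometric0 _ _ K _ (half_q01 R)) => N.
elim: N i => [|N IH] i; first by rewrite expr0 mulr1.
by rewrite uQ exprSr mulrA; apply: Q_half.
Qed.

(** Neumann series: [v] is the sum of the iterates of [Q] at [e0]. That [Q] commutes with this
    infinite sum follows from [Q_half] applied to the tail [v - s N]. *)
Lemma contraction_exists (e0 : I -> R[i]) K : (forall i, cmod (e0 i) * w i <= K) ->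
  exists v, (forall i, v i = e0 i + Q v i) /\ forall i, cmod (v i) * w i <= 2 * K.
Proof.
move=> eK; pose D N := iter N Q e0.
have DK N i : cmod (D N i) * w i <= K * 2^-1 ^+ N.
  elim: N i => [|N IH] i; first by rewrite expr0 mulr1.
  by rewrite exprSr mulrA /D iterS; apply: Q_half.
have DG i : geodom 2^-1 (K / w i) (fun N => D N i).
  by move=> N; rewrite mulrAC ler_pdivlMr.
pose v i := csum (fun N => D N i).
pose s N i := \sum_(k < N) D k i.
have vs N i : cmod (v i - s N i) * w i <= 2 * K * 2^-1 ^+ N.
  rewrite -ler_pdivlMr // cmodB; apply: le_trans (csum_err N (half_q01 R) (DG i)) _.
  rewrite le_eqVlt; apply/orP; left; apply/eqP; field.
  by rewrite gt_eqF.
have Q0 i : Q (fun=> 0) i = 0.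
  have -> : (fun=> 0) = (fun k : I => (0 : R[i]) - 0) by apply/funext => k; rewrite subrr.
  by rewrite Q_sub subrr.
have sS N i : s N.+1 i = e0 i + Q (s N) i.
  elim: N i => [|N IH] i.
    rewrite /s big_ord1 (_ : (fun _ => _) = fun=> 0) ?Q0 ?addr0 //.
    by apply/funext => k; rewrite big_ord0.
  rewrite /s big_ord_recr /= -/(s _ _) IH -addrA; congr (_ + _).
  have := Q_sub (s N.+1) (s N) i.
  have -> : (fun k => s N.+1 k - s N k) = D N.
    by apply/funext => k; rewrite /s big_ord_recr /= [X in X - _]addrC addrK.
  by rewrite -/(D N.+1 i) => ->; rewrite addrCA subrr addr0.
exists v; split=> i; last first.
  by have := vs 0%N i; rewrite /s big_ord0 subr0 expr0 mulr1.
apply/eqP; rewrite -subr_eq0 -cmod_eq0 eq_le cmod_ge0 andbT.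
rewrite -(pmulr_lle0 _ (w_gt0 i)).
apply: (@le_geometric0 _ _ (2 * K) _ (half_q01 R)) => N.
have -> : v i - (e0 i + Q v i) = (v i - s N.+1 i) - Q (fun k => v k - s N k) i.
  by rewrite sS Q_sub; ring.
apply: le_trans (ler_wpM2r (ltW (w_gt0 i)) (cmod_triB _ _)) _; rewrite mulrDl.
apply: le_trans (lerD (vs N.+1 i) (Q_half (vs N) i)) _.
by rewrite exprS le_eqVlt; apply/orP; left; apply/eqP; field.
Qed.

End Contraction.

(** * Algebra and evaluation of double series *)

Section DoubleSeries.
Variable R : realType.
Local Notation C := R[i].
Implicit Types (c v : nat -> nat -> C).

Lemma psum_ext (a b : nat -> C) z : a =1 b -> psum a z = psum b z.
Proof. by move=> /funext ->. Qed.

Definition coef_bound2 (d M : R) c := forall a k, cmod (c a k) * d ^+ (a + k) <= M.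

(** Summed first over the powers of [e]: for fixed [e] this is a power series in [x], the form in
    which the differential equation is compared coefficient by coefficient. *)
Definition psum2 c (e x : C) : C := psum (fun k => psum (c ^~ k) e) x.

Definition cprod2 c v a k :=
  \sum_(m < k.+1) \sum_(b < a.+1) c b m * v (a - b)%N (k - m)%N.

Lemma csum_sum q (I : Type) (r : seq I) (F : I -> nat -> C) : 0 <= q < 1 ->
  (forall i, exists M, geodom q M (F i)) ->
  (exists M, geodom q M (fun k => \sum_(i <- r) F i k)) /\
  csum (fun k => \sum_(i <- r) F i k) = \sum_(i <- r) csum (F i).
Proof.
move=> q01 H; elim: r => [|i r [[M1 IH1] IH2]].
  split; first by exists 0 => k; rewrite big_nil cmod0 mul0r.
  by rewrite big_nil -[RHS](csum0 R); apply: csum_ext => k; rewrite big_nil.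
have [M2 H2] := H i.
have E k : \sum_(j <- i :: r) F j k = F i k + \sum_(j <- r) F j k by rewrite big_cons.
split; first by exists (M2 + M1) => k; rewrite E; exact: (geodomD H2 IH1 k).
by rewrite (csum_ext E) (csumD q01 H2 IH1) IH2 big_cons.
Qed.

Lemma psum_sum d (I : Type) (r : seq I) (F : I -> nat -> C) z : cmod z <= d / 2 ->
  (forall i, exists M, coef_bound d M (F i)) ->
  psum (fun k => \sum_(i <- r) F i k) z = \sum_(i <- r) psum (F i) z.
Proof.
move=> zd H.
have [|_ <-] := csum_sum r (F := fun i k => F i k * z ^+ k) (half_q01 R).
  by move=> i; have [M HM] := H i; exists M; apply: (coef_bound_half zd).
by apply: csum_ext => k; rewrite mulr_suml.
Qed.

Lemma coef_bound2_col d M c k : 0 < d -> coef_bound2 d M c ->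
  coef_bound d (M / d ^+ k) (c ^~ k).
Proof.
move=> d0 H a; rewrite ler_pdivlMr ?exprn_gt0 // -mulrA -exprD; exact: H.
Qed.

Lemma coef_bound2_ge0 d M c : coef_bound2 d M c -> 0 <= M.
Proof. by move/(_ 0%N 0%N); rewrite expr0 mulr1; apply: le_trans; exact: cmod_ge0. Qed.

Lemma coef_bound2_rows d M c e : 0 < d -> coef_bound2 d M c -> cmod e <= d / 2 ->
  coef_bound d (2 * M) (fun k => psum (c ^~ k) e).
Proof.
move=> d0 H ed k; have := psum_le ed (coef_bound2_col k d0 H).
by rewrite mulrA ler_pdivlMr ?exprn_gt0.
Qed.

Lemma coef_bound2W d d' M M' c : 0 <= d' <= d -> M <= M' ->
  coef_bound2 d M c -> coef_bound2 d' M' c.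
Proof.
move=> /andP[d0 dd] MM H a k; apply: le_trans MM; apply: le_trans (H a k).
by rewrite ler_wpM2l ?cmod_ge0 // lerXn2r ?nnegrE // (le_trans d0).
Qed.

Lemma coef_bound2D d M1 M2 c c' : 0 <= d -> coef_bound2 d M1 c ->
  coef_bound2 d M2 c' -> coef_bound2 d (M1 + M2) (fun a k => c a k + c' a k).
Proof.
move=> d0 H H' a k; apply: le_trans (lerD (H a k) (H' a k)).
by rewrite -mulrDl ler_wpM2r ?exprn_ge0 // cmodD.
Qed.

Lemma coef_bound2Z d M z c : coef_bound2 d M c ->
  coef_bound2 d (cmod z * M) (fun a k => z * c a k).
Proof. by move=> H a k; rewrite cmodM -mulrA ler_wpM2l ?cmod_ge0. Qed.

Lemma psum2D d M1 M2 c c' e x : 0 < d -> cmod e <= d / 2 -> cmod x <= d / 2 ->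
  coef_bound2 d M1 c -> coef_bound2 d M2 c' ->
  psum2 (fun a k => c a k + c' a k) e x = psum2 c e x + psum2 c' e x.
Proof.
move=> d0 ed xd H H'; rewrite /psum2.
rewrite -(psumD xd (coef_bound2_rows d0 H ed) (coef_bound2_rows d0 H' ed)).
apply: psum_ext => k.
exact: (psumD ed (coef_bound2_col k d0 H) (coef_bound2_col k d0 H')).
Qed.

Lemma psum2Z d M z c e x : 0 < d -> cmod e <= d / 2 -> cmod x <= d / 2 ->
  coef_bound2 d M c -> psum2 (fun a k => z * c a k) e x = z * psum2 c e x.
Proof.
move=> d0 ed xd H; rewrite /psum2 -(psumZ z xd (coef_bound2_rows d0 H ed)).
apply: psum_ext => k; exact: (psumZ _ ed (coef_bound2_col k d0 H)).
Qed.

Lemma coef_bound2_cprod d M1 M2 c c' : 0 < d -> coef_bound2 d M1 c ->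
  coef_bound2 d M2 c' -> coef_bound2 (d / 2) (M1 * M2) (cprod2 c c').
Proof.
move=> d0 H H' a k; have dk m : 0 < d ^+ m by rewrite exprn_gt0.
rewrite exprD mulrA.
have E : cmod (cprod2 c c' a k) * (d / 2) ^+ a <= k.+1%:R * (M1 * M2 / d ^+ k).
  apply: le_trans (ler_wpM2r _ (cmod_sum _ _ _)) _.
    by rewrite exprn_ge0 // divr_ge0 // ltW.
  rewrite mulr_suml; apply: (@le_trans _ _ (\sum_(l < k.+1) M1 * M2 / d ^+ k)); last first.
    by rewrite sumr_const card_ord mulr_natl.
  apply: ler_sum => -[m /= mk] _.
  have := coef_bound_cprod (ltW d0) (coef_bound2_col m d0 H)
    (coef_bound2_col (k - m) d0 H') a.
  rewrite mulrACA -invfM -exprD subnKC //.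
apply: le_trans (ler_wpM2r _ E) _; first by rewrite exprn_ge0 // divr_ge0 // ltW.
rewrite exprMn (_ : _ * _ = (k.+1%:R / 2 ^+ k) * (M1 * M2)).
  rewrite ler_piMl ?mulr_ge0 ?(coef_bound2_ge0 H) ?(coef_bound2_ge0 H') //.
  by rewrite ler_pdivrMr ?exprn_gt0 // mul1r succ_le_exp2.
by rewrite exprVn; field; rewrite !expf_neq0 // gt_eqF.
Qed.

Lemma psum2M d M1 M2 c c' e x : 0 < d -> cmod e <= d / 4 -> cmod x <= d / 4 ->
  coef_bound2 d M1 c -> coef_bound2 d M2 c' ->
  psum2 (cprod2 c c') e x = psum2 c e x * psum2 c' e x.
Proof.
move=> d0 ed xd H H'.
have ed2 : cmod e <= d / 2 by lra.
rewrite /psum2 -(psumM xd (coef_bound2_rows d0 H ed2) (coef_bound2_rows d0 H' ed2)).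
apply: psum_ext => k; rewrite /cprod2.
rewrite (@psum_sum (d / 2) _ _ (fun (m : 'I_k.+1) a => \sum_(b < a.+1) c b m * c' (a - b)%N (k - m)%N)).
- apply: eq_bigr => m _.
  exact: (psumM ed (coef_bound2_col m d0 H) (coef_bound2_col (k - m) d0 H')).
- by lra.
- move=> m; eexists; apply: (coef_bound_cprod (ltW d0) (coef_bound2_col m d0 H)
    (coef_bound2_col (k - m) d0 H')).
Qed.

Lemma psum2_sum d (I : Type) (r : seq I) (F : I -> nat -> nat -> C) e x :
  0 < d -> cmod e <= d / 2 -> cmod x <= d / 2 ->
  (forall i, exists M, coef_bound2 d M (F i)) ->
  (exists M, coef_bound2 d M (fun a k => \sum_(i <- r) F i a k)) /\
  psum2 (fun a k => \sum_(i <- r) F i a k) e x = \sum_(i <- r) psum2 (F i) e x.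
Proof.
move=> d0 ed xd H; split.
  elim: r => [|i r [M1 IH]].
    by exists 0 => a k; rewrite big_nil cmod0 mul0r.
  have [M2 H2] := H i; exists (M2 + M1) => a k; rewrite big_cons.
  exact: (coef_bound2D (ltW d0) H2 IH).
rewrite /psum2 -(psum_sum _ xd).
  apply: psum_ext => k; rewrite -(psum_sum _ ed) // => i.
  by have [M HM] := H i; exists (M / d ^+ k); apply: coef_bound2_col.
by move=> i; have [M HM] := H i; exists (2 * M); apply: coef_bound2_rows.
Qed.

Definition xshift c a k := if k is k'.+1 then c a k' else 0.
Definition eshift c a k := if a is a'.+1 then c a' k else 0.
Definition dxcoef c a k := k.+1%:R * c a k.+1.

Lemma psum_shift d M (a : nat -> C) z : 0 < d -> cmod z <= d / 2 -> coef_bound d M a ->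
  psum (fun k => if k is k'.+1 then a k' else 0) z = z * psum a z.
Proof.
move=> d0 zd H; rewrite /psum.
have G : geodom 2^-1 (2 * cmod z * M) (fun k => (if k is k'.+1 then a k' else 0) * z ^+ k).
  case=> [|k]; first by rewrite mul0r cmod0 mulr_ge0 ?mulr_ge0 ?exprn_ge0 ?cmod_ge0 ?(coef_bound_ge0 H).
  rewrite exprS mulrCA cmodM.
  rewrite [leRHS](_ : _ = cmod z * (M * 2^-1 ^+ k)); last by rewrite exprS; field.
  by rewrite ler_wpM2l ?cmod_ge0 //; apply: coef_bound_half zd H k.
rewrite (csum_shift (half_q01 R) G) mul0r add0r.
rewrite -(csumZ z (half_q01 R) (coef_bound_half zd H)).
by apply: csum_ext => k; rewrite exprS mulrCA.
Qed.

Lemma coef_bound2_xshift d M c : 0 <= d -> coef_bound2 d M c ->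
  coef_bound2 d (d * M) (xshift c).
Proof.
move=> d0 H a [|k] /=; first by rewrite cmod0 mul0r mulr_ge0 ?(coef_bound2_ge0 H).
by rewrite addnS exprS mulrCA ler_wpM2l.
Qed.

Lemma coef_bound2_eshift d M c : 0 <= d -> coef_bound2 d M c ->
  coef_bound2 d (d * M) (eshift c).
Proof.
move=> d0 H [|a] k /=; first by rewrite cmod0 mul0r mulr_ge0 ?(coef_bound2_ge0 H).
by rewrite addSn exprS mulrCA ler_wpM2l.
Qed.

Lemma psum2_xshift d M c e x : 0 < d -> cmod e <= d / 2 -> cmod x <= d / 2 ->
  coef_bound2 d M c -> psum2 (xshift c) e x = x * psum2 c e x.
Proof.
move=> d0 ed xd H; rewrite /psum2 -(psum_shift d0 xd (coef_bound2_rows d0 H ed)).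
by apply: psum_ext => -[|k] //=; exact: psum0.
Qed.

Lemma psum2_eshift d M c e x : 0 < d -> cmod e <= d / 2 -> cmod x <= d / 2 ->
  coef_bound2 d M c -> psum2 (eshift c) e x = e * psum2 c e x.
Proof.
move=> d0 ed xd H; rewrite /psum2 -(psumZ e xd (coef_bound2_rows d0 H ed)).
apply: psum_ext => k; rewrite -(psum_shift d0 ed (coef_bound2_col k d0 H)).
by apply: psum_ext => -[|a].
Qed.

Lemma psum2_deriv d M c e x : 0 < d -> cmod e <= d / 2 -> cmod x < d / 8 ->
  coef_bound2 d M c -> has_cderiv (psum2 c e) x (psum2 (dxcoef c) e x).
Proof.
move=> d0 ed xd H.
rewrite (_ : psum2 (dxcoef c) e x = psum (dcoef (fun k => psum (c ^~ k) e)) x).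
  exact: (psum_deriv d0 (coef_bound2_rows d0 H ed) xd).
apply: psum_ext => k.
by rewrite /dcoef /dxcoef (psumZ _ ed (coef_bound2_col k.+1 d0 H)).
Qed.

(** Connects the iterated sum [psum2] with the square partial sums in which [analytic2_at] is
    phrased. *)
Lemma psum2_square_err d M c e x N : 0 < d -> cmod e <= d / 2 -> cmod x <= d / 2 ->
  coef_bound2 d M c ->
  cmod (\sum_(a < N) \sum_(k < N) c a k * (e ^+ a * x ^+ k) - psum2 c e x) <=
  8 * M * 2^-1 ^+ N.
Proof.
move=> d0 ed xd H; have M0 := coef_bound2_ge0 H.
apply: le_trans (cmod_tri (\sum_(k < N) psum (c ^~ k) e * x ^+ k) _ _) _.
rewrite (_ : 8 * M * _ = 4 * M * 2^-1 ^+ N + 2 * (2 * M) * 2^-1 ^+ N); last by ring.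
apply: lerD; last exact: psum_err xd (coef_bound2_rows d0 H ed).
rewrite exchange_big /= -sumrB; apply: le_trans (cmod_sum _ _ _) _.
apply: (@le_trans _ _ (\sum_(k < N) 2 * M * 2^-1 ^+ N * 2^-1 ^+ (0 + k))); last first.
  rewrite -mulr_sumr; apply: le_trans (ler_wpM2l _ (geometric_sum_le _ _ (half_q01 R))) _.
    by rewrite !mulr_ge0 ?exprn_ge0.
  by rewrite expr0 le_eqVlt; apply/orP; left; apply/eqP; field.
apply: ler_sum => k _; rewrite add0n.
rewrite [X in cmod X](_ : _ = (\sum_(a < N) c a k * e ^+ a - psum (c ^~ k) e) * x ^+ k); last first.
  by rewrite mulrBl mulr_suml; congr (_ - _); apply: eq_bigr => a _; rewrite mulrA.
rewrite cmodM cmodX.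
have E := psum_err N ed (coef_bound2_col k d0 H).
apply: le_trans (ler_pM (cmod_ge0 _) (exprn_ge0 _ (cmod_ge0 _)) E (lerXn2r k _ _ xd)) _.
- exact: cmod_ge0.
- by rewrite nnegrE divr_ge0 // ltW.
rewrite exprMn [leLHS](_ : _ = 2 * (M / d ^+ k * d ^+ k) * 2^-1 ^+ N * 2^-1 ^+ k).
  by rewrite divfK // expf_neq0 // gt_eqF.
by ring.
Qed.

End DoubleSeries.

(** * The formal row *)

Section Operator.
Variables (R : realType) (n : nat) (j : 'I_n).
Local Notation C := R[i].
Local Notation index := (nat * nat * 'I_n)%type.
Implicit Types (c : nat -> nat -> C) (v : index -> C).

Definition column v i a k : C := v (a, k, i).

Lemma cprod2B c (u v : nat -> nat -> C) a k :
  cprod2 c (fun b l => u b l - v b l) a k = cprod2 c u a k - cprod2 c v a k.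
Proof.
rewrite /cprod2 -sumrB; apply: eq_bigr => m _; rewrite -sumrB.
by apply: eq_bigr => b _; rewrite mulrBr.
Qed.

(** The weighted norm of multiplication by [c] is at most the sum of the norms of its monomials:
    [g b m] bounds the coefficient [c b m] together with the change of weight from [(a - b, k - m)]
    to [(a, k)]. *)
Lemma cprod2_est c (v : nat -> nat -> C) (g : nat -> nat -> R) (K s : R) (w : nat -> R) a k :
  0 < s -> (forall l, 0 < w l) ->
  (forall b m, (b <= a)%N -> (m <= k)%N ->
     cmod (c b m) * (s ^+ a * w k) <= g b m * (s ^+ (a - b) * w (k - m)%N)) ->
  (forall b l, cmod (v b l) * (s ^+ b * w l) <= K) ->
  cmod (cprod2 c v a k) * (s ^+ a * w k) <=
  (\sum_(m < k.+1) \sum_(b < a.+1) g b m) * K.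
Proof.
move=> s0 w0 Hc Hv.
have p0 b l : 0 < s ^+ b * w l by rewrite mulr_gt0 ?exprn_gt0.
apply: le_trans (ler_wpM2r (ltW (p0 _ _)) (cmod_sum _ _ _)) _.
rewrite !mulr_suml; apply: ler_sum => -[m /= mk] _.
apply: le_trans (ler_wpM2r (ltW (p0 _ _)) (cmod_sum _ _ _)) _.
rewrite !mulr_suml; apply: ler_sum => -[b /= ba] _.
rewrite cmodM mulrAC.
have g0 : 0 <= g b m.
  rewrite -(pmulr_lge0 _ (p0 (a - b)%N (k - m)%N)).
  by apply: le_trans (Hc _ _ ba mk); rewrite mulr_ge0 ?cmod_ge0 // ltW.
apply: le_trans (ler_wpM2r (cmod_ge0 _) (Hc _ _ ba mk)) _.
by rewrite -mulrA ler_wpM2l // mulrC.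
Qed.

Lemma geometric_half_le (q : R) l m : 0 <= q <= 2^-1 ->
  \sum_(k < m) q ^+ (l + k) <= 2 * q ^+ l.
Proof.
move=> /andP[q0 q1]; have q01 : 0 <= q < 1 by rewrite q0 /=; lra.
apply: le_trans (geometric_sum_le _ _ q01) _.
rewrite ler_pdivrMr; last lra.
by rewrite mulrAC ler_peMl ?exprn_ge0 //; lra.
Qed.

Lemma geometric2_le (p q B : R) a k : 0 <= B -> 0 <= p <= 2^-1 -> 0 <= q <= 2^-1 ->
  \sum_(m < k.+1) \sum_(b < a.+1) B * p ^+ b * q ^+ m <= 4 * B.
Proof.
move=> B0 Hp Hq; have [q0 q1] := andP Hq.
apply: (@le_trans _ _ (\sum_(m < k.+1) 2 * B * q ^+ (0 + m))).
  apply: ler_sum => m _; rewrite -mulr_suml -mulr_sumr add0n ler_wpM2r ?exprn_ge0 //.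
  rewrite mulrC ler_wpM2r //.
  by have := geometric_half_le 0 a.+1 Hp; rewrite expr0 mulr1.
rewrite -mulr_sumr; have := geometric_half_le 0 k.+1 Hq; rewrite expr0 mulr1.
move=> /(ler_wpM2l (_ : 0 <= 2 * B)) H; apply: le_trans (H _) _; first exact: mulr_ge0.
by rewrite le_eqVlt; apply/orP; left; apply/eqP; ring.
Qed.

(** The constant term is separated because it gains no factor [p] or [q]; its smallness [eta] must
    come from elsewhere. *)
Lemma geometric2_tail_le (p q B eta : R) a k : 0 <= B ->
  0 <= p <= 2^-1 -> 0 <= q <= 2^-1 ->
  \sum_(m < k.+1) \sum_(b < a.+1)
    (if (b == 0%N :> nat) && (m == 0%N :> nat) then eta else B * p ^+ b * q ^+ m)
  <= eta + 4 * B * (p + q).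
Proof.
move=> B0 Hp Hq; have [p0 p1] := andP Hp; have [q0 q1] := andP Hq.
rewrite big_ord_recl big_ord_recl /= -addrA lerD2l.
rewrite (_ : 4 * B * (p + q) = 4 * B * p + 4 * B * q); last by ring.
apply: lerD.
  apply: (@le_trans _ _ (\sum_(b < a) B * p ^+ (1 + b))).
    by apply: ler_sum => b _ /=; rewrite expr0 mulr1.
  rewrite -mulr_sumr; apply: le_trans (ler_wpM2l B0 (geometric_half_le _ _ Hp)) _.
  by rewrite expr1; nra.
apply: (@le_trans _ _ (\sum_(m < k) \sum_(b < a.+1) B * q * p ^+ b * q ^+ m)).
  apply: ler_sum => m _; apply: ler_sum => b _ /=; rewrite andbF.
  by rewrite /bump /= add1n exprS le_eqVlt; apply/orP; left; apply/eqP; ring.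
case: k => [|k].
  by rewrite big_ord0 !mulr_ge0.
by rewrite -[leRHS]mulrA; apply: geometric2_le; rewrite // mulr_ge0.
Qed.

Variables (mu : 'I_n -> C) (T : 'I_n -> 'I_n -> nat -> nat -> C)
  (Rj : 'I_n -> nat -> nat -> C) (S : (nat -> nat -> C) -> nat -> nat -> C) (m : nat).

Definition vmulT v i a k : C := \sum_l cprod2 (T l i) (column v l) a k.
Definition vmulR v a k : C := \sum_l cprod2 (Rj l) (column v l) a k.

(** In the application the constant term of [T] is diagonal with entries [- mu i]. It is the part
    solved for in low degrees, so it is removed from the perturbation. *)
Definition T0 (l i : 'I_n) a k : C :=
  T l i a k + (if [&& a == 0%N, k == 0%N & l == i] then mu i else 0).

Definition vmulT0 v i a k : C := \sum_l cprod2 (T0 l i) (column v l) a k.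

(* [S] stands for multiplication by epsilon. Component [j] integrates
   [v_j' = - (v R)_j]; for the other components the coefficients of [x^k] of
   [(x^2 - epsilon) v_i' = (v T)_i] are solved for [v_k] when [k < m], where the
   term [mu v_k] dominates, and for [v_(k-1)] when [k > m], where [x^2 v'] does. *)
Definition solveQ v (p : index) : C :=
  let: (a, k, i) := p in
  if i == j then
    if k is k'.+1 then - ((k'.+1%:R : C)^-1 * vmulR v a k') else 0
  else if (k < m)%N then
    - ((mu i)^-1 *
       ((if k is k'.+1 then k'%:R * column v i a k' else 0)
        - k.+1%:R * S (column v i) a k.+1 - vmulT0 v i a k))
  else (k%:R : C)^-1 * (k.+2%:R * S (column v i) a k.+2 + vmulT v i a k.+1).

Hypothesis S_sub : forall (u v : nat -> nat -> C) a k,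
  S (fun b l => u b l - v b l) a k = S u a k - S v a k.

Lemma solveQ_sub (u v : index -> C) p :
  solveQ (fun x => u x - v x) p = solveQ u p - solveQ v p.
Proof.
have HE (F : 'I_n -> 'I_n -> nat -> nat -> C) (i : 'I_n) a k : \sum_l cprod2 (F l i) (column (fun x => u x - v x) l) a k =
    \sum_l cprod2 (F l i) (column u l) a k - \sum_l cprod2 (F l i) (column v l) a k :> C.
  by rewrite -sumrB; apply: eq_bigr => l _; rewrite -cprod2B.
case: p => [[a k] i]; rewrite /solveQ.
have ES k' : S (column (fun x => u x - v x) i) a k' =
    S (column u i) a k' - S (column v i) a k' by rewrite -S_sub.
case: ifP => _.
  case: k => [|k]; first by rewrite subrr.
  rewrite /vmulR (HE (fun l _ => Rj l) i) mulrBr opprB opprK addrC //.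
case: ifP => _; last by rewrite ES /vmulT (HE T i); ring.
rewrite ES /vmulT0 (HE T0 i); case: k => [|k]; first by ring.
by rewrite /column; ring.
Qed.

Variables (d B eta mu1 sg s1 s2 : R).
Hypothesis d_gt0 : 0 < d.
Hypothesis sg_gt0 : 0 < sg.
Hypothesis s1_gt0 : 0 < s1.
Hypothesis s12 : s1 <= s2.
Hypothesis s2d : s2 <= d / 2.
Hypothesis sgd : sg <= d / 2.
Hypothesis B_ge0 : 0 <= B.
Hypothesis m_gt0 : (0 < m)%N.
Hypothesis TB : forall l i, coef_bound2 d B (T l i).
Hypothesis RB : forall l, coef_bound2 d B (Rj l).
Hypothesis T00 : forall l i, cmod (T0 l i 0%N 0%N) <= eta.
Hypothesis mu_bound : forall i, i != j -> cmod (mu i)^-1 <= mu1.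
(** Holds for the shift [eshift] of the formal problem as well as for multiplication by a number of
    modulus at most [sg]. One estimate thus serves the existence of the formal row and uniqueness at
    a fixed epsilon. *)
Hypothesis S_bound : forall (u : nat -> nat -> C) k K,
  (forall a, cmod (u a k) * sg ^+ a <= K) ->
  forall a, cmod (S u a k) * sg ^+ a <= sg * K.
(** One condition for each kind of term in [solveQ]: [small_j] for component [j], [small_S] and
    [large_m] for the epsilon term and the product in degrees [k >= m], and [small_low] for
    everything in degrees [k < m]. *)
Hypothesis small_j : 4 * n%:R * B * s2 <= 2^-1.
Hypothesis small_S : 12 * sg <= s2 ^+ 2.
Hypothesis large_m : 16 * n%:R * B <= m%:R * s2.
Hypothesis small_low :
  mu1 * (m%:R * s1 + m%:R * (sg / s1) +
         n%:R * (eta + 4 * B * (sg / d + s1 / d))) <= 2^-1.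

(** Radius [s1] up to degree [m] and [s2] beyond. A single radius would not do: the low degrees
    require [m s1] to be small, the high degrees require [m s2] to be large. *)
Definition xweight k : R := s1 ^+ minn k m * s2 ^+ (k - m)%N.
Definition weight (p : index) : R := sg ^+ p.1.1 * xweight p.1.2.

Let s2_gt0 : 0 < s2. Proof. exact: lt_le_trans s12. Qed.

Lemma xweight_gt0 k : 0 < xweight k.
Proof. by rewrite mulr_gt0 ?exprn_gt0. Qed.

Lemma weight_gt0 p : 0 < weight p.
Proof. by rewrite mulr_gt0 ?exprn_gt0 ?xweight_gt0. Qed.

Lemma xweightS_low k : (k < m)%N -> xweight k.+1 = s1 * xweight k.
Proof.
move=> km; rewrite /xweight (minn_idPl km) (minn_idPl (ltnW km)) exprS mulrA.
by congr (_ * _); rewrite (eqP km) (eqP (ltnW km)).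
Qed.

Lemma xweightS_high k : (m <= k)%N -> xweight k.+1 = s2 * xweight k.
Proof.
move=> mk; rewrite /xweight (minn_idPr mk) (minn_idPr (leqW mk)).
by rewrite subSn // exprS mulrCA.
Qed.

Lemma xweightS_le k : xweight k.+1 <= s2 * xweight k.
Proof.
have [km|mk] := ltnP k m; last by rewrite xweightS_high.
by rewrite xweightS_low // ler_wpM2r // ltW // xweight_gt0.
Qed.

Lemma xweightD_le l k : xweight (k + l) <= s2 ^+ l * xweight k.
Proof.
elim: l => [|l IH]; first by rewrite addn0 mul1r.
rewrite addnS; apply: le_trans (xweightS_le _) _.
by rewrite exprS -mulrA ler_wpM2l // ltW.
Qed.

Lemma xweightD_low l k : (k + l <= m)%N -> xweight (k + l) = s1 ^+ l * xweight k.
Proof.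
elim: l => [|l IH]; first by rewrite addn0 mul1r.
by rewrite addnS => H; rewrite xweightS_low // IH 1?ltnW // exprS mulrA.
Qed.

Let p_half (s : R) : 0 < s -> s <= d / 2 -> 0 <= s / d <= 2^-1.
Proof.
move=> s0 sd; rewrite divr_ge0 ?(ltW s0) ?(ltW d_gt0) //=.
by rewrite ler_pdivrMr // mulrC.
Qed.

Let wx_ge0 a k : 0 <= sg ^+ a * xweight k.
Proof. by rewrite mulr_ge0 ?exprn_ge0 ?(ltW sg_gt0) ?(ltW (xweight_gt0 _)). Qed.

Section Bounds.
Variables (v : index -> C) (K : R).
Hypothesis vK : forall p, cmod (v p) * weight p <= K.

Let K_ge0 : 0 <= K.
Proof.
by apply: le_trans (vK (0%N, 0%N, j)); rewrite mulr_ge0 ?cmod_ge0 // ltW // weight_gt0.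
Qed.

Let column_bound i a k : cmod (column v i a k) * (sg ^+ a * xweight k) <= K.
Proof. exact: (vK (a, k, i)). Qed.

Lemma cprod2_bound c i a k : coef_bound2 d B c ->
  cmod (cprod2 c (column v i) a k) * (sg ^+ a * xweight k) <= 4 * B * K.
Proof.
move=> Hc.
apply: le_trans (cprod2_est (g := fun b l => B * (sg / d) ^+ b * (s2 / d) ^+ l)
  sg_gt0 xweight_gt0 _ (column_bound i)) _.
  move=> b l ba lk; rewrite !expr_div_n.
  have -> : B * (sg ^+ b / d ^+ b) * (s2 ^+ l / d ^+ l) * (sg ^+ (a - b) * xweight (k - l)) =
    B / d ^+ (b + l) * (sg ^+ a * (s2 ^+ l * xweight (k - l))).
    rewrite (_ : sg ^+ a = sg ^+ b * sg ^+ (a - b)) ?exprD; last by rewrite -exprD subnKC.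
    field.
    by rewrite !expf_neq0 // gt_eqF.
  apply: ler_pM; rewrite ?cmod_ge0 ?wx_ge0 //.
    by rewrite ler_pdivlMr ?exprn_gt0.
  rewrite ler_wpM2l ?exprn_ge0 ?(ltW sg_gt0) //.
  by rewrite -{1}(subnK lk) xweightD_le.
by rewrite ler_wpM2r // geometric2_le // p_half.
Qed.

(** Up to degree [m] only the radius [s1] occurs, so every coefficient of [T0] except the constant
    one gains a factor [sg / d] or [s1 / d]. *)
Lemma cprod2_bound_low l i a k : (k <= m)%N ->
  cmod (cprod2 (T0 l i) (column v l) a k) * (sg ^+ a * xweight k) <=
  (eta + 4 * B * (sg / d + s1 / d)) * K.
Proof.
move=> km.
apply: le_trans (cprod2_est (g := fun b q => if (b == 0%N) && (q == 0%N) then eta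
  else B * (sg / d) ^+ b * (s1 / d) ^+ q) sg_gt0 xweight_gt0 _ (column_bound l)) _.
  move=> b q ba qk; case: ifP => [/andP[/eqP -> /eqP ->]|bq].
    by rewrite !subn0 ler_wpM2r ?wx_ge0.
  rewrite !expr_div_n.
  have -> : B * (sg ^+ b / d ^+ b) * (s1 ^+ q / d ^+ q) * (sg ^+ (a - b) * xweight (k - q)) =
    B / d ^+ (b + q) * (sg ^+ a * (s1 ^+ q * xweight (k - q))).
    rewrite (_ : sg ^+ a = sg ^+ b * sg ^+ (a - b)) ?exprD; last by rewrite -exprD subnKC.
    field.
    by rewrite !expf_neq0 // gt_eqF.
  rewrite -xweightD_low subnK // ler_wpM2r ?wx_ge0 //.
  by rewrite ler_pdivlMr ?exprn_gt0 // /T0 andbA bq addr0; exact: TB.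
rewrite ler_wpM2r // geometric2_tail_le // p_half //.
exact: le_trans s12 s2d.
Qed.

Lemma vsum_bound (F : 'I_n -> C) (b : R) w : 0 <= w ->
  (forall l, cmod (F l) * w <= b) -> cmod (\sum_l F l) * w <= n%:R * b.
Proof.
move=> w0 H; apply: le_trans (ler_wpM2r w0 (cmod_sum _ _ _)) _.
rewrite mulr_suml; apply: le_trans (ler_sum _ (fun l _ => H l)) _.
by rewrite sumr_const card_ord mulr_natl.
Qed.

Let S_column i a k : cmod (S (column v i) a k) * (sg ^+ a * xweight k) <= sg * K.
Proof.
rewrite mulrA -ler_pdivlMr ?xweight_gt0 // -mulrA.
apply: S_bound => b.
by rewrite ler_pdivlMr ?xweight_gt0 // -mulrA.
Qed.

Lemma solveQ_half p : cmod (solveQ v p) * weight p <= K / 2.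
Proof.
case: p => [[a k] i]; rewrite /solveQ /weight /=; case: ifPn => [_|ij].
  case: k => [|k]; first by rewrite cmod0 mul0r divr_ge0.
  rewrite cmodN cmodM cmodV cmod_nat.
  have E : cmod (vmulR v a k) * (sg ^+ a * xweight k) <= n%:R * (4 * B * K).
    by apply: vsum_bound => // l; apply: cprod2_bound.
  have k1 : k.+1%:R^-1 <= 1 :> R by rewrite invf_le1 ?ler1n.
  apply: (@le_trans _ _ (1 * cmod (vmulR v a k) * (sg ^+ a * (s2 * xweight k)))).
    apply: ler_pM; rewrite ?wx_ge0 ?mulr_ge0 ?cmod_ge0 ?invr_ge0 //.
      by rewrite ler_wpM2r ?cmod_ge0.
    by rewrite ler_wpM2l ?exprn_ge0 ?(ltW sg_gt0) ?xweightS_le.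
  rewrite [leLHS](_ : _ = s2 * (cmod (vmulR v a k) * (sg ^+ a * xweight k))); last by ring.
  apply: le_trans (ler_wpM2l (ltW s2_gt0) E) _.
  rewrite [leLHS](_ : _ = 4 * n%:R * B * s2 * K); last by ring.
  by rewrite [leRHS]mulrC ler_wpM2r.
have mu1_ge0 : 0 <= mu1 by apply: le_trans (mu_bound ij); exact: cmod_ge0.
case: ifPn => [km|]; last rewrite -leqNgt => mk.
  rewrite cmodN cmodM -mulrA.
  (* [A] comes from [x^2 v'], [D] from [epsilon v'] and [E] from the product with [T0]. They account
     for the three summands of [small_low]. *)
  set A := (if k is _.+1 then _ else _); set D := _ * S _ _ _; set E := vmulT0 _ _ _ _.
  have HA : cmod A * (sg ^+ a * xweight k) <= m%:R * s1 * K.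
    rewrite /A; case: k {A D E} km => [|k] km.
      by rewrite cmod0 mul0r !mulr_ge0 // ltW.
    rewrite cmodM cmod_nat xweightS_low 1?ltnW // -mulrA.
    rewrite (_ : cmod _ * _ = s1 * (cmod (column v i a k) * (sg ^+ a * xweight k))); last by ring.
    have cw := mulr_ge0 (cmod_ge0 (column v i a k)) (wx_ge0 a k).
    rewrite -[leRHS]mulrA; apply: ler_pM; rewrite ?ler0n ?(mulr_ge0 (ltW s1_gt0) cw) //.
      by rewrite ler_nat ltnW // ltnW.
    by rewrite ler_wpM2l // ltW.
  have HD : cmod D * (sg ^+ a * xweight k) <= m%:R * (sg / s1) * K.
    rewrite /D cmodM cmod_nat.
    rewrite (_ : _ * _ = k.+1%:R * (cmod (S (column v i) a k.+1) * (sg ^+ a * xweight k.+1) / s1)); last first.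
      by rewrite xweightS_low //; field; rewrite gt_eqF.
    have cw := mulr_ge0 (cmod_ge0 (S (column v i) a k.+1)) (wx_ge0 a k.+1).
    rewrite -[leRHS]mulrA; apply: ler_pM; rewrite ?ler0n ?(divr_ge0 cw (ltW s1_gt0)) //.
      by rewrite ler_nat.
    by rewrite [leRHS]mulrAC ler_wpM2r ?invr_ge0 ?(ltW s1_gt0).
  have HE : cmod E * (sg ^+ a * xweight k) <= n%:R * ((eta + 4 * B * (sg / d + s1 / d)) * K).
    by apply: vsum_bound => // l; apply: cprod2_bound_low; exact: ltnW.
  apply: (@le_trans _ _ (mu1 * ((m%:R * s1 + m%:R * (sg / s1) +
         n%:R * (eta + 4 * B * (sg / d + s1 / d))) * K))).
    apply: ler_pM; rewrite ?(mulr_ge0 (cmod_ge0 _) (wx_ge0 _ _)) ?cmod_ge0 ?(mu_bound ij) //.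
    apply: le_trans (ler_wpM2r (wx_ge0 _ _) (cmod_triB _ _)) _.
    rewrite [leLHS]mulrDl [leRHS]mulrDl; apply: lerD; last by rewrite -mulrA.
    apply: le_trans (ler_wpM2r (wx_ge0 _ _) (cmod_triB _ _)) _.
    by rewrite [leLHS]mulrDl [leRHS]mulrDl lerD.
  by rewrite mulrA [leRHS]mulrC ler_wpM2r.
have k0 : 0 < k%:R :> R by rewrite ltr0n (leq_trans m_gt0).
have m0 : 0 < m%:R :> R by rewrite ltr0n.
have mkR : m%:R <= k%:R :> R by rewrite ler_nat.
have k1 : 1 <= k%:R :> R by rewrite ler1n (leq_trans m_gt0).
rewrite cmodM cmodV cmod_nat -mulrA ler_pdivrMl //.
apply: le_trans (ler_wpM2r (wx_ge0 _ _) (cmodD _ _)) _.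
(* Each of the two terms may use half of the budget. The division by [k] pays for [k + 2 <= 3 k] in
   the epsilon term, and for the product through [m <= k] and [large_m]. *)
rewrite mulrDl (_ : k%:R * (K / 2) = k%:R * K / 4 + k%:R * K / 4); last by field.
apply: lerD.
  rewrite cmodM cmod_nat.
  rewrite [leLHS](_ : _ = k.+2%:R * (cmod (S (column v i) a k.+2) * (sg ^+ a * xweight k.+2) / s2 ^+ 2)); last first.
    by rewrite xweightS_high ?leqW // xweightS_high //; field; rewrite gt_eqF.
  apply: (@le_trans _ _ (3 * k%:R * (sg * K / s2 ^+ 2))).
    have cw := mulr_ge0 (cmod_ge0 (S (column v i) a k.+2)) (wx_ge0 a k.+2).
    apply: ler_pM; rewrite ?ler0n ?(divr_ge0 cw (exprn_ge0 2 (ltW s2_gt0))) //.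
      by rewrite -(natr1 k.+1) -natr1; lra.
    by rewrite ler_wpM2r ?invr_ge0 ?exprn_ge0 ?(ltW s2_gt0).
  rewrite (_ : 3 * _ * _ = (12 * sg / s2 ^+ 2) * (k%:R * K / 4)); last by field; rewrite gt_eqF.
  rewrite ler_piMl ?divr_ge0 ?mulr_ge0 ?(ltW k0) //.
  by rewrite ler_pdivrMr ?mul1r ?exprn_gt0.
have E : cmod (vmulT v i a k.+1) * (sg ^+ a * xweight k.+1) <= n%:R * (4 * B * K).
  by apply: vsum_bound => // l; apply: cprod2_bound.
rewrite [leLHS](_ : _ = cmod (vmulT v i a k.+1) * (sg ^+ a * xweight k.+1) / s2); last first.
  by rewrite xweightS_high //; field; rewrite gt_eqF.
rewrite ler_pdivrMr //; apply: le_trans E _.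
rewrite (_ : n%:R * _ = (16 * n%:R * B) * (K / 4)); last by field.
apply: (@le_trans _ _ (m%:R * s2 * (K / 4))); first by rewrite ler_wpM2r ?divr_ge0.
rewrite (_ : k%:R * K / 4 * s2 = k%:R * s2 * (K / 4)); last by field.
by rewrite ler_wpM2r ?divr_ge0 // ler_wpM2r // ltW.
Qed.

End Bounds.
End Operator.

(** * Coefficient bounds with unnamed constants *)

Section BoundedCoefficients.
Variable R : realType.
Local Notation C := R[i].
Implicit Types (a b : nat -> C) (d : R).

Definition bounded_coef d a := exists M, coef_bound d M a.

Lemma bounded_coefD d a b : 0 <= d -> bounded_coef d a -> bounded_coef d b ->
  bounded_coef d (fun k => a k + b k).
Proof. by move=> d0 [M Ha] [N Hb]; exists (M + N); apply: coef_boundD. Qed.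

Lemma bounded_coefZ d x a : bounded_coef d a -> bounded_coef d (fun k => x * a k).
Proof. by move=> [M Ha]; exists (cmod x * M); apply: coef_boundZ. Qed.

Lemma bounded_coef_sum d (I : Type) (r : seq I) (F : I -> nat -> C) : 0 <= d ->
  (forall i, bounded_coef d (F i)) ->
  bounded_coef d (fun k => \sum_(i <- r) F i k).
Proof.
move=> d0 H; elim: r => [|i r IH].
  by exists 0 => k; rewrite big_nil cmod0 mul0r.
have [M HM] := bounded_coefD d0 (H i) IH.
by exists M => k; rewrite big_cons; exact: HM.
Qed.

Lemma bounded_coefW d d' a : 0 <= d' <= d -> bounded_coef d a -> bounded_coef d' a.
Proof.
move=> /andP[d0 dd] [M H]; exists M => k; apply: le_trans (H k).
by rewrite ler_wpM2l ?cmod_ge0 // lerXn2r ?nnegrE // (le_trans d0).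
Qed.

Lemma bounded_coef_shift d a : 0 <= d -> bounded_coef d a ->
  bounded_coef d (fun k => if k is k'.+1 then a k' else 0).
Proof.
move=> d0 [M H]; exists (d * M) => -[|k].
  by rewrite cmod0 mul0r mulr_ge0 // (coef_bound_ge0 H).
by rewrite exprS mulrCA ler_wpM2l.
Qed.

Lemma bounded_coef_cprod d a b : 0 <= d -> bounded_coef d a -> bounded_coef d b ->
  bounded_coef (d / 2) (cprod a b).
Proof. by move=> d0 [M Ha] [N Hb]; exists (M * N); apply: coef_bound_cprod. Qed.

Lemma bcpsumD d a b z : cmod z <= d / 2 -> bounded_coef d a -> bounded_coef d b ->
  psum (fun k => a k + b k) z = psum a z + psum b z.
Proof. by move=> zd [M Ha] [N Hb]; apply: psumD zd Ha Hb. Qed.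

Lemma bcpsumZ d x a z : cmod z <= d / 2 -> bounded_coef d a ->
  psum (fun k => x * a k) z = x * psum a z.
Proof. by move=> zd [M Ha]; apply: psumZ zd Ha. Qed.

Lemma bounded_coef_cprod2 d (c v : nat -> nat -> C) k : 0 <= d ->
  (forall m, bounded_coef d (c ^~ m)) -> (forall m, bounded_coef d (v ^~ m)) ->
  bounded_coef (d / 2) (fun q => cprod2 c v q k).
Proof.
move=> d0 Hc Hv; apply: (@bounded_coef_sum (d / 2) _ _ (fun m : 'I_k.+1 => cprod (c ^~ m) (v ^~ (k - m)%N))).
  by rewrite divr_ge0.
by move=> m; apply: bounded_coef_cprod.
Qed.

Lemma psum_cprod2 d (c v : nat -> nat -> C) k e : 0 <= d -> cmod e <= d / 4 ->
  (forall m, bounded_coef d (c ^~ m)) -> (forall m, bounded_coef d (v ^~ m)) ->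
  psum (fun q => cprod2 c v q k) e =
  cprod (fun m => psum (c ^~ m) e) (fun m => psum (v ^~ m) e) k.
Proof.
move=> d0 ed Hc Hv.
rewrite -[LHS]/(psum (fun q => \sum_(m < k.+1) cprod (c ^~ m) (v ^~ (k - m)%N) q) e).
rewrite (@psum_sum _ (d / 2)) //.
- apply: eq_bigr => m _; have [M HM] := Hc m; have [N HN] := Hv (k - m)%N.
  exact: psumM ed HM HN.
- by rewrite (_ : d / 2 / 2 = d / 4) //; field.
- by move=> m; apply: bounded_coef_cprod.
Qed.

End BoundedCoefficients.

Lemma vmulT0E (R : realType) n (mu : 'I_n -> R[i]) T v i a k :
  vmulT0 mu T v i a k = vmulT T v i a k + mu i * v (a, k, i).
Proof.
have E l : cprod2 (T0 mu T l i) (column v l) a k =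
    cprod2 (T l i) (column v l) a k + (if l == i then mu i * column v l a k else 0).
  rewrite /cprod2 /T0.
  under eq_bigr => m _ do under eq_bigr => b _ do rewrite mulrDl.
  under eq_bigr => m _ do rewrite big_split /=.
  rewrite big_split /=; congr (_ + _); case: eqP => [->|_]; last first.
    by rewrite big1 // => m _; rewrite big1 // => b _; rewrite !andbF mul0r.
  rewrite big_ord_recl [X in _ + X]big1 ?addr0; last first.
    by move=> m _; rewrite big1 // => b _ /=; rewrite andbF mul0r.
  rewrite big_ord_recl /= [X in _ + X]big1 ?addr0 ?subn0 // => b _ /=.
  by rewrite mul0r.
rewrite /vmulT0 (eq_bigr _ (fun l _ => E l)) big_split /=; congr (_ + _).
by rewrite -big_mkcond big_pred1_eq.
Qed.

(** * Uniqueness of the row at a fixed value of epsilon *)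

Section SolveAt.
Variables (R : realType) (n : nat) (j : 'I_n).
Local Notation C := R[i].

(* The [k]-th coefficients of [(x^2 - e) y_i' - (y T)_i] and [y_j' + (y R)_j]. *)
Definition eqT (Te : 'I_n -> 'I_n -> nat -> C) (e : C) (y : 'I_n -> nat -> C) i k : C :=
  (if k is k'.+1 then k'%:R * y i k' else 0) - e * (k.+1%:R * y i k.+1)
  - \sum_l cprod (Te l i) (y l) k.
Definition eqR (Re : 'I_n -> nat -> C) (y : 'I_n -> nat -> C) k : C :=
  k.+1%:R * y j k.+1 + \sum_l cprod (Re l) (y l) k.

Lemma cprod_lin (a u v : nat -> C) z k :
  cprod a (fun l => u l - z * v l) k = cprod a u k - z * cprod a v k.
Proof.
rewrite /cprod mulr_sumr -sumrB; apply: eq_bigr => l _; ring.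
Qed.

Lemma eqT_lin Te e u v z i k :
  eqT Te e (fun l q => u l q - z * v l q) i k = eqT Te e u i k - z * eqT Te e v i k.
Proof.
rewrite /eqT (_ : \sum_l _ = \sum_l cprod (Te l i) (u l) k - z * \sum_l cprod (Te l i) (v l) k).
  by case: k => [|k]; ring.
by rewrite mulr_sumr -sumrB; apply: eq_bigr => l _; rewrite -cprod_lin.
Qed.

Lemma eqR_lin Re u v z k :
  eqR Re (fun l q => u l q - z * v l q) k = eqR Re u k - z * eqR Re v k.
Proof.
rewrite /eqR (_ : \sum_l _ = \sum_l cprod (Re l) (u l) k - z * \sum_l cprod (Re l) (v l) k).
  by ring.
by rewrite mulr_sumr -sumrB; apply: eq_bigr => l _; rewrite -cprod_lin.
Qed.

(** A series in [x] as a double series concentrated in [e]-degree zero. The problem at a fixed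
    number [e] thereby becomes an instance of [solveQ]. *)
Definition collapse (a : nat -> C) (b k : nat) : C := if b == 0%N then a k else 0.

Lemma cprod2_collapse a u b k :
  cprod2 (collapse a) (collapse u) b k = collapse (cprod a u) b k.
Proof.
rewrite /cprod2 /collapse; case: eqP => [->|/eqP b0].
  by apply: eq_bigr => m _; rewrite big_ord1.
rewrite big1 // => m _; rewrite big1 // => -[q /= qb] _.
case: eqP => [->|]; last by rewrite mul0r.
by rewrite subn0 (negbTE b0) mulr0.
Qed.

Variables (mu : 'I_n -> C) (Te : 'I_n -> 'I_n -> nat -> C) (Re : 'I_n -> nat -> C) (e : C).
Variables (m : nat) (d B eta mu1 sg s1 s2 : R).
Hypothesis d_gt0 : 0 < d.
Hypothesis sg_gt0 : 0 < sg.
Hypothesis s1_gt0 : 0 < s1.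
Hypothesis s12 : s1 <= s2.
Hypothesis s2d : s2 <= d / 2.
Hypothesis sgd : sg <= d / 2.
Hypothesis B_ge0 : 0 <= B.
Hypothesis m_gt0 : (0 < m)%N.
Hypothesis TB : forall l i, coef_bound d B (Te l i).
Hypothesis RB : forall l, coef_bound d B (Re l).
Hypothesis T00 : forall l i, cmod (Te l i 0%N + (if l == i then mu i else 0)) <= eta.
Hypothesis mu_neq0 : forall i, i != j -> mu i != 0.
Hypothesis mu_bound : forall i, i != j -> cmod (mu i)^-1 <= mu1.
Hypothesis e_small : cmod e <= sg.
Hypothesis small_j : 4 * n%:R * B * s2 <= 2^-1.
Hypothesis small_S : 12 * sg <= s2 ^+ 2.
Hypothesis large_m : 16 * n%:R * B <= m%:R * s2.
Hypothesis small_low :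
  mu1 * (m%:R * s1 + m%:R * (sg / s1) +
         n%:R * (eta + 4 * B * (sg / d + s1 / d))) <= 2^-1.

Lemma collapse_bound2 (a : nat -> C) M : coef_bound d M a -> coef_bound2 d M (collapse a).
Proof.
move=> H b k; rewrite /collapse; case: eqP => [->|_]; first exact: H.
by rewrite cmod0 mul0r (coef_bound_ge0 H).
Qed.

(** A solution with [y j 0 = 0] is a fixed point of [solveQ] without source term. Equation [m] is
    excluded among the hypotheses because the lemma is applied to a difference for which it is not
    yet known. *)
Lemma solution_unique (y : 'I_n -> nat -> C) K :
  (forall i k, cmod (y i k) * xweight m s1 s2 k <= K) -> y j 0%N = 0 ->
  (forall k, eqR Re y k = 0) ->
  (forall i k, i != j -> k != m -> eqT Te e y i k = 0) ->
  forall i k, y i k = 0.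
Proof.
move=> yK yj0 HR HT i k.
pose T l i := collapse (Te l i); pose Rj l := collapse (Re l).
pose S (u : nat -> nat -> C) a k := e * u a k.
pose v (p : nat * nat * 'I_n) := collapse (y p.2) p.1.1 p.1.2.
have SB (u : nat -> nat -> C) k' K' :
  (forall a, cmod (u a k') * sg ^+ a <= K') ->
  forall a, cmod (S u a k') * sg ^+ a <= sg * K'.
  move=> H a; rewrite /S cmodM -mulrA ler_pM ?cmod_ge0 ?mulr_ge0 ?exprn_ge0 ?cmod_ge0 //.
  exact: ltW.
have Ssub (u1 u2 : nat -> nat -> C) a k' : S (fun b l => u1 b l - u2 b l) a k' = S u1 a k' - S u2 a k'.
  by rewrite /S mulrBr.
have T0B l i' : cmod (T0 mu T l i' 0%N 0%N) <= eta by rewrite /T0 /T /collapse /=.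
have Hhalf := @solveQ_half R n j mu T Rj S m d B eta mu1 sg s1 s2
  d_gt0 sg_gt0 s1_gt0 s12 s2d sgd B_ge0 m_gt0
  (fun l i => collapse_bound2 (TB l i)) (fun l => collapse_bound2 (RB l)) T0B
  mu_bound SB small_j small_S large_m small_low.
have wK p : cmod (v p) * weight m sg s1 s2 p <= K.
  case: p => [[a k'] i']; rewrite /v /weight /collapse /=.
  case: eqP => [->|_]; first by rewrite mul1r.
  by rewrite cmod0 mul0r; apply: le_trans (yK i 0%N); rewrite mulr_ge0 ?cmod_ge0 ?ltW ?xweight_gt0.
suff vQ p : v p = solveQ j mu T Rj S m v p.
  have := contraction_unique (weight_gt0 m sg_gt0 s1_gt0 s12) Hhalf wK vQ (0%N, k, i).
  by rewrite /v /collapse.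
have vcol l : column v l = collapse (y l) by [].
have vR a k' : vmulR Rj v a k' = collapse (fun q => \sum_l cprod (Re l) (y l) q) a k'.
  rewrite /vmulR (eq_bigr (fun l => collapse (cprod (Re l) (y l)) a k')) => [|l _].
    by rewrite /collapse; case: eqP => //; rewrite big1.
  by rewrite vcol cprod2_collapse.
have vT a k' i' : vmulT T v i' a k' = collapse (fun q => \sum_l cprod (Te l i') (y l) q) a k'.
  rewrite /vmulT (eq_bigr (fun l => collapse (cprod (Te l i') (y l)) a k')) => [|l _].
    by rewrite /collapse; case: eqP => //; rewrite big1.
  by rewrite vcol cprod2_collapse.
have vT0 a k' i' : vmulT0 mu T v i' a k' = vmulT T v i' a k' + mu i' * v (a, k', i').
  exact: vmulT0E.
case: p => [[a k'] i']; rewrite /solveQ.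
case: ifPn => [/eqP -> | ij].
  case: k' => [|k']; first by rewrite /v /collapse /= yj0; case: ifP.
  rewrite vR /v /collapse /=; case: eqP => _; last by ring.
  have := HR k'; rewrite /eqR => /eqP; rewrite addr_eq0 => /eqP E.
  by rewrite -mulrN -E mulKf // pnatr_eq0.
case: ifPn => [km|]; last rewrite -leqNgt => mk.
  rewrite vT0 vT vcol /S /v /collapse /=; case: eqP => _; last by case: k' {km} => [|k']; ring.
  have := HT i' k' ij (negbT (ltn_eqF km)); rewrite /eqT => /eqP.
  rewrite subr_eq0 => /eqP <-; apply: (mulfI (mu_neq0 ij)).
  rewrite mulrN mulVKf ?mu_neq0 //; case: k' {km} => [|k']; ring.
rewrite vT vcol /S /v /collapse /=; case: eqP => _; last by ring.
have k0 : k'%:R != 0 :> C by rewrite pnatr_eq0 -lt0n (leq_trans m_gt0).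
(* For [k' >= m] the coefficient [k'] is read off equation [k' + 1 > m], for [k' < m] off equation
   [k']; so equation [m] is never called upon. *)
have := HT i' k'.+1 ij; rewrite gtn_eqF ?ltnS // => /(_ isT).
rewrite /eqT => /eqP; rewrite subr_eq0 => /eqP <-.
by rewrite (mulrCA e) addrC subrK mulKf.
Qed.

End SolveAt.

(** * The formal row and the vanishing of the omitted equations *)

Section FormalSolution.
Variable R : realType.
Local Notation C := R[i].

(** The order of choice matters: [s2] from the data, [m] from [s2], [s1] from [m], and [sg] last,
    because [m sg / s1] must be small. The bound [tau] on [s2] lets the true row into the weighted
    space. *)
Lemma choose_constants (n : nat) (d B tau mu1 : R) :
  0 < d -> 0 <= B -> 0 < tau -> 0 <= mu1 ->
  exists (m : nat) (s1 s2 sg : R),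
    [/\ [/\ (0 < m)%N, 0 < sg, 0 < s1, s1 <= s2 & s2 <= d / 2],
        s2 <= tau, sg <= d / 2 &
        [/\ 4 * n%:R * (2 * B) * s2 <= 2^-1, 12 * sg <= s2 ^+ 2,
            16 * n%:R * (2 * B) <= m%:R * s2 &
            mu1 * (m%:R * s1 + m%:R * (sg / s1) +
              n%:R * (2 * B * sg / d + 4 * (2 * B) * (sg / d + s1 / d))) <= 2^-1]].
Proof.
move=> d0 B0 tau0 mu10; have n0 : 0 <= n%:R :> R by [].
have nB0 : 0 <= n%:R * B by rewrite mulr_ge0.
have small (c : R) : 0 <= c -> c * (4 * (c + 1))^-1 <= 4^-1.
  by move=> c0; rewrite ler_pdivrMr; nra.
pose s2 := Num.min (Num.min (d / 2) tau) (16 * (n%:R * B) + 1)^-1.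
have s20 : 0 < s2 by rewrite /s2 !lt_min tau0 divr_gt0 //= invr_gt0; lra.
have s2d : s2 <= d / 2 by rewrite /s2 !ge_min lexx.
have s2t : s2 <= tau by rewrite /s2 !ge_min lexx !orbT.
have s2B : s2 <= (16 * (n%:R * B) + 1)^-1 by rewrite /s2 !ge_min lexx !orbT.
pose m := (Num.truncn (32 * (n%:R * B) / s2)).+1.
have mB : 32 * (n%:R * B) <= m%:R * s2.
  by rewrite -ler_pdivrMr // ltW // truncnS_gt.
have m0 : 0 <= m%:R :> R by [].
pose c1 := mu1 * (m%:R + 8 * (n%:R * B) / d).
have c10 : 0 <= c1 by rewrite mulr_ge0 // addr_ge0 // divr_ge0 ?(ltW d0) // mulr_ge0.
pose s1 := Num.min s2 (4 * (c1 + 1))^-1.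
have s10 : 0 < s1 by rewrite /s1 lt_min s20 invr_gt0; lra.
have s12 : s1 <= s2 by rewrite /s1 ge_min lexx.
have s1c : s1 <= (4 * (c1 + 1))^-1 by rewrite /s1 ge_min lexx orbT.
pose c2 := mu1 * (m%:R / s1 + 10 * (n%:R * B) / d).
have c20 : 0 <= c2.
  by rewrite mulr_ge0 // addr_ge0 // divr_ge0 ?(ltW d0) ?(ltW s10) // mulr_ge0.
pose sg := Num.min (Num.min (d / 2) (s2 ^+ 2 / 12)) (4 * (c2 + 1))^-1.
have sg0 : 0 < sg.
  by rewrite /sg !lt_min !divr_gt0 ?exprn_gt0 //= invr_gt0; lra.
have sgd : sg <= d / 2 by rewrite /sg !ge_min lexx.
have sgs : sg <= s2 ^+ 2 / 12 by rewrite /sg !ge_min lexx !orbT.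
have sgc : sg <= (4 * (c2 + 1))^-1 by rewrite /sg !ge_min lexx !orbT.
exists m, s1, s2, sg; split => //; split.
- have : s2 * (16 * (n%:R * B) + 1) <= 1.
    by rewrite -ler_pdivlMr ?div1r //; lra.
  rewrite (_ : 4 * n%:R * (2 * B) * s2 = 8 * (s2 * (n%:R * B))); last by ring.
  by rewrite mulrDr mulrCA; lra.
- by move: sgs; rewrite ler_pdivlMr; lra.
- by move: mB; rewrite (_ : 16 * _ * _ = 32 * (n%:R * B)) //; ring.
(* With [eta = 2 B sg / d] the low condition is linear in [sg] once [s1] is fixed;
   [s1 <= 1 / (4 (c1 + 1))] and the same bound for [sg] give a quarter each. *)
- rewrite [leLHS](_ : _ = c1 * s1 + c2 * sg); last first.
    by rewrite /c1 /c2; field; rewrite !gt_eqF.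
  have h1 := le_trans (ler_wpM2l c10 s1c) (small c1 c10).
  have h2 := le_trans (ler_wpM2l c20 sgc) (small c2 c20).
  lra.
Qed.

Variables (n : nat) (j : 'I_n) (mu : 'I_n -> C) (T : 'I_n -> 'I_n -> nat -> nat -> C)
  (Rj : 'I_n -> nat -> nat -> C) (d B tau : R).
Hypothesis d_gt0 : 0 < d.
Hypothesis tau_gt0 : 0 < tau.
Hypothesis TB : forall l i, coef_bound2 d B (T l i).
Hypothesis RB : forall l, coef_bound2 d B (Rj l).
Hypothesis T00 : forall l i, T l i 0%N 0%N = if l == i then - mu i else 0.
Hypothesis mu_neq0 : forall i, i != j -> mu i != 0.

Definition T_at (e : C) l i k := psum (T l i ^~ k) e.
Definition R_at (e : C) l k := psum (Rj l ^~ k) e.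

(** Supplied later by the glued row at [e = a^2]. The ratio [tau] is fixed in advance, whereas [K]
    may vary with [e]. *)
Hypothesis solutions_at : forall rho : R, 0 < rho ->
  exists (e : C) (y : 'I_n -> nat -> C) (K : R),
    [/\ e != 0, cmod e < rho, exists i k, y i k != 0,
        forall i k, cmod (y i k) * tau ^+ k <= K &
        (forall k, eqR j (R_at e) y k = 0) /\
        (forall i k, i != j -> eqT (T_at e) e y i k = 0)].

(* The equations [eqT] and [eqR] with [e] as a second formal variable, of exponent [a]. *)
Definition formalT (v : 'I_n -> nat -> nat -> C) i k a : C :=
  (if k is k'.+1 then k'%:R * v i a k' else 0) -
  k.+1%:R * eshift (v i) a k.+1 - \sum_l cprod2 (T l i) (v l) a k.
Definition formalR (v : 'I_n -> nat -> nat -> C) k a : C :=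
  k.+1%:R * v j a k.+1 + \sum_l cprod2 (Rj l) (v l) a k.

(** Evaluation at [e] is multiplicative on a quarter of the radius, whence [sg / 4]. The bound on
    the coefficients of [formalT] is what [psum_zero_seq] requires of the defect. *)
Lemma formal_at (v : 'I_n -> nat -> nat -> C) sg e : 0 < sg -> sg <= d ->
  cmod e <= sg / 4 -> (forall i k, bounded_coef sg (v i ^~ k)) ->
  let ve i k := psum (v i ^~ k) e in
  [/\ forall i k, bounded_coef (sg / 2) (formalT v i k),
      forall i k, psum (formalT v i k) e = eqT (T_at e) e ve i k &
      forall k, psum (formalR v k) e = eqR j (R_at e) ve k].
Proof.
move=> sg0 sgd es vb ve.
have sg2 : 0 <= sg / 2 by lra.
have e2 : cmod e <= sg / 2 / 2 by lra.
have Tb l i k : bounded_coef sg (T l i ^~ k).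
  by exists (B / sg ^+ k); apply: coef_bound2_col => //; apply: coef_bound2W (TB l i); rewrite ?(ltW sg0).
have Rb l k : bounded_coef sg (Rj l ^~ k).
  by exists (B / sg ^+ k); apply: coef_bound2_col => //; apply: coef_bound2W (RB l); rewrite ?(ltW sg0).
have vb2 i k : bounded_coef (sg / 2) (v i ^~ k).
  by apply: bounded_coefW (vb i k); apply/andP; split; lra.
have vs i k : bounded_coef (sg / 2) (fun a => eshift (v i) a k).
  exact: (bounded_coef_shift sg2 (vb2 i k)).
have bT i k : bounded_coef (sg / 2) (fun a => \sum_l cprod2 (T l i) (v l) a k).
  apply: (@bounded_coef_sum _ _ _ _ (fun l a => cprod2 (T l i) (v l) a k)) => // l.
  by apply: bounded_coef_cprod2 => //; exact: ltW.
have bR k : bounded_coef (sg / 2) (fun a => \sum_l cprod2 (Rj l) (v l) a k).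
  apply: (@bounded_coef_sum _ _ _ _ (fun l a => cprod2 (Rj l) (v l) a k)) => // l.
  by apply: bounded_coef_cprod2 => //; exact: ltW.
pose A i k a : C := if k is k'.+1 then k'%:R * v i a k' else 0.
have bA i k : bounded_coef (sg / 2) (A i k).
  case: k => [|k]; last exact: bounded_coefZ.
  by exists 0 => a; rewrite /A cmod0 mul0r.
have FE i k : formalT v i k = fun a => A i k a + (- k.+1%:R) * eshift (v i) a k.+1 +
    (-1) * \sum_l cprod2 (T l i) (v l) a k.
  by apply/funext => a; rewrite mulNr mulN1r.
have pT l i k : psum (fun a => cprod2 (T l i) (v l) a k) e = cprod (T_at e l i) (ve l) k.
  by rewrite (psum_cprod2 (d := sg)) // ltW.
have pR l k : psum (fun a => cprod2 (Rj l) (v l) a k) e = cprod (R_at e l) (ve l) k.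
  by rewrite (psum_cprod2 (d := sg)) // ltW.
have bAS i k : bounded_coef (sg / 2) (fun a => A i k a + (- k.+1%:R) * eshift (v i) a k.+1).
  by apply: bounded_coefD => //; exact: bounded_coefZ.
split=> [i k|i k|k].
- by rewrite FE; apply: bounded_coefD => //; exact: bounded_coefZ.
- rewrite FE (bcpsumD e2) //; last exact: bounded_coefZ.
  rewrite (bcpsumD e2) //; last exact: bounded_coefZ.
  rewrite (bcpsumZ _ e2) // (bcpsumZ _ e2) // mulN1r mulNr.
  rewrite (@psum_sum _ (sg / 2)) //; last first.
    by move=> l; apply: bounded_coef_cprod2 => //; exact: ltW.
  rewrite /eqT (eq_bigr _ (fun l _ => pT l i k)); congr (_ - _ - _).
    case: k => [|k]; first exact: psum0.
    by rewrite /A (bcpsumZ _ e2).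
  rewrite mulrCA; congr (_ * _).
  have [M HM] := vb2 i k.+1; have sg20 : 0 < sg / 2 by lra.
  by rewrite -(psum_shift sg20 e2 HM); apply: psum_ext => -[].
- rewrite /formalR (bcpsumD e2) //; last exact: bounded_coefZ.
  rewrite (bcpsumZ _ e2) // (@psum_sum _ (sg / 2)) //; last first.
    by move=> l; apply: bounded_coef_cprod2 => //; exact: ltW.
  by rewrite /eqR (eq_bigr _ (fun l _ => pR l k)).
Qed.

Lemma formal_solution :
  exists (v : 'I_n -> nat -> nat -> C) (s K : R),
    [/\ 0 < s, forall i, coef_bound2 s K (v i),
        forall a, v j a 0%N = (a == 0%N)%:R &
        (forall k a, formalR v k a = 0) /\
        (forall i k a, i != j -> formalT v i k a = 0)].
Proof.
have B0 : 0 <= B := coef_bound2_ge0 (RB j).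
pose mu1 : R := \sum_i cmod (mu i)^-1.
have mu10 : 0 <= mu1 by apply: sumr_ge0 => i _; exact: cmod_ge0.
have mub i : i != j -> cmod (mu i)^-1 <= mu1.
  by move=> _; rewrite /mu1 (bigD1 i) //= lerDl sumr_ge0 // => *; exact: cmod_ge0.
have [m [s1 [s2 [sg [[m0 sg0 s10 s12 s2d] s2t sgd [sj sS lm sl]]]]]] :=
  choose_constants n d_gt0 B0 tau_gt0 mu10.
have B20 : 0 <= 2 * B by rewrite mulr_ge0.
have BB2 : B <= 2 * B by lra.
have dd : (0 <= d <= d) by rewrite ltW // lexx.
have TB2 l i : coef_bound2 d (2 * B) (T l i) := coef_bound2W dd BB2 (TB l i).
have RB2 l : coef_bound2 d (2 * B) (Rj l) := coef_bound2W dd BB2 (RB l).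
have eta0 : 0 <= 2 * B * sg / d by rewrite divr_ge0 ?mulr_ge0 // ltW.
have T0z l i : T0 mu T l i 0%N 0%N = 0.
  by rewrite /T0 T00 /=; case: eqP => _; rewrite ?addNr ?addr0.
(* In the formal problem this entry is zero; the weaker bound is the one valid at a number [e],
   where the entry is of order [e]. Both problems then share their constants. *)
have T0e l i : cmod (T0 mu T l i 0%N 0%N) <= 2 * B * sg / d by rewrite T0z cmod0.
have SB (u : nat -> nat -> C) k K :
  (forall a, cmod (u a k) * sg ^+ a <= K) ->
  forall a, cmod (eshift u a k) * sg ^+ a <= sg * K.
  move=> H [|a] /=.
    rewrite cmod0 mul0r mulr_ge0 ?(ltW sg0) //.
    by apply: le_trans (H 0%N); rewrite mulr_ge0 ?cmod_ge0 ?exprn_ge0 ?(ltW sg0).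
  by rewrite exprS mulrCA ler_wpM2l ?(ltW sg0).
have Ssub (u1 u2 : nat -> nat -> C) a k :
    eshift (fun b l => u1 b l - u2 b l) a k = eshift u1 a k - eshift u2 a k.
  by case: a => [|a] //=; rewrite subrr.
have Qhalf := @solveQ_half R n j mu T Rj (@eshift R) m d (2 * B) _ mu1 sg s1 s2
  d_gt0 sg0 s10 s12 s2d sgd B20 m0 TB2 RB2 T0e mub SB sj sS lm sl.
have Qsub := @solveQ_sub R n j mu T Rj (@eshift R) m Ssub.
(* The source term imposes [v_j(e, 0) = 1]: in component [j] and degree zero, [solveQ] itself
   returns [0]. *)
pose e0 (p : nat * nat * 'I_n) : C := if p == (0%N, 0%N, j) then 1 else 0.
have e0K p : cmod (e0 p) * weight m sg s1 s2 p <= 1.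
  rewrite /e0; case: eqP => [->|_]; last by rewrite cmod0 mul0r.
  by rewrite /weight /xweight /= min0n sub0n !expr0 cmod1 !mulr1.
have [V [HV VK]] := contraction_exists (weight_gt0 m sg0 s10 s12) Qsub Qhalf e0K.
pose v i a k := V (a, k, i).
have xw0 k : 0 < xweight m s1 s2 k := xweight_gt0 m s10 s12 k.
have vb i k : bounded_coef sg (v i ^~ k).
  exists (2 * 1 / xweight m s1 s2 k) => a.
  by rewrite ler_pdivlMr // -mulrA; exact: (VK (a, k, i)).
have cV i : column V i = v i by [].
have vTE i k a : vmulT0 mu T V i a k = \sum_l cprod2 (T l i) (v l) a k + mu i * v i a k.
  by rewrite vmulT0E.
have vR k a : formalR v k a = 0.
  rewrite /formalR {1}/v HV /e0 /= !xpair_eqE /= andbF add0r eqxx.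
  rewrite mulrN mulVKf ?pnatr_eq0 // addNr //.
have vT i k a : i != j -> k != m -> formalT v i k a = 0.
  move=> ij; have e0z b q : e0 (b, q, i) = 0 by rewrite /e0 xpair_eqE (negbTE ij) andbF.
  rewrite neq_ltn => /orP[km|].
    have := HV (a, k, i); rewrite e0z add0r /solveQ (negbTE ij) km vTE => E.
    have {}E : mu i * v i a k = - (formalT v i k a - mu i * v i a k).
      rewrite {1}/v E mulrN mulVKf ?mu_neq0 //; congr (- _).
      by case: k {km E} => [|k]; rewrite /formalT !cV; ring.
    by move: E; rewrite opprB => /eqP; rewrite -subr_eq0 opprB addrC subrK => /eqP.
  case: k => // k mk; have := HV (a, k, i); rewrite e0z add0r /solveQ (negbTE ij) ltnNge -ltnS mk /=.
  have k0 : k%:R != 0 :> C by rewrite pnatr_eq0 -lt0n (leq_trans m0).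
  move=> E; rewrite /formalT {1}/v E mulVKf //.
  by rewrite [_ + vmulT _ _ _ _ _]addrC addrK subrr.
(* As [s1 <= s2], the power [s^(a + k)] is below the weight, so a bound with two radii yields one
   with a single radius. *)
pose s := Num.min sg s1.
have s0 : 0 < s by rewrite lt_min sg0.
exists v, s, (2 * 1); split=> //.
- move=> i a k; apply: le_trans (VK (a, k, i)); rewrite ler_wpM2l ?cmod_ge0 //.
  rewrite /weight /= exprD ler_pM ?exprn_ge0 ?(ltW s0) //.
    by rewrite lerXn2r ?nnegrE ?(ltW s0) ?(ltW sg0) // ge_min lexx.
  apply: (@le_trans _ _ (s1 ^+ k)).
    by rewrite lerXn2r ?nnegrE ?(ltW s0) ?(ltW s10) // ge_min lexx orbT.
  rewrite /xweight -{1}(subnKC (geq_minl k m)) exprD ler_wpM2l ?exprn_ge0 ?(ltW s10) //.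
  rewrite (_ : (k - minn k m = k - m)%N); last first.
    by have [km|//] := leqP k m; rewrite subnn; apply/esym/eqP; rewrite subn_eq0.
  by rewrite lerXn2r ?nnegrE ?(ltW s10) // ltW // (lt_le_trans s10).
- by move=> a; rewrite /v HV /e0 /= eqxx addr0 !xpair_eqE !eqxx !andbT; case: (a == 0%N).
(* Only equation [m] is left. Its defect is a power series in [e], shown to have zeros accumulating
   at the origin. *)
split=> // i k a ij; have [->|km] := eqVneq k m; last exact: vT.
have sgd' : sg <= d by lra.
have sg8 : 0 < sg / 2 by lra.
have e00 : cmod (0 : C) <= sg / 4 by rewrite cmod0; lra.
have [FB _ _] := formal_at sg0 sgd' e00 vb; have [M HM] := FB i m.
apply: (psum_zero_seq sg8 HM) => rho rho0.
have [|e [y [K [e_0 e_rho [i0 [k0 yik]] yK [yR yT]]]]] := solutions_at (rho := Num.min rho (sg / 4)).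
  by rewrite lt_min rho0; lra.
move: e_rho; rewrite lt_min => /andP[e_rho e_sg].
exists e; split=> //.
have [_ fT fR] := formal_at sg0 sgd' (ltW e_sg) vb.
rewrite fT; set ve := (fun _ _ => _) in fT fR *.
have xws k' : xweight m s1 s2 k' <= tau ^+ k'.
  apply: le_trans (xweightD_le m s10 s12 k' 0) _; rewrite /xweight min0n sub0n !expr0 !mulr1.
  by rewrite lerXn2r ?nnegrE ?(ltW tau_gt0) // ltW // (lt_le_trans s10).
have TeB l i' : coef_bound d (2 * B) (T_at e l i').
  by apply: coef_bound2_rows => //; lra.
have ReB l : coef_bound d (2 * B) (R_at e l).
  by apply: coef_bound2_rows => //; lra.
have T0eB l i' : cmod (T_at e l i' 0%N + (if l == i' then mu i' else 0)) <= 2 * B * sg / d.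
  have q0 : 0 <= cmod e / d by rewrite divr_ge0 ?cmod_ge0 ?(ltW d_gt0).
  have qs : cmod e / d <= sg / d by rewrite ler_wpM2r ?invr_ge0 ?(ltW d_gt0) //; lra.
  have q2 : cmod e / d <= 2^-1 by rewrite ler_pdivrMr // mulrC; lra.
  have q01 : 0 <= cmod e / d < 1 by rewrite q0 /=; lra.
  have zq : cmod e <= cmod e / d * d by rewrite divfK // gt_eqF.
  have := csum_err 1 q01 (coef_bound_geodom q0 zq (coef_bound2_col 0 d_gt0 (TB l i'))).
  rewrite -/(psum _ _) big_ord1 expr0 mulr1 T00 cmodB => H.
  rewrite (_ : (if l == i' then mu i' else 0) = - (if l == i' then - mu i' else 0)); last first.
    by case: ifP; rewrite ?opprK ?oppr0.
  apply: le_trans H _; rewrite ?expr0 ?divr1 ?expr1 ler_pdivrMr; last lra.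
  apply: le_trans (_ : B * (sg / d) <= _); first by rewrite ler_wpM2l.
  rewrite (_ : 2 * B * sg / d * _ = B * (sg / d) * (2 * (1 - cmod e / d))); last by ring.
  have h : 1 <= 2 * (1 - cmod e / d) by lra.
  by rewrite ler_peMr // mulr_ge0 // divr_ge0 ?(ltW sg0) ?(ltW d_gt0).
have e_sg' : cmod e <= sg by lra.
have Uniq := @solution_unique R n j mu (T_at e) (R_at e) e m d (2 * B) _ mu1 sg s1 s2
  d_gt0 sg0 s10 s12 s2d sgd B20 m0 TeB ReB T0eB mu_neq0 mub e_sg' sj sS lm sl.
have yw i' k' : cmod (y i' k') * xweight m s1 s2 k' <= K.
  by apply: le_trans (yK i' k'); rewrite ler_wpM2l ?cmod_ge0.
(* Otherwise uniqueness would make [y] vanish identically; hence [y] can be normalized like [v]. *)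
have y0 : y j 0%N != 0.
  apply/eqP => y00; move/eqP: yik; apply.
  by apply: (Uniq y K) => // i' k' ij' _; exact: yT.
have veB i' k' : cmod (ve i' k') * xweight m s1 s2 k' <= 4.
  have H : coef_bound sg (2 / xweight m s1 s2 k') (v i' ^~ k').
    by move=> b; rewrite ler_pdivlMr // -mulrA; have := VK (b, k', i'); rewrite mulr1.
  have e2 : cmod e <= sg / 2 by lra.
  have := psum_le e2 H; rewrite mulrA ler_pdivlMr // => H'; apply: le_trans H' _; lra.
pose z := (y j 0%N)^-1.
pose w l q := ve l q - z * y l q.
have wK i' k' : cmod (w i' k') * xweight m s1 s2 k' <= 4 + cmod z * K.
  apply: le_trans (ler_wpM2r (ltW (xw0 _)) (cmod_triB _ _)) _; rewrite mulrDl lerD //.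
  by rewrite cmodM -mulrA ler_wpM2l ?cmod_ge0.
have w0 : w j 0%N = 0.
  rewrite /w /z mulVf // /ve (psum_fin (n := 1)).
    rewrite big_ord1 expr0 mulr1 /v HV /e0 /= !eqxx /= addr0 subrr //.
  by move=> [|b] // _; rewrite /v HV /e0 /= eqxx addr0 ?xpair_eqE.
have wz := Uniq w _ wK w0.
have {}wz : forall i k, w i k = 0.
  apply: wz => [k'|i' k' ij' km'].
    rewrite eqR_lin yR mulr0 subr0 -fR (_ : formalR v k' = fun=> 0) ?psum0 //.
    by apply/funext => b; exact: vR.
  rewrite eqT_lin yT // mulr0 subr0 -fT (_ : formalT v i' k' = fun=> 0) ?psum0 //.
  by apply/funext => b; exact: vT.
(* Equation [m] does hold for [y], so subtracting [z y] does not change the defect of [ve]; and the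
   difference [w] is zero. *)
have := eqT_lin (T_at e) e ve y z i m; rewrite yT // mulr0 subr0 => <-.
rewrite /eqT; have E l : (fun q => ve l q - z * y l q) = fun=> 0 by apply/funext => q; exact: wz.
rewrite big1 => [|l _]; last first.
  by rewrite E /cprod big1 // => q _; rewrite mulr0.
by case: (m) => [|m']; rewrite -!/(w _ _) !wz; ring.
Qed.

End FormalSolution.

(** * Analytic germs and the maximum principle *)

Section Germs.
Variable R : realType.
Local Notation C := R[i].
Implicit Types (f g : C -> C -> C) (c : nat -> nat -> C).

Definition germ2 f (y0 z0 : C) := exists c (d M : R),
  [/\ 0 < d, coef_bound2 d M c &
      forall e x, cmod e < d -> cmod x < d -> f (y0 + e) (z0 + x) = psum2 c e x].

(** Functions of one variable as functions of two that ignore the first: the closure properties are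
    proved once. *)
Definition germ (f : C -> C) z0 := germ2 (fun=> f) 0 z0.

Lemma coef_bound2_shrink d d' M c : 0 < d' -> d' <= d ->
  coef_bound2 d M c -> coef_bound2 d' M c.
Proof. by move=> d'0 dd; apply: coef_bound2W; rewrite // ltW. Qed.

Lemma psum2_at0 c : psum2 c 0 0 = c 0%N 0%N.
Proof. by rewrite /psum2 !psum_at0. Qed.

Lemma psum2_e0 c x : psum2 c 0 x = psum (c 0%N) x.
Proof. by apply: psum_ext => k; rewrite psum_at0. Qed.

Lemma germP (f : C -> C) z0 : germ f z0 <-> exists (a : nat -> C) (d M : R),
  [/\ 0 < d, coef_bound d M a & forall x, cmod x < d -> f (z0 + x) = psum a x].
Proof.
split=> [[c [d [M [d0 cM H]]]]|[a [d [M [d0 aM H]]]]].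
  exists (c 0%N), d, M; split=> //.
  by move=> x xd; rewrite -psum2_e0 -(H 0 x) // cmod0.
exists (fun b k => if b == 0%N then a k else 0), d, M; split=> //.
  move=> b k; case: eqP => [->|_]; first exact: aM.
  by rewrite cmod0 mul0r (coef_bound_ge0 aM).
move=> e x _ xd; rewrite H //; apply: psum_ext => k.
by rewrite (psum_fin (n := 1)) ?big_ord1 ?expr0 ?mulr1 //; case.
Qed.

Lemma germ2_slice f y0 z0 : germ2 f y0 z0 -> germ (f y0) z0.
Proof.
move=> [c [d [M [d0 cM H]]]]; apply/germP; exists (c 0%N), d, M; split=> //.
by move=> x xd; rewrite -psum2_e0 -(H 0 x) ?cmod0 // addr0.
Qed.

Lemma germ2_near f g y0 z0 : germ2 f y0 z0 ->
  (exists2 r : R, 0 < r & forall e x, cmod e < r -> cmod x < r ->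
     f (y0 + e) (z0 + x) = g (y0 + e) (z0 + x)) -> germ2 g y0 z0.
Proof.
move=> [c [d [M [d0 cM H]]]] [r r0 fg].
have m0 : 0 < Num.min d r by rewrite lt_min d0.
exists c, (Num.min d r), M; split=> //.
  by apply: coef_bound2_shrink cM; rewrite // ge_min lexx.
by move=> e x; rewrite !lt_min => /andP[? ?] /andP[? ?]; rewrite -fg // H.
Qed.

Lemma germ2_cst (z : C) y0 z0 : germ2 (fun _ _ => z) y0 z0.
Proof.
exists (fun a k => if (a == 0%N) && (k == 0%N) then z else 0), 1, (cmod z); split=> //.
  move=> a k; rewrite expr1n mulr1; case: ifP => // _.
  by rewrite cmod0 cmod_ge0.
move=> e x _ _; rewrite /psum2 (psum_fin (n := 1)).
  by rewrite big_ord1 mulr1 (psum_fin (n := 1)) ?big_ord1 ?mulr1 // => -[].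
case=> // k _; rewrite (psum_fin (n := 0)) ?big_ord0 // => a _.
by rewrite andbF.
Qed.

Lemma germ2_D f g y0 z0 : germ2 f y0 z0 -> germ2 g y0 z0 ->
  germ2 (fun e x => f e x + g e x) y0 z0.
Proof.
move=> [c [d [M [d0 cM Hf]]]] [c' [d' [M' [d'0 cM' Hg]]]].
pose r := Num.min d d'.
have r0 : 0 < r by rewrite lt_min d0.
have B1 : coef_bound2 r M c by apply: coef_bound2_shrink cM; rewrite // ge_min lexx.
have B2 : coef_bound2 r M' c' by apply: coef_bound2_shrink cM'; rewrite // ge_min lexx orbT.
exists (fun a k => c a k + c' a k), (r / 2), (M + M'); split; first by rewrite divr_gt0.
  by apply: coef_bound2_shrink (coef_bound2D (ltW r0) B1 B2); lra.
move=> e x er xr; have rd : r <= d by rewrite ge_min lexx.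
have rd' : r <= d' by rewrite ge_min lexx orbT.
by rewrite (psum2D r0 _ _ B1 B2) ?ltW // Hf ?Hg //; lra.
Qed.

Lemma germ2_M f g y0 z0 : germ2 f y0 z0 -> germ2 g y0 z0 ->
  germ2 (fun e x => f e x * g e x) y0 z0.
Proof.
move=> [c [d [M [d0 cM Hf]]]] [c' [d' [M' [d'0 cM' Hg]]]].
pose r := Num.min d d'.
have r0 : 0 < r by rewrite lt_min d0.
have B1 : coef_bound2 r M c by apply: coef_bound2_shrink cM; rewrite // ge_min lexx.
have B2 : coef_bound2 r M' c' by apply: coef_bound2_shrink cM'; rewrite // ge_min lexx orbT.
exists (cprod2 c c'), (r / 4), (M * M'); split; first by rewrite divr_gt0.
  by apply: coef_bound2_shrink (coef_bound2_cprod r0 B1 B2); lra.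
move=> e x er xr; have rd : r <= d by rewrite ge_min lexx.
have rd' : r <= d' by rewrite ge_min lexx orbT.
by rewrite (psum2M r0 _ _ B1 B2) ?ltW // Hf ?Hg //; lra.
Qed.

Lemma germ2_sum (I : Type) (r : seq I) (F : I -> C -> C -> C) y0 z0 :
  (forall i, germ2 (F i) y0 z0) -> germ2 (fun e x => \sum_(i <- r) F i e x) y0 z0.
Proof.
move=> H; elim: r => [|i r IH].
  rewrite (_ : (fun _ _ => _) = fun _ _ => 0); first exact: germ2_cst.
  by apply/funext => e; apply/funext => x; rewrite big_nil.
rewrite (_ : (fun _ _ => _) = fun e x => F i e x + \sum_(j <- r) F j e x).
  exact: germ2_D.
by apply/funext => e; apply/funext => x; rewrite big_cons.
Qed.

Lemma germ2_prod (I : Type) (r : seq I) (F : I -> C -> C -> C) y0 z0 :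
  (forall i, germ2 (F i) y0 z0) -> germ2 (fun e x => \prod_(i <- r) F i e x) y0 z0.
Proof.
move=> H; elim: r => [|i r IH].
  rewrite (_ : (fun _ _ => _) = fun _ _ => 1); first exact: germ2_cst.
  by apply/funext => e; apply/funext => x; rewrite big_nil.
rewrite (_ : (fun _ _ => _) = fun e x => F i e x * \prod_(j <- r) F j e x).
  exact: germ2_M.
by apply/funext => e; apply/funext => x; rewrite big_cons.
Qed.

(** The inverse is the fixed point of [g = 1 - (c - 1) g], a contraction on a small bidisc since
    [c - 1] has no constant term. *)
Lemma inverse_series c (d B : R) : 0 < d -> coef_bound2 d B c -> c 0%N 0%N = 1 ->
  exists (g : nat -> nat -> C) (s K : R), [/\ 0 < s, s <= d, coef_bound2 s K g &
    forall a k, cprod2 c g a k = if (a == 0%N) && (k == 0%N) then 1 else 0].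
Proof.
move=> d0 cB c00; have B0 := coef_bound2_ge0 cB.
(* The contraction factor is [4 B (s / d + s / d)], and this [s] gives [8 B s / d <= 1 / 2]. *)
pose s := d / 2 * (8 * B + 1)^-1.
have s0 : 0 < s by rewrite mulr_gt0 ?divr_gt0 ?invr_gt0 //; lra.
have sB : (s / d) * (8 * B + 1) = 2^-1 by rewrite /s; field; rewrite !gt_eqF //; lra.
clearbody s.
have q0 : 0 <= s / d by rewrite divr_ge0 ?ltW.
have q2 : s / d <= 2^-1 by rewrite -sB ler_peMr //; lra.
have sd : s <= d by have := q2; rewrite ler_pdivrMr //; lra.
pose c' a k := c a k - (if (a == 0%N) && (k == 0%N) then 1 else 0).
pose Q (u : nat * nat -> C) p := - cprod2 c' (fun a k => u (a, k)) p.1 p.2.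
pose w (p : nat * nat) : R := s ^+ p.1 * s ^+ p.2.
have w0 p : 0 < w p by rewrite mulr_gt0 ?exprn_gt0.
have Qsub u v p : Q (fun q => u q - v q) p = Q u p - Q v p.
  by rewrite /Q cprod2B opprB opprK addrC.
have Qhalf u K : (forall p, cmod (u p) * w p <= K) ->
    forall p, cmod (Q u p) * w p <= K / 2.
  move=> uK [a k]; rewrite /Q cmodN /w /=.
  have K0 : 0 <= K by apply: le_trans (uK (0%N, 0%N)); rewrite mulr_ge0 ?cmod_ge0 ?ltW.
  apply: le_trans (cprod2_est (g := fun b q => if (b == 0%N) && (q == 0%N) then 0
    else B * (s / d) ^+ b * (s / d) ^+ q) s0 (fun l => exprn_gt0 l s0) _ (fun b l => uK (b, l))) _.
    move=> b q ba qk; rewrite /c'; case: ifP => [/andP[/eqP -> /eqP ->]|bq].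
      by rewrite c00 subrr cmod0 !mul0r.
    rewrite subr0 /= !expr_div_n.
    have -> : B * (s ^+ b / d ^+ b) * (s ^+ q / d ^+ q) * (s ^+ (a - b) * s ^+ (k - q)) =
      B / d ^+ (b + q) * (s ^+ a * s ^+ k).
      rewrite (_ : s ^+ a = s ^+ b * s ^+ (a - b)); last by rewrite -exprD subnKC.
      rewrite (_ : s ^+ k = s ^+ q * s ^+ (k - q)) ?exprD; last by rewrite -exprD subnKC.
      by field; rewrite !expf_neq0 // gt_eqF.
    rewrite ler_wpM2r ?mulr_ge0 ?exprn_ge0 ?(ltW s0) //.
    by rewrite ler_pdivlMr ?exprn_gt0.
  rewrite [leRHS]mulrC ler_wpM2r //.
  have q02 : 0 <= s / d <= 2^-1 by rewrite q0.
  apply: le_trans (geometric2_tail_le 0 a k B0 q02 q02) _.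
  by move: sB; move: (s / d) q0 => q q0' sB; nra.
pose e0 (p : nat * nat) : C := if (p.1 == 0%N) && (p.2 == 0%N) then 1 else 0.
have e0K p : cmod (e0 p) * w p <= 1.
  case: p => [[|a] [|k]]; rewrite /e0 /w /= ?cmod0 ?mul0r //.
  by rewrite cmod1 !expr0 !mulr1.
have [g [Hg gK]] := contraction_exists w0 Qsub Qhalf e0K.
exists (fun a k => g (a, k)), s, (2 * 1); split=> //.
  by move=> a k; rewrite exprD; exact: (gK (a, k)).
move=> a k; have := Hg (a, k); rewrite /e0 /Q /=.
have -> : cprod2 c' (fun a k => g (a, k)) a k = cprod2 c (fun a k => g (a, k)) a k - g (a, k).
  rewrite /cprod2 /c'.
  under eq_bigr => m _ do under eq_bigr => b _ do rewrite mulrBl.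
  under eq_bigr => m _ do rewrite sumrB.
  rewrite sumrB; congr (_ - _).
  rewrite big_ord_recl [X in _ + X]big1 ?addr0; last first.
    by move=> m _; rewrite big1 // => b _ /=; rewrite andbF mul0r.
  rewrite big_ord_recl /= [X in _ + X]big1 ?addr0 ?subn0 ?mul1r // => b _ /=.
  by rewrite mul0r.
rewrite opprB addrCA -[LHS]addr0 => /addrI /eqP.
by rewrite eq_sym subr_eq0 => /eqP <-.
Qed.

Lemma germ2_V f y0 z0 : germ2 f y0 z0 -> f y0 z0 != 0 ->
  germ2 (fun e x => (f e x)^-1) y0 z0.
Proof.
move=> [c [d [M [d0 cM Hf]]]] f0.
have c00 : f y0 z0 = c 0%N 0%N.
  by have := Hf 0 0; rewrite !addr0 cmod0 psum2_at0 => ->.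
have cB := coef_bound2Z (f y0 z0)^-1 cM.
have [|g [s [K [s0 sd gK Hg]]]] := inverse_series d0 cB.
  by rewrite -c00 mulVf.
have cB' : coef_bound2 s (cmod (f y0 z0)^-1 * M) (fun a k => (f y0 z0)^-1 * c a k).
  exact: coef_bound2_shrink cB.
exists (fun a k => (f y0 z0)^-1 * g a k), (s / 4), (cmod (f y0 z0)^-1 * K); split.
- by rewrite divr_gt0.
- by apply: coef_bound2Z; apply: coef_bound2_shrink gK; lra.
move=> e x es xs.
have H := psum2M s0 (ltW es) (ltW xs) cB' gK.
have e1 : psum2 (fun a k => if (a == 0%N) && (k == 0%N) then 1 else 0) e x = 1 :> C.
  rewrite /psum2 (psum_fin (n := 1)).
    by rewrite big_ord1 mulr1 (psum_fin (n := 1)) ?big_ord1 ?mulr1 // => -[].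
  case=> // k _; rewrite (psum_fin (n := 0)) ?big_ord0 // => a _.
  by rewrite andbF.
have e2 : cmod e <= d / 2 by lra.
have x2 : cmod x <= d / 2 by lra.
have es2 : cmod e <= s / 2 by lra.
have xs2 : cmod x <= s / 2 by lra.
have E : cprod2 (fun a k => (f y0 z0)^-1 * c a k) g = fun a k => if (a == 0%N) && (k == 0%N) then 1 else 0.
  by apply/funext => a; apply/funext => k; exact: Hg.
move: H; rewrite E e1 (psum2Z _ d0 e2 x2 cM) (psum2Z _ s0 es2 xs2 gK).
have ed : cmod e < d by lra.
have xd : cmod x < d by lra.
rewrite -(Hf _ _ ed xd) => H; have fn0 : f (y0 + e) (z0 + x) != 0.
  apply/eqP => f00; move: H; rewrite f00 mulr0 mul0r => /eqP.
  by rewrite oner_eq0.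
by apply: (mulfI fn0); rewrite divff // H; ring.
Qed.

Lemma germ_near (f g : C -> C) z0 : germ f z0 ->
  (exists2 r : R, 0 < r & forall x, cmod x < r -> f (z0 + x) = g (z0 + x)) ->
  germ g z0.
Proof.
by move=> Hf [r r0 H]; apply: germ2_near Hf _; exists r => // e x _ xr; exact: H.
Qed.

Lemma germ_id z0 : germ id z0.
Proof.
apply/germP; exists (fun k => if k == 0%N then z0 else if k == 1%N then 1 else 0), 1, (cmod z0 + 1).
split=> //.
  move=> k; rewrite expr1n mulr1; case: k => [|[|k]] /=.
  - by rewrite lerDl.
  - by rewrite cmod1 lerDr cmod_ge0.
  - by rewrite cmod0 addr_ge0 ?cmod_ge0.
move=> x _; rewrite (psum_fin (n := 2)) => [|[|[|k]]] //.
by rewrite !big_ord_recl big_ord0 /= expr0 expr1 mulr1 mul1r addr0.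
Qed.

Lemma germX (f : C -> C) z0 m : germ f z0 -> germ (fun x => f x ^+ m) z0.
Proof.
move=> Hf; elim: m => [|m IH]; first exact: (germ2_cst 1).
by rewrite (_ : (fun x => _) = fun x => f x * f x ^+ m); [exact: germ2_M | apply/funext => x; rewrite exprS].
Qed.

Lemma germ_expand (f : C -> C) z0 m : germ f z0 ->
  exists (a : nat -> C) (K r : R), [/\ 0 < r, 0 <= K, a 0%N = f z0 &
    forall h, cmod h < r -> cmod (f (z0 + h) - \sum_(k < m) a k * h ^+ k) <= K * cmod h ^+ m].
Proof.
move=> /germP[a [d [M [d0 aM H]]]]; have M0 := coef_bound_ge0 aM.
exists a, (2 * M / d ^+ m), (d / 2); split.
- by rewrite divr_gt0.
- by rewrite divr_ge0 ?exprn_ge0 ?mulr_ge0 ?(ltW d0).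
- by rewrite -(addr0 z0) H ?cmod0 // psum_at0.
move=> h hd; rewrite H; last lra.
have q0 : 0 <= cmod h / d by rewrite divr_ge0 ?cmod_ge0 ?(ltW d0).
have q2 : cmod h / d <= 2^-1 by rewrite ler_pdivrMr // mulrC ltW.
have q01 : 0 <= cmod h / d < 1 by rewrite q0 /=; lra.
have zq : cmod h <= cmod h / d * d by rewrite divfK // gt_eqF.
rewrite cmodB; apply: le_trans (csum_err m q01 (coef_bound_geodom q0 zq aM)) _.
rewrite ler_pdivrMr; last lra.
rewrite expr_div_n (_ : 2 * M / d ^+ m * _ * _ = M * (cmod h ^+ m / d ^+ m) * (2 * (1 - cmod h / d))); last by ring.
rewrite ler_peMr //; last lra.
by rewrite mulr_ge0 // divr_ge0 ?exprn_ge0 ?cmod_ge0 ?(ltW d0).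
Qed.

End Germs.

(** * The maximum principle on a square *)

Section MaximumPrinciple.
Variable R : realType.
Local Notation C := R[i].
Implicit Types (f : C -> C) (z h : C).

(** A square rather than a disc, because it is a product of two compact segments. *)
Definition square (p : R) z := (`|complex.Re z| <= p) && (`|complex.Im z| <= p).

Definition continuous_cmod f z := forall e : R, 0 < e ->
  exists2 r : R, 0 < r & forall h, cmod h < r -> cmod (f (z + h) - f z) < e.

Lemma square_cmod p z : square p z -> cmod z ^+ 2 <= 2 * p ^+ 2.
Proof.
move=> /andP[zr zi]; rewrite sqr_cmod -(real_normK (num_real (complex.Re z))) -(real_normK (num_real (complex.Im z))).
have := normr_ge0 (complex.Re z); have := normr_ge0 (complex.Im z).
by move: zr zi; move: `|_| `|_| => x y; nra.
Qed.

Lemma square_max (f : C -> R) p : 0 <= p ->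
  (forall z, square p z -> forall e : R, 0 < e -> exists2 r : R, 0 < r &
     forall h, cmod h < r -> `|f (z + h) - f z| < e) ->
  exists2 z0, square p z0 & forall z, square p z -> f z <= f z0.
Proof.
move=> p0 fc; pose A : set (R * R) := `[- p, p]%classic `*` `[- p, p]%classic.
have inA u : (u \in A) = square p (u.1 +i* u.2).
  apply/idP/idP.
    rewrite inE => -[] /=; rewrite !in_itv /= => xp yp.
    by rewrite /square /= !ler_norml xp yp.
  rewrite /square /= !ler_norml => /andP[xp yp].
  by rewrite inE; split; rewrite /= in_itv.
have [||| [x y] xyA H] := @compact_EVT_max (R * R)%type R (fun u => f (u.1 +i* u.2)) A.
- by exists (0, 0); rewrite /A /= !in_itv /= !oppr_le0 p0.
- by apply: compact_setX; exact: segment_compact.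
- apply: continuous_in_subspaceT => -[x y] uA; apply/cvgrPdist_lt => e e0.
  have [|r r0 Hr] := fc (x +i* y) _ e e0; first by rewrite inA in uA.
  have r2 : 0 < r / 2 by lra.
  near=> u.
  have /= ux : `|x - u.1| < r / 2.
    near: u; apply: (@cvgr_dist_lt _ _ _ _ _ (fun u : R * R => u.1) x) => //.
    exact: cvg_fst.
  have /= uy : `|y - u.2| < r / 2.
    near: u; apply: (@cvgr_dist_lt _ _ _ _ _ (fun u : R * R => u.2) y) => //.
    exact: cvg_snd.
  have := Hr ((u.1 - x) +i* (u.2 - y)).
  have -> : x +i* y + ((u.1 - x) +i* (u.2 - y)) = u.1 +i* u.2.
    by apply: eq_ReIm => /=; rewrite addrC subrK.
  rewrite distrC; apply; apply: le_lt_trans (cmod_le_ReIm _) _ => /=.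
  by rewrite -(distrC x) -(distrC y); lra.
exists (x +i* y); first by rewrite inA in xyA.
by move=> [a b] ab; apply: (H (a, b)); rewrite inA.
Unshelve. all: by end_near. Qed.

Lemma germ_continuous f z : germ f z -> continuous_cmod f z.
Proof.
move=> /(germ_expand 1) [a [K [r [r0 K0 a0 H]]]] e e0.
exists (Num.min r (e / (K + 1))); first by rewrite lt_min r0 divr_gt0 //; lra.
move=> h; rewrite lt_min => /andP[hr]; rewrite ltr_pdivlMr; last lra.
move=> he; have := H h hr; rewrite big_ord1 a0 expr0 mulr1 expr1 => /le_lt_trans; apply.
by have := cmod_ge0 h; nra.
Qed.

(* Averaging over the four directions [s], [-s], [is], [-is] cancels the mixed
   terms of a 2-jet, which is all the maximum principle needs of Cauchy's formula. *)
Lemma mean4 (b0 b1 b2 : C) (s : R) :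
  cmod (b0 + b1 * s%:C + b2 * s%:C ^+ 2) ^+ 2 +
  cmod (b0 + b1 * (- s)%:C + b2 * (- s)%:C ^+ 2) ^+ 2 +
  cmod (b0 + b1 * (0 +i* s) + b2 * (0 +i* s) ^+ 2) ^+ 2 +
  cmod (b0 + b1 * (0 +i* (- s)) + b2 * (0 +i* (- s)) ^+ 2) ^+ 2 =
  4 * (cmod b0 ^+ 2 + cmod b1 ^+ 2 * s ^+ 2 + cmod b2 ^+ 2 * s ^+ 4).
Proof.
case: b0 b1 b2 => [x0 y0] [x1 y1] [x2 y2].
by rewrite !sqr_cmod !(re_add, im_add, re_mul, im_mul, expr2) /=; ring.
Qed.

Lemma sqr_cmod_perturb (x y : C) (G K : R) : cmod y <= G -> cmod (x - y) <= K ->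
  cmod y ^+ 2 - 2 * G * K <= cmod x ^+ 2.
Proof.
move=> yG xyK; have yx := cmod_subl y x; rewrite cmodB in yx.
have := cmod_ge0 x; have := cmod_ge0 y; have := cmod_ge0 (x - y).
move: (cmod x) (cmod y) (cmod (x - y)) yG xyK yx => a b c bG cK bca c0 b0 a0.
have : b * c <= G * K by rewrite ler_pM.
by have [cb|bc] := leP c b; nra.
Qed.

(** The term [eta |z|^2] makes the subharmonicity strict: by [mean4] the average over four points at
    distance [s] exceeds the central value by at least [eta s^2], up to a Taylor remainder of order
    [s^3]. *)
Lemma no_local_max f z0 (eta r : R) : germ f z0 -> 0 < eta -> 0 < r ->
  (forall h, cmod h < r ->
     cmod (f (z0 + h)) ^+ 2 + eta * cmod (z0 + h) ^+ 2 <=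
     cmod (f z0) ^+ 2 + eta * cmod z0 ^+ 2) -> False.
Proof.
move=> /(germ_expand 3) [b [K [r' [r'0 K0 b0 H]]]] eta0 r0 Hmax.
pose G := cmod (b 0%N) + cmod (b 1%N) + cmod (b 2%N).
have G0 : 0 <= G by rewrite !addr_ge0 ?cmod_ge0.
have GK : 0 <= G * K by rewrite mulr_ge0.
(* The second bound makes the remainder [2 G K s^3] smaller than [eta s^2]; the last one keeps the
   four points where both the expansion and the maximality hold. *)
pose s := Num.min (Num.min 1 (eta / (4 * (G * K) + 1))) (Num.min r r' / 2).
have mr : 0 < Num.min r r' by rewrite lt_min r0.
have s0 : 0 < s by rewrite !lt_min ltr01 !divr_gt0 //; lra.
have s1 : s <= 1 by rewrite /s !ge_min lexx.
have se : s <= eta / (4 * (G * K) + 1) by rewrite /s !ge_min lexx orbT.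
have sm : s <= Num.min r r' / 2 by rewrite /s ge_min lexx orbT.
have mr1 : Num.min r r' <= r by rewrite ge_min lexx.
have mr2 : Num.min r r' <= r' by rewrite ge_min lexx orbT.
clearbody s.
have sr : s < r by lra.
have sr' : s < r' by lra.
have E h : cmod h = s ->
    cmod (b 0%N + b 1%N * h + b 2%N * h ^+ 2) ^+ 2 - 2 * G * (K * s ^+ 3) <=
    cmod (f z0) ^+ 2 + eta * cmod z0 ^+ 2 - eta * cmod (z0 + h) ^+ 2.
  move=> hs; rewrite lerBrDr; apply: le_trans (Hmax h _); last by rewrite hs.
  rewrite lerD2r; apply: sqr_cmod_perturb.
    apply: le_trans (cmodD _ _) _; rewrite /G lerD //.
      apply: le_trans (cmodD _ _) _; rewrite lerD // cmodM hs.
      by rewrite ler_piMr ?cmod_ge0.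
    by rewrite cmodM cmodX hs ler_piMr ?cmod_ge0 // expr_le1 // ltW.
  have := H h; rewrite hs => /(_ sr').
  by rewrite !big_ord_recr big_ord0 /= add0r expr0 mulr1 expr1.
have c1 : cmod s%:C = s by rewrite cmodR ger0_norm // ltW.
have c2 : cmod (- s)%:C = s by rewrite cmodR normrN ger0_norm // ltW.
have c3 : cmod (0 +i* s) = s by rewrite cmod_def /= expr0n add0r sqrtr_sqr ger0_norm // ltW.
have c4 : cmod (0 +i* (- s)) = s by rewrite cmod_def /= expr0n add0r sqrtr_sqr normrN ger0_norm // ltW.
have M4 := mean4 (b 0%N) (b 1%N) (b 2%N) s.
have N4 := mean4 z0 1 0 s; rewrite !mul1r !mul0r !addr0 cmod1 cmod0 in N4.
have {}N4 := congr1 (fun t => eta * t) N4.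
have := E _ c1; have := E _ c2; have := E _ c3; have := E _ c4.
have P1 : 0 <= cmod (b 1%N) ^+ 2 * s ^+ 2 by rewrite mulr_ge0 ?exprn_ge0 ?cmod_ge0 // ltW.
have P2 : 0 <= cmod (b 2%N) ^+ 2 * s ^+ 4 by rewrite mulr_ge0 ?exprn_ge0 ?cmod_ge0 // ltW.
have ss : 0 < s ^+ 2 by rewrite exprn_gt0.
have : 2 * G * (K * s ^+ 3) * 2 < eta * s ^+ 2 * 2.
  rewrite ltr_pM2r // (_ : 2 * G * (K * s ^+ 3) = (2 * (G * K) * s) * s ^+ 2); last by ring.
  rewrite ltr_pM2r //; move: se; rewrite ler_pdivlMr; last lra.
  by move: (G * K) GK => t t0; nra.
move: M4 N4; rewrite b0 !expr1n mul1r expr0n /= mul0r addr0.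
lra.
Qed.

Lemma max_principle f p M : 0 < p -> 0 <= M ->
  (forall z, square p z -> germ f z \/ f z = 0 /\ continuous_cmod f z) ->
  (forall z, square p z -> `|complex.Re z| = p \/ `|complex.Im z| = p -> cmod (f z) <= M) ->
  forall z, square p z -> cmod (f z) <= M.
Proof.
move=> p0 M0 Hf Hb z1 Sz1; rewrite leNgt; apply/negP => Mz1.
(* On the square [eta |z|^2] is at most half of [|f z1|^2 - M^2], so the maximum of [F] lies neither
   on the boundary nor at a zero of [f]. *)
pose eta := (cmod (f z1) ^+ 2 - M ^+ 2) / (4 * p ^+ 2).
have pp : 0 < p ^+ 2 by rewrite exprn_gt0.
have M2 : M ^+ 2 < cmod (f z1) ^+ 2 by rewrite ltrXn2r // nnegrE cmod_ge0.
have eta0 : 0 < eta by rewrite divr_gt0 //; lra.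
have etaE : eta * (2 * p ^+ 2) = (cmod (f z1) ^+ 2 - M ^+ 2) / 2.
  by rewrite /eta; field; rewrite gt_eqF.
have etaz z : square p z -> eta * cmod z ^+ 2 <= (cmod (f z1) ^+ 2 - M ^+ 2) / 2.
  by move=> Sz; rewrite -etaE ler_wpM2l ?square_cmod // ltW.
pose F z := cmod (f z) ^+ 2 + eta * cmod z ^+ 2.
have cont g z : continuous_cmod g z -> forall e : R, 0 < e -> exists2 r : R, 0 < r &
    forall h, cmod h < r -> `|cmod (g (z + h)) ^+ 2 - cmod (g z) ^+ 2| < e.
  move=> gc e e0; pose c := 2 * cmod (g z) + 1.
  have c0 : 0 < c by rewrite /c; have := cmod_ge0 (g z); lra.
  have [|r r0 Hr] := gc (Num.min 1 (e / c)); first by rewrite lt_min ltr01 divr_gt0.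
  exists r => // h /Hr; rewrite lt_min => /andP[h1 h2].
  rewrite ltr_pdivlMr // in h2.
  have E1 := cmod_subl (g (z + h)) (g z).
  have E2 := cmod_subl (g z) (g (z + h)); rewrite cmodB in E2.
  have := cmod_ge0 (g (z + h)); have := cmod_ge0 (g z); have := cmod_ge0 (g (z + h) - g z).
  move: h1 h2 E1 E2; rewrite /c ltr_norml.
  move: (cmod (g (z + h) - g z)) (cmod (g z)) (cmod (g (z + h))) => d a b h1 h2 E1 E2 d0 a0 b0.
  by apply/andP; split; nra.
have [||z0 Sz0 Hz0] := @square_max F p; first exact: ltW.
  move=> z Sz e e0; have e2 : 0 < e / 2 by lra.
  have fc : continuous_cmod f z.
    by case: (Hf z Sz) => [/germ_continuous //|[]].
  have [r1 r10 H1] := cont f z fc _ e2.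
  have idc : continuous_cmod id z by move=> d d0; exists d => // h; rewrite /= addrC addKr.
  have [|r2 r20 H2] := cont id z idc (e / 2 / eta); first by rewrite divr_gt0.
  exists (Num.min r1 r2); first by rewrite lt_min r10.
  move=> h; rewrite lt_min => /andP[/H1 h1 /H2]; rewrite ltr_pdivlMr // => h2.
  rewrite /F opprD addrACA -mulrBr; apply: le_lt_trans (ler_normD _ _) _.
  by rewrite normrM (gtr0_norm eta0) mulrC; move: h2 => /=; lra.
have F1 := Hz0 z1 Sz1; rewrite /F in F1.
have z1p : 0 <= eta * cmod z1 ^+ 2 by rewrite mulr_ge0 ?exprn_ge0 ?cmod_ge0 // ltW.
have z0e := etaz z0 Sz0.
have inner : `|complex.Re z0| < p /\ `|complex.Im z0| < p.
  have nb : ~ (`|complex.Re z0| = p \/ `|complex.Im z0| = p).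
    move=> /(Hb _ Sz0) fM; have : cmod (f z0) ^+ 2 <= M ^+ 2 by rewrite lerXn2r ?nnegrE ?cmod_ge0.
    lra.
  have /andP[a b] := Sz0; split; rewrite lt_neqAle ?a ?b andbT; apply/eqP => E; apply: nb; auto.
have gz0 : germ f z0.
  case: (Hf z0 Sz0) => // -[fz0 _]; move: F1; rewrite fz0 cmod0 expr0n /= add0r.
  have M20 : 0 <= M ^+ 2 by rewrite exprn_ge0.
  lra.
pose r := Num.min (p - `|complex.Re z0|) (p - `|complex.Im z0|).
have r0 : 0 < r by rewrite lt_min !subr_gt0; apply/andP.
apply: (no_local_max gz0 eta0 r0) => h; rewrite lt_min => /andP[h1 h2].
apply: Hz0; apply/andP; split.
  rewrite re_add; apply: le_trans (ler_normD _ _) _.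
  by have := Re_le_cmod h; lra.
rewrite im_add; apply: le_trans (ler_normD _ _) _.
by have := Im_le_cmod h; lra.
Qed.

End MaximumPrinciple.

(** * Growth of Taylor coefficients in the presence of two singular points *)

Section CoefficientGrowth.
Variable R : realType.
Local Notation C := R[i].
Implicit Types (f : C -> C) (z h : C).

Definition locally_bounded f z := exists (r B : R),
  0 < r /\ forall h, cmod h < r -> cmod (f (z + h)) <= B.

Lemma germ_locally_bounded f z : germ f z -> locally_bounded f z.
Proof.
move=> /germ_continuous /(_ 1 ltr01) [r r0 H]; exists r, (cmod (f z) + 1); split=> // h hr.
by have := H h hr; have := cmod_subl (f (z + h)) (f z); lra.
Qed.

Lemma locally_boundedD f g z : locally_bounded f z -> locally_bounded g z ->
  locally_bounded (fun x => f x + g x) z.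
Proof.
move=> [r [B [r0 H]]] [r' [B' [r'0 H']]]; exists (Num.min r r'), (B + B'); split.
  by rewrite lt_min r0.
move=> h; rewrite lt_min => /andP[h1 h2]; apply: le_trans (cmodD _ _) _.
by rewrite lerD ?H ?H'.
Qed.

Lemma locally_boundedM f g z : locally_bounded f z -> locally_bounded g z ->
  locally_bounded (fun x => f x * g x) z.
Proof.
move=> [r [B [r0 H]]] [r' [B' [r'0 H']]]; exists (Num.min r r'), (B * B'); split.
  by rewrite lt_min r0.
move=> h; rewrite lt_min => /andP[h1 h2].
by rewrite cmodM ler_pM ?cmod_ge0 ?H ?H'.
Qed.

Lemma locally_bounded_near f g z : locally_bounded f z ->
  (exists2 r : R, 0 < r & forall h, cmod h < r -> f (z + h) = g (z + h)) ->
  locally_bounded g z.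
Proof.
move=> [r [B [r0 H]]] [r' r'0 fg]; exists (Num.min r r'), B; split.
  by rewrite lt_min r0.
by move=> h; rewrite lt_min => /andP[h1 h2]; rewrite -fg ?H.
Qed.

Lemma germD f g z : germ f z -> germ g z -> germ (fun x => f x + g x) z.
Proof. exact: germ2_D. Qed.

Lemma germM f g z : germ f z -> germ g z -> germ (fun x => f x * g x) z.
Proof. exact: germ2_M. Qed.

Lemma germ_poly2 e z : germ (fun x => x ^+ 2 - e) z.
Proof. by apply: germD; [apply: germX; exact: germ_id | exact: germ2_cst]. Qed.

Variables (p : R) (e : C).
Hypothesis p_gt0 : 0 < p.
Hypothesis e_neq0 : e != 0.
Hypothesis e_small : cmod e < p ^+ 2.

Definition germ_off_roots f :=
  (forall z, square p z -> z ^+ 2 != e -> germ f z) /\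
  (forall z, z ^+ 2 = e -> locally_bounded f z).

Let boundary z := square p z /\ (`|complex.Re z| = p \/ `|complex.Im z| = p).

Lemma boundary_cmod z : boundary z -> p <= cmod z.
Proof.
move=> [_ [<-|<-]]; [exact: Re_le_cmod | exact: Im_le_cmod].
Qed.

Lemma vanishing_continuous f z : z ^+ 2 = e -> locally_bounded f z ->
  continuous_cmod (fun x => f x * (x ^+ 2 - e)) z.
Proof.
move=> ze [r [B [r0 H]]] d d0.
have B0 : 0 <= B by apply: le_trans (H 0 _); rewrite ?cmod_ge0 ?cmod0.
pose c := 2 * cmod z + 1; have c0 : 0 < c by have := cmod_ge0 z; rewrite /c; lra.
have Bc0 : 0 <= B * c by rewrite mulr_ge0 // ltW.
exists (Num.min (Num.min r 1) (d / (B * c + 1))).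
  by rewrite !lt_min r0 ltr01 divr_gt0 //; lra.
move=> h; rewrite !lt_min => /andP[/andP[h1 h2] h3].
rewrite ze subrr mulr0 subr0 cmodM.
have -> : (z + h) ^+ 2 - e = h * (2 * z + h) by rewrite -ze; ring.
rewrite cmodM; move: h3; rewrite ltr_pdivlMr; last lra.
apply: le_lt_trans.
have E1 := H h h1.
have E2 : cmod (2 * z + h) <= c.
  by apply: le_trans (cmodD _ _) _; rewrite cmodM cmod_nat /c; lra.
apply: (@le_trans _ _ (B * (cmod h * c))).
  by rewrite ler_pM ?cmod_ge0 ?mulr_ge0 ?cmod_ge0 // ler_wpM2l ?cmod_ge0.
by rewrite [leRHS](_ : _ = B * (cmod h * c) + cmod h) ?lerDl ?cmod_ge0 //; ring.
Qed.

(** Takes the place of a removable singularity theorem. Since [f^m (x^2 - e)] is continuous with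
    value zero at the roots, [|f 0|^m |e| <= M^m L] for every [m], with [L] independent of [m]; as
    [e] is not zero this forces [|f 0| <= M]. *)
Lemma max_principle_punctured f M : germ_off_roots f -> 0 <= M ->
  (forall z, boundary z -> cmod (f z) <= M) -> cmod (f 0) <= M.
Proof.
move=> [Hg Hl] M0 Hb; rewrite leNgt; apply/negP => Mf.
have f0 : 0 < cmod (f 0) by apply: le_lt_trans Mf.
pose L := 2 * p ^+ 2 + cmod e.
have S0 : square p 0 by rewrite /square /= normr0 ltW.
have Hm m : cmod (f 0) ^+ m * cmod e <= M ^+ m * L.
  have := @max_principle R (fun x => f x ^+ m * (x ^+ 2 - e)) p (M ^+ m * L) p_gt0.
  have L0 : 0 <= L by rewrite addr_ge0 ?cmod_ge0 ?mulr_ge0 ?exprn_ge0 // ltW.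
  move=> /(_ (mulr_ge0 (exprn_ge0 _ M0) L0)) MP.
  have := MP _ _ 0 S0; rewrite cmodM cmodX expr0n /= sub0r cmodN; apply.
    move=> z Sz; have [ze|ze] := eqVneq (z ^+ 2) e; last first.
      left; apply: germM; last exact: germ_poly2.
      by apply: germX; exact: Hg.
    right; rewrite ze subrr mulr0; split=> //; apply: vanishing_continuous => //.
    have [r [B [r0 H]]] := Hl z ze; exists r, (B ^+ m); split=> // h hr.
    by rewrite cmodX lerXn2r ?nnegrE ?cmod_ge0 ?H // (le_trans (cmod_ge0 _) (H h hr)).
  move=> z Sz Bz; rewrite cmodM cmodX ler_pM ?exprn_ge0 ?cmod_ge0 //.
    by rewrite lerXn2r ?nnegrE ?cmod_ge0 // Hb.
  by apply: le_trans (cmod_triB _ _) _; rewrite cmodX lerD // square_cmod.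
have q01 : 0 <= M / cmod (f 0) < 1.
  by rewrite divr_ge0 ?cmod_ge0 //= ltr_pdivrMr // mul1r.
have : cmod e <= 0.
  apply: (@le_geometric0 _ _ L (M / cmod (f 0)) q01) => m.
  rewrite expr_div_n mulrA ler_pdivlMr ?exprn_gt0 // mulrC [leRHS]mulrC; exact: Hm.
by rewrite leNgt cmod_gt0 e_neq0.
Qed.

(** Multiplication by [x^2 - e] gives a continuous function on the whole compact square, and on the
    boundary this factor has modulus at least [p^2 - |e|]. *)
Lemma boundary_bounded f : germ_off_roots f ->
  exists2 M : R, 0 <= M & forall z, boundary z -> cmod (f z) <= M.
Proof.
move=> [Hg Hl]; have p0 := ltW p_gt0.
have [|z0 Sz0 H] := @square_max R (fun z => cmod (f z * (z ^+ 2 - e))) p p0.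
  move=> z Sz d d0.
  have : continuous_cmod (fun x => f x * (x ^+ 2 - e)) z.
    have [ze|ze] := eqVneq (z ^+ 2) e; last first.
      by apply: germ_continuous; apply: germM (germ_poly2 _ _); exact: Hg.
    by apply: vanishing_continuous => //; exact: Hl.
  move=> /(_ d d0) [r r0 Hr]; exists r => // h /Hr; apply: le_lt_trans.
  rewrite ler_norml; have := cmod_subl (f (z + h) * ((z + h) ^+ 2 - e)) (f z * (z ^+ 2 - e)).
  have := cmod_subl (f z * (z ^+ 2 - e)) (f (z + h) * ((z + h) ^+ 2 - e)).
  rewrite (cmodB (f z * _)); move: (cmod _) (cmod _) (cmod _) => a b c H1 H2.
  by apply/andP; split; lra.
have pe : 0 < p ^+ 2 - cmod e by rewrite subr_gt0.
exists (cmod (f z0 * (z0 ^+ 2 - e)) / (p ^+ 2 - cmod e)).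
  by rewrite divr_ge0 ?cmod_ge0 // ltW.
move=> z Bz; rewrite ler_pdivlMr //.
apply: le_trans (_ : cmod (f z * (z ^+ 2 - e)) <= _); last by apply: H; case: Bz.
rewrite cmodM ler_wpM2l ?cmod_ge0 //.
have := cmod_subl (z ^+ 2) e; rewrite cmodX.
have : p ^+ 2 <= cmod z ^+ 2 by rewrite lerXn2r ?nnegrE ?cmod_ge0 // boundary_cmod.
lra.
Qed.

Lemma psum_split d M (a : nat -> C) x m : 0 < d -> coef_bound d M a -> cmod x <= d / 2 ->
  psum a x = \sum_(l < m) a l * x ^+ l + x ^+ m * psum (fun k => a (m + k)%N) x.
Proof.
move=> d0 aM xd; elim: m => [|m IH]; first by rewrite big_ord0 add0r expr0 mul1r.
have bm : coef_bound d (M / d ^+ m) (fun k => a (m + k)%N).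
  move=> k; rewrite ler_pdivlMr ?exprn_gt0 // -mulrA -exprD addnC; exact: aM.
have bm1 : coef_bound d (M / d ^+ m.+1) (fun k => a (m.+1 + k)%N).
  move=> k; rewrite ler_pdivlMr ?exprn_gt0 // -mulrA -exprD addnC; exact: aM.
rewrite IH big_ord_recr /= -addrA; congr (_ + _).
rewrite {1}/psum (csum_shift (half_q01 R) (coef_bound_half xd bm)) addn0 expr0 mulr1.
rewrite mulrDr mulrC; congr (_ + _); rewrite exprSr -mulrA; congr (_ * _).
rewrite -(csumZ x (half_q01 R) (coef_bound_half xd bm1)).
by apply: csum_ext => k; rewrite addSnnS exprS mulrCA.
Qed.

(** A substitute for Cauchy's estimates, with radius [p / 2] independent of [e]. The maximum
    principle is applied to [(f - s) / x^k], where [s] is the Taylor polynomial of degree below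
    [k]. *)
Lemma coef_growth f (a : nat -> C) (d M : R) : germ_off_roots f ->
  0 < d -> coef_bound d M a -> (forall x, cmod x < d -> f x = psum a x) ->
  exists K : R, forall k, cmod (a k) * (p / 2) ^+ k <= K.
Proof.
move=> Hf d0 aM fa; have [K K0 HK] := boundary_bounded Hf.
have [Hg Hl] := Hf; exists K => k.
suff : cmod (a k) * p ^+ k <= K * 2 ^+ k.
  by rewrite expr_div_n mulrA ler_pdivrMr ?exprn_gt0.
elim/ltn_ind: k => k IH.
pose s x := \sum_(l < k) a l * x ^+ l.
(* The value at [0] is the one that makes [g] analytic there. *)
pose g x := if x == 0 then a k else (f x - s x) * (x ^+ k)^-1.
have gs z : germ s z.
  apply: (@germ2_sum R _ _ (fun (l : 'I_k) _ x => a l * x ^+ l)) => l.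
  by apply: germ2_M; [exact: germ2_cst | exact: (germX l (germ_id z))].
have gz z : z != 0 -> germ (fun x => (x ^+ k)^-1) z.
  by move=> z0; apply: germ2_V; [exact: (germX k (germ_id z)) | rewrite expf_neq0].
have nz z : z != 0 -> exists2 r : R, 0 < r & forall h, cmod h < r ->
    (f (z + h) - s (z + h)) * ((z + h) ^+ k)^-1 = g (z + h).
  move=> z0; exists (cmod z); first by rewrite cmod_gt0.
  move=> h hz; rewrite /g; case: eqP => // /eqP; rewrite addr_eq0 => /eqP zh.
  by move: hz; rewrite zh cmodN ltxx.
have gN z : germ (fun x => - s x) z.
  rewrite (_ : (fun x => _) = fun x => (-1) * s x); first by apply: germM (gs z); exact: germ2_cst.
  by apply/funext => x; rewrite mulN1r.
have : cmod (g 0) <= K * 2 ^+ k / p ^+ k.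
  apply: max_principle_punctured.
  - split=> [z Sz ze|z ze].
      have [->|z0] := eqVneq z 0; last first.
        apply: germ_near (nz z z0); apply: germM (gz z z0); apply: germD (gN z).
        exact: Hg.
      apply/germP; exists (fun l => a (k + l)%N), (d / 2), (M / d ^+ k); split.
      + by rewrite divr_gt0.
      + move=> l; apply: (@le_trans _ _ (cmod (a (k + l)%N) * d ^+ l)).
          rewrite ler_wpM2l ?cmod_ge0 // lerXn2r ?nnegrE ?divr_ge0 ?(ltW d0) //; lra.
        by rewrite ler_pdivlMr ?exprn_gt0 // -mulrA -exprD addnC; exact: aM.
      + move=> x xd; rewrite add0r /g; case: eqP => [->|/eqP x0]; first by rewrite psum_at0 addn0.
        rewrite fa; last lra.
        rewrite (psum_split k d0 aM (ltW xd)) /s addrC addKr mulrC mulKf //.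
        by rewrite expf_neq0.
    have z0 : z != 0 by apply: contraNneq e_neq0 => z00; rewrite -ze z00 expr0n.
    apply: locally_bounded_near (nz z z0).
    apply: locally_boundedM (germ_locally_bounded (gz z z0)).
    by apply: locally_boundedD (germ_locally_bounded (gN z)); exact: Hl.
  - by rewrite divr_ge0 ?mulr_ge0 ?exprn_ge0 // ltW.
  move=> z Bz; have pz := boundary_cmod Bz.
  have z0 : z != 0 by rewrite -cmod_gt0 (lt_le_trans p_gt0).
  have zk l : 0 < cmod z ^+ l by rewrite exprn_gt0 // cmod_gt0.
  rewrite /g (negbTE z0) cmodM cmodV cmodX ler_pdivrMr //.
  have pzl l : p ^+ l <= cmod z ^+ l by rewrite lerXn2r ?nnegrE ?cmod_ge0 // ltW.
  have pl l : 0 < p ^+ l by rewrite exprn_gt0.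
  apply: le_trans (cmod_triB _ _) _.
  have E1 : cmod (f z) <= K / p ^+ k * cmod z ^+ k.
    apply: le_trans (HK z Bz) _; rewrite -mulrA ler_peMr //.
    by rewrite ler_pdivlMl // mulr1.
  have E2 : cmod (s z) <= \sum_(l < k) K * 2 ^+ l / p ^+ k * cmod z ^+ k.
    apply: le_trans (cmod_sum _ _ _) _; apply: ler_sum => -[l /= lk] _.
    rewrite cmodM cmodX.
    have := IH l lk; rewrite -ler_pdivlMr // => El.
    apply: le_trans (ler_wpM2r (ltW (zk l)) El) _.
    rewrite -!mulrA ler_wpM2l // ler_wpM2l ?exprn_ge0 // ler_pdivrMl //.
    rewrite [leRHS](_ : _ = cmod z ^+ l * (cmod z ^+ (k - l) / p ^+ (k - l))).
      by rewrite ler_peMr ?(ltW (zk l)) // ler_pdivlMr // mul1r.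
    rewrite (_ : p ^+ k = p ^+ l * p ^+ (k - l)); last by rewrite -exprD subnKC // ltnW.
    rewrite (_ : cmod z ^+ k = cmod z ^+ l * cmod z ^+ (k - l)); last by rewrite -exprD subnKC // ltnW.
    field.
    by rewrite !gt_eqF.
  apply: le_trans (lerD E1 E2) _.
  rewrite -!mulr_suml -mulr_sumr.
  (* The bound on [f] and the inductive bounds on the lower coefficients add up to
     [K (1 + (2^k - 1))]: this is the cause of the loss from [p] to [p / 2]. *)
  have -> : \sum_(l < k) 2 ^+ l = 2 ^+ k - 1 :> R.
    elim: (k) => [|q IHq]; first by rewrite big_ord0 expr0 subrr.
    by rewrite big_ord_recr /= IHq exprS; ring.
  by rewrite le_eqVlt; apply/orP; left; apply/eqP; ring.
by rewrite /g eqxx ler_pdivlMr ?exprn_gt0.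
Qed.

End CoefficientGrowth.

(** * Complex derivatives and the exponential *)

Section Calculus.
Variable R : realType.
Local Notation C := R[i].
Implicit Types (f g : C -> C) (x D : C).

Lemma has_cderiv_continuous f x D : has_cderiv f x D -> continuous_cmod f x.
Proof.
move=> H e e0; have [r r0 Hr] := H 1 ltr01.
pose c := 1 + cmod D; have c0 : 0 < c by rewrite /c; have := cmod_ge0 D; lra.
exists (Num.min r (e / c)); first by rewrite lt_min r0 divr_gt0.
move=> h; rewrite lt_min ltr_pdivlMr // => /andP[hr he].
have := cmod_subl (f (x + h) - f x) (h * D); rewrite cmodM => E.
by have := Hr h hr; move: he; rewrite /c; lra.
Qed.

Lemma has_cderiv_unique f x D D' : has_cderiv f x D -> has_cderiv f x D' -> D = D'.
Proof.
move=> H H'; apply/eqP; rewrite -subr_eq0 -cmod_eq0 eq_le cmod_ge0 andbT leNgt.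
apply/negP => DD; have e0 : 0 < cmod (D - D') / 4 by lra.
have [r r0 Hr] := H _ e0; have [r' r'0 Hr'] := H' _ e0.
pose s := Num.min r r' / 2.
have m0 : 0 < Num.min r r' by rewrite lt_min r0.
have m1 : Num.min r r' <= r by rewrite ge_min lexx.
have m2 : Num.min r r' <= r' by rewrite ge_min lexx orbT.
have s0 : 0 < s by rewrite /s; lra.
have cs : cmod s%:C = s by rewrite cmodR gtr0_norm.
have E1 := Hr s%:C; have E2 := Hr' s%:C; rewrite cs in E1 E2.
have : cmod (s%:C * (D - D')) <= cmod (D - D') / 4 * s + cmod (D - D') / 4 * s.
  rewrite (_ : s%:C * (D - D') = (f (x + s%:C) - f x - s%:C * D') - (f (x + s%:C) - f x - s%:C * D)); last by ring.
  apply: le_trans (cmod_triB _ _) _; apply: lerD; [apply: E2 | apply: E1]; rewrite /s; lra.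
by rewrite cmodM cs; nra.
Qed.

Lemma has_cderiv_near f g x D : has_cderiv f x D ->
  (exists2 r : R, 0 < r & forall h, cmod h < r -> f (x + h) = g (x + h)) ->
  has_cderiv g x D.
Proof.
move=> H [r r0 fg] e e0; have [s s0 Hs] := H e e0.
exists (Num.min r s); first by rewrite lt_min r0.
move=> h; rewrite lt_min => /andP[hr hs]; have := Hs h hs.
by rewrite fg // -[in f x](addr0 x) fg ?cmod0 // addr0.
Qed.

Lemma has_cderiv_cst (c : C) x : has_cderiv (fun=> c) x 0.
Proof.
move=> e e0; exists 1 => // h _; rewrite subrr mulr0 subr0 cmod0.
by rewrite mulr_ge0 ?cmod_ge0 // ltW.
Qed.

Lemma has_cderiv_id x : has_cderiv id x 1.
Proof.
move=> e e0; exists 1 => // h _.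
by rewrite mulr1 /= (addrC x) addrK subrr cmod0 mulr_ge0 ?cmod_ge0 // ltW.
Qed.

Lemma has_cderivD f g x D D' : has_cderiv f x D -> has_cderiv g x D' ->
  has_cderiv (fun y => f y + g y) x (D + D').
Proof.
move=> H H' e e0; have e2 : 0 < e / 2 by lra.
have [r r0 Hr] := H _ e2; have [r' r'0 Hr'] := H' _ e2.
exists (Num.min r r'); first by rewrite lt_min r0.
move=> h; rewrite lt_min => /andP[hr hr'].
rewrite (_ : _ - _ - _ = (f (x + h) - f x - h * D) + (g (x + h) - g x - h * D')); last by ring.
apply: le_trans (cmodD _ _) _; rewrite [e]splitr mulrDl.
by apply: lerD; [exact: Hr | exact: Hr'].
Qed.

Lemma has_cderiv_sum (I : Type) (r : seq I) (F : I -> C -> C) (G : I -> C) x :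
  (forall i, has_cderiv (F i) x (G i)) ->
  has_cderiv (fun y => \sum_(i <- r) F i y) x (\sum_(i <- r) G i).
Proof.
move=> H; elim: r => [|i r IH].
  rewrite big_nil (_ : (fun _ => _) = fun=> 0); first exact: has_cderiv_cst.
  by apply/funext => y; rewrite big_nil.
rewrite big_cons (_ : (fun _ => _) = fun y => F i y + \sum_(j <- r) F j y).
  exact: has_cderivD.
by apply/funext => y; rewrite big_cons.
Qed.

Lemma has_cderiv_comp f g x D D' : has_cderiv f x D -> has_cderiv g (f x) D' ->
  has_cderiv (fun y => g (f y)) x (D * D').
Proof.
move=> H H' e e0.
pose c := 1 + cmod D; have c0 : 0 < c by rewrite /c; have := cmod_ge0 D; lra.
have c0' : 0 < 1 + cmod D' by have := cmod_ge0 D'; lra.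
have e1 : 0 < e / 2 / c by rewrite !divr_gt0.
have e2 : 0 < e / 2 / (1 + cmod D') by rewrite !divr_gt0.
have [r r0 Hr] := H' _ e1; have [s s0 Hs] := H _ e2; have [s1 s10 Hs1] := H _ ltr01.
have [s2 s20 Hs2] := has_cderiv_continuous H r0.
exists (Num.min (Num.min s s1) s2); first by rewrite !lt_min s0 s10.
move=> h; rewrite !lt_min => /andP[/andP[hs hs1] hs2].
pose k := f (x + h) - f x.
have fk : f (x + h) = f x + k by rewrite /k [RHS]addrC subrK.
have kc : cmod k <= c * cmod h.
  have := Hs1 h hs1; have := cmod_subl k (h * D); rewrite -/k cmodM /c; lra.
have E1 : cmod (g (f x + k) - g (f x) - k * D') <= e / 2 / c * (c * cmod h).
  apply: le_trans (Hr k (Hs2 h hs2)) _; rewrite ler_wpM2l // ltW //.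
have E2 : cmod ((k - h * D) * D') <= e / 2 / (1 + cmod D') * cmod h * (1 + cmod D').
  rewrite cmodM; apply: ler_pM; rewrite ?cmod_ge0 //; first exact: Hs.
  by rewrite lerDr.
rewrite fk (_ : _ - _ - _ = (g (f x + k) - g (f x) - k * D') + (k - h * D) * D'); last by ring.
apply: le_trans (cmodD _ _) _; apply: le_trans (lerD E1 E2) _.
rewrite le_eqVlt; apply/orP; left; apply/eqP; field.
by rewrite !gt_eqF.
Qed.

Lemma has_cderivM f g x D D' : has_cderiv f x D -> has_cderiv g x D' ->
  has_cderiv (fun y => f y * g y) x (D * g x + f x * D').
Proof.
move=> H H' e e0.
pose a := 1 + cmod (g x) + cmod (f x) + cmod D'.
have a0 : 0 < a by rewrite /a; have := cmod_ge0 D'; have := cmod_ge0 (g x); have := cmod_ge0 (f x); lra.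
pose d := Num.min 1 (e / (4 * a)).
have d0 : 0 < d by rewrite lt_min ltr01 divr_gt0 //; lra.
have d1 : d <= 1 by rewrite ge_min lexx.
have de : 4 * a * d <= e.
  have : d <= e / (4 * a) by rewrite ge_min lexx orbT.
  by rewrite ler_pdivlMr; lra.
have [r r0 Hr] := H d d0; have [s s0 Hs] := H' d d0.
have [r1 r10 Hr1] := has_cderiv_continuous H d0.
exists (Num.min (Num.min r s) r1); first by rewrite !lt_min r0 s0.
move=> h; rewrite !lt_min => /andP[/andP[hr hs] hr1].
pose k := f (x + h) - f x.
rewrite (_ : _ - _ - _ = (f (x + h) - f x - h * D) * g x +
   (f x * (g (x + h) - g x - h * D') + k * (g (x + h) - g x - h * D') + k * (h * D'))); last by rewrite /k; ring.
have h0 := cmod_ge0 h; have kd := ltW (Hr1 h hr1); rewrite -/k in kd.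
have E1 : cmod ((f (x + h) - f x - h * D) * g x) <= d * cmod h * a.
  rewrite cmodM; apply: ler_pM; rewrite ?cmod_ge0 ?Hr // /a.
  by have := cmod_ge0 D'; have := cmod_ge0 (f x); lra.
have E2 : cmod (f x * (g (x + h) - g x - h * D')) <= a * (d * cmod h).
  rewrite cmodM; apply: ler_pM; rewrite ?cmod_ge0 ?Hs // /a.
  by have := cmod_ge0 D'; have := cmod_ge0 (g x); lra.
have E3 : cmod (k * (g (x + h) - g x - h * D')) <= a * (d * cmod h).
  rewrite cmodM; apply: ler_pM; rewrite ?cmod_ge0 ?Hs //; apply: (le_trans kd).
  by rewrite /a; have := cmod_ge0 D'; have := cmod_ge0 (g x); have := cmod_ge0 (f x); lra.
have E4 : cmod (k * (h * D')) <= d * (cmod h * a).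
  rewrite !cmodM; apply: ler_pM; rewrite ?mulr_ge0 ?cmod_ge0 // ler_wpM2l //.
  by rewrite /a; have := cmod_ge0 (g x); have := cmod_ge0 (f x); lra.
apply: le_trans (cmodD _ _) _; apply: le_trans (lerD E1 (cmodD _ _)) _.
have E5 := cmodD (f x * (g (x + h) - g x - h * D')) (k * (g (x + h) - g x - h * D')).
apply: le_trans (_ : _ <= 4 * a * d * cmod h) _; last by rewrite ler_wpM2r.
have -> : 4 * a * d * cmod h = d * cmod h * a + (a * (d * cmod h) + a * (d * cmod h) + d * (cmod h * a)) by ring.
by rewrite lerD2l; apply: lerD E4; apply: le_trans E5 (lerD E2 E3).
Qed.

Lemma has_cderiv_inv x : x != 0 -> has_cderiv (fun y => y^-1) x (- (x ^- 2)).
Proof.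
move=> x0 e e0; have c0 : 0 < cmod x by rewrite cmod_gt0.
have cc : 0 < cmod x ^+ 3 by rewrite exprn_gt0.
exists (Num.min (cmod x / 2) (e * cmod x ^+ 3 / 2)).
  by rewrite lt_min !divr_gt0 // mulr_gt0.
move=> h; rewrite lt_min => /andP[h1 h2].
have xh : cmod x / 2 <= cmod (x + h).
  by have := cmod_subl x (- h); rewrite opprK cmodN; lra.
have xh0 : x + h != 0 by rewrite -cmod_gt0; lra.
rewrite (_ : _ - _ - _ = h ^+ 2 * ((x + h)^-1 * (x ^+ 2)^-1)); last by field; rewrite x0 xh0.
rewrite !cmodM !cmodV !cmodX -invfM.
rewrite ler_pdivrMr ?mulr_gt0 ?exprn_gt0 //; last lra.
have : cmod x ^+ 3 / 2 <= cmod (x + h) * cmod x ^+ 2.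
  by rewrite exprS mulrAC ler_wpM2r ?exprn_ge0 ?cmod_ge0.
move=> H; have h0 := cmod_ge0 h; rewrite expr2.
apply: le_trans (_ : e * cmod h * (cmod x ^+ 3 / 2) <= _).
  by rewrite -mulrA mulrCA ler_wpM2l // mulrA ltW.
by rewrite ler_wpM2l // mulr_ge0 // ltW.
Qed.

Lemma germ_has_cderiv f z : germ f z -> exists D, has_cderiv f z D.
Proof.
move=> /germP[a [d [M [d0 aM H]]]].
have z8 : cmod (0 : C) < d / 8 by rewrite cmod0; lra.
have P := psum_deriv d0 aM z8.
exists (psum (dcoef a) 0) => e e0; have [r r0 Hr] := P e e0.
exists (Num.min r d); first by rewrite lt_min r0.
move=> h; rewrite lt_min => /andP[hr hd]; have := Hr h hr.
have E0 : psum a 0 = f z by rewrite -H ?cmod0 // addr0.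
by rewrite add0r E0 -(H h hd).
Qed.

Lemma real_is_derive (f : R -> R) (x d : R) : is_derive x (1 : R) f d ->
  forall e : R, 0 < e -> exists2 r : R, 0 < r &
    forall h, `|h| < r -> `|f (x + h) - f x - h * d| <= e * `|h|.
Proof.
move=> [fd <-] e e0.
have : (fun h => h^-1 *: (f (h *: (1 : R) + x) - f x)) @ (0 : R)^' --> 'D_1 f x by exact: fd.
move=> /cvgrPdist_le /(_ e e0); rewrite /dnbhs /within /= => /nbhs_ballP [r /= r0 Hr].
exists r => // h hr; have [->|h0] := eqVneq h 0.
  by rewrite addr0 subrr mul0r subr0 normr0 mulr0.
have := Hr h; rewrite -ball_normE /= sub0r normrN => /(_ hr h0).
rewrite -(ler_pM2r (_ : 0 < `|h|)) ?normr_gt0 // -normrM; congr (_ <= _).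
rewrite -normrN; congr `| _ |; rewrite /GRing.scale /= mulr1 (addrC h).
by field.
Qed.

End Calculus.

(** * The exponential and local logarithms *)

Section ComplexExponential.
Variable R : realType.
Local Notation C := R[i].
Implicit Types (z u : C).

Lemma Re_cexp z : complex.Re (cexp z) = expR (complex.Re z) * cos (complex.Im z).
Proof. by rewrite /cexp re_mul /= mul0r subr0. Qed.

Lemma Im_cexp z : complex.Im (cexp z) = expR (complex.Re z) * sin (complex.Im z).
Proof. by rewrite /cexp im_mul /= mul0r addr0. Qed.

Lemma cexpD z u : cexp (z + u) = cexp z * cexp u.
Proof.
apply: eq_ReIm; [rewrite [RHS]re_mul | rewrite [RHS]im_mul];
  rewrite !Re_cexp !Im_cexp re_add im_add expRD ?cosD ?sinD; ring.
Qed.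

Lemma cmod_cexp z : cmod (cexp z) = expR (complex.Re z).
Proof.
rewrite cmod_def Re_cexp Im_cexp !exprMn -mulrDr cos2Dsin2 mulr1 sqrtr_sqr.
by rewrite ger0_norm // expR_ge0.
Qed.

Lemma cexp_neq0 z : cexp z != 0.
Proof. by rewrite -cmod_gt0 cmod_cexp expR_gt0. Qed.

Lemma cexp0 : cexp 0 = 1 :> C.
Proof. by apply: eq_ReIm; rewrite ?Re_cexp ?Im_cexp /= expR0 ?cos0 ?sin0 mul1r. Qed.

Lemma cexpN z : cexp (- z) = (cexp z)^-1.
Proof.
by apply: (mulfI (cexp_neq0 z)); rewrite -cexpD subrr cexp0 divff // cexp_neq0.
Qed.

Lemma cexp_eq1 z : cexp z = 1 -> complex.Re z = 0 /\ cos (complex.Im z) = 1.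
Proof.
move=> z1; have Rz : complex.Re z = 0.
  by apply: expR_inj; rewrite -cmod_cexp z1 cmod1 expR0.
by split=> //; have := Re_cexp z; rewrite z1 Rz expR0 mul1r => <-.
Qed.

(** The argument is the [acos] of [Re y / |y|], with the sign of [Im y]. Its cosine is recorded
    because it controls the size of the argument when [y] is close to [1]. *)
Lemma cexp_log (y : C) : y != 0 ->
  exists u, [/\ cexp u = y, - pi <= complex.Im u <= pi &
    cos (complex.Im u) = complex.Re y / cmod y].
Proof.
move=> y0; have c0 : 0 < cmod y by rewrite cmod_gt0.
pose c := complex.Re y / cmod y.
have c1 : -1 <= c <= 1.
  by rewrite -ler_norml /c normrM normfV (gtr0_norm c0) ler_pdivrMr // mul1r Re_le_cmod.
have cI : c \in `[-1, 1] by rewrite in_itv.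
have s2 : Num.sqrt (1 - c ^+ 2) = `|complex.Im y| / cmod y.
  rewrite (_ : 1 - c ^+ 2 = (complex.Im y / cmod y) ^+ 2); last first.
    rewrite /c !expr_div_n -[1](divff (_ : cmod y ^+ 2 != 0)) ?expf_neq0 ?gt_eqF //.
    by rewrite -mulrBl {1}sqr_cmod addrC addKr.
  by rewrite sqrtr_sqr normrM normfV (gtr0_norm c0).
have pi0 := @pi_ge0 R.
have a0 := acos_ge0 c1; have a1 := acos_lepi c1.
have [y_ge0|y_lt0] := leP 0 (complex.Im y).
  exists (ln (cmod y) +i* acos c); split=> /=.
  - apply: eq_ReIm; rewrite ?Re_cexp ?Im_cexp /= lnK ?posrE //.
      by rewrite acosK // mulrC divfK // gt_eqF.
    by rewrite sin_acos // s2 ger0_norm // mulrC divfK // gt_eqF.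
  - by rewrite a1 andbT; lra.
  - by rewrite acosK.
exists (ln (cmod y) +i* - acos c); split=> /=.
- apply: eq_ReIm; rewrite ?Re_cexp ?Im_cexp /= lnK ?posrE //.
    by rewrite cosN acosK // mulrC divfK // gt_eqF.
  by rewrite sinN sin_acos // s2 ltr0_norm // mulNr opprK mulrC divfK // gt_eqF.
- by apply/andP; split; lra.
- by rewrite cosN acosK.
Qed.

Lemma cexp_log_near1 (eta : R) : 0 < eta -> exists2 d : R, 0 < d &
  forall y, cmod (y - 1) < d -> exists2 u : C, cexp u = y & `|complex.Im u| < eta.
Proof.
move=> eta0; pose t := Num.min eta pi.
have pi0 := @pi_gt0 R.
have t0 : 0 < t by rewrite lt_min eta0.
have tpi : t <= pi by rewrite ge_min lexx orbT.
have tI : t \in `[0, pi] by rewrite in_itv /= tpi andbT ltW.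
have ct : cos t < 1 by rewrite -cos0 ltr_cos // in_itv /= lexx ltW.
have ct1 : -1 <= cos t by apply: cos_geN1.
(* If [|y - 1| <= D] then [Re y / |y| >= (1 - D) / (1 + D)], which exceeds [cos t] when
   [2 D < 1 - cos t]. *)
exists (Num.min 2^-1 ((1 - cos t) / 4)); first by rewrite lt_min; apply/andP; split; lra.
move=> y; rewrite lt_min => /andP[y2 yc].
have Ry : 1 - cmod (y - 1) <= complex.Re y.
  by have := Re_le_cmod (y - 1); rewrite re_add re_opp /= ler_norml => /andP[]; lra.
have cy : cmod y <= 1 + cmod (y - 1) by have := cmod_subl y 1; rewrite cmod1; lra.
have d0 := cmod_ge0 (y - 1).
have y0 : y != 0.
  by apply/eqP => y0; move: Ry; rewrite {2}y0 /=; lra.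
have [u [uy ub uc]] := cexp_log y0; exists u => //.
have c0 : 0 < cmod y by rewrite cmod_gt0.
rewrite ltNge; apply/negP => etau.
have ucos : cos `|complex.Im u| = complex.Re y / cmod y.
  rewrite -uc; have [p|p] := leP 0 (complex.Im u); first by rewrite ger0_norm.
  by rewrite ltr0_norm // cosN.
have : cos `|complex.Im u| <= cos t.
  have ub' : `|complex.Im u| <= pi by rewrite ler_norml.
  have [->//|nu] := eqVneq `|complex.Im u| t.
  have tu : t < `|complex.Im u|.
    by rewrite lt_neqAle eq_sym nu /= (le_trans _ etau) // ge_min lexx.
  by rewrite ltW // ltr_cos // in_itv /= normr_ge0.
rewrite ucos ler_pdivrMr //; apply/negP; rewrite -ltNge.
by move: (cos t) ct ct1 yc => k k1 k2 k3; nra.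
Qed.

Lemma cexp_deriv z : has_cderiv (@cexp R) z (cexp z).
Proof.
have H0 : has_cderiv (@cexp R) (0 : C) 1.
  move=> e e0.
  pose d := Num.min 1 (e / 6); have d0 : 0 < d by rewrite lt_min ltr01; lra.
  have d1 : d <= 1 by rewrite ge_min lexx.
  have de : d <= e / 6 by rewrite ge_min lexx orbT.
  have [r1 r10 H1] := real_is_derive (is_derive_expR (0 : R)) d0.
  have [r2 r20 H2] := real_is_derive (is_derive_cos (0 : R)) d0.
  have [r3 r30 H3] := real_is_derive (is_derive_sin (0 : R)) d0.
  exists (Num.min (Num.min r1 r2) (Num.min r3 (d / 2))).
    by rewrite !lt_min r10 r20 r30; lra.
  move=> h; rewrite !lt_min => /andP[/andP[h1 h2] /andP[h3 h4]].
  have hx := Re_le_cmod h; have hy := Im_le_cmod h.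
  have := H1 (complex.Re h) (le_lt_trans hx h1).
  have := H2 (complex.Im h) (le_lt_trans hy h2).
  have := H3 (complex.Im h) (le_lt_trans hy h3).
  rewrite !add0r expR0 cos0 sin0 oppr0 mulr0 !subr0 !addr0 !mulr1.
  rewrite cexp0.
  move=> A3 A2 A1; apply: le_trans (cmod_le_ReIm _) _.
  rewrite !(re_add, im_add, re_opp, im_opp) Re_cexp Im_cexp /= oppr0 addr0.
  have h0 := cmod_ge0 h.
  move: (expR _) (cos _) (sin _) A1 A2 A3 => E c s A1 A2 A3.
  have x0 := normr_ge0 (complex.Re h); have y0 := normr_ge0 (complex.Im h).
  have E1 : `|E - 1| <= d.
    rewrite (_ : E - 1 = (E - 1 - complex.Re h) + complex.Re h); last by ring.
    by apply: le_trans (ler_normD _ _) _; nra.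
  have E2 : `|E| <= 2.
    by have := ler_normD (E - 1) 1; rewrite subrK normr1; lra.
  have B1 : `|E * c - 1 - complex.Re h| <= 3 * d * cmod h.
    rewrite (_ : _ - _ = (E - 1 - complex.Re h) + E * (c - 1)); last by ring.
    apply: le_trans (ler_normD _ _) _; rewrite normrM.
    have : `|E| * `|c - 1| <= 2 * (d * `|complex.Im h|) by rewrite ler_pM.
    by nra.
  have B2 : `|E * s - complex.Im h| <= 3 * d * cmod h.
    rewrite (_ : _ - _ = E * (s - complex.Im h) + (E - 1) * complex.Im h); last by ring.
    apply: le_trans (ler_normD _ _) _; rewrite !normrM.
    have : `|E| * `|s - complex.Im h| <= 2 * (d * `|complex.Im h|) by rewrite ler_pM.
    have : `|E - 1| * `|complex.Im h| <= d * cmod h by rewrite ler_pM.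
    by nra.
  by apply: le_trans (lerD B1 B2) _; nra.
move=> e e0; have ez : 0 < e / cmod (cexp z) by rewrite divr_gt0 // cmod_gt0 cexp_neq0.
have [r r0 Hr] := H0 _ ez; exists r => // h /Hr; rewrite !add0r cexp0 mulr1.
rewrite cexpD (_ : _ * cexp h - _ - _ = cexp z * (cexp h - 1 - h)); last by ring.
rewrite cmodM => H; apply: le_trans (ler_wpM2l (cmod_ge0 _) H) _.
have cz : cmod (cexp z) != 0 by rewrite cmod_eq0 cexp_neq0.
by rewrite mulrA [cmod _ * _]mulrC divfK.
Qed.

(** A continuous logarithm of a differentiable function is differentiable. Needed because the branch
    [lg] in [is_branchD] is only given as continuous. *)
Lemma cexp_lift_deriv (g E : C -> C) (z D : C) : continuous_cmod g z ->
  has_cderiv E z D -> (exists2 r : R, 0 < r & forall h, cmod h < r -> cexp (g (z + h)) = E (z + h)) ->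
  has_cderiv g z (D / E z).
Proof.
move=> gc HE [r0 r00 gE] e e0.
have Ez : E z = cexp (g z) by rewrite -(addr0 z) gE ?cmod0.
have Ez0 : E z != 0 by rewrite Ez cexp_neq0.
pose q h := E (z + h) / E z - 1.
have qu h : cmod h < r0 -> q h = cexp (g (z + h) - g z) - 1.
  by move=> hr; rewrite /q -gE // Ez cexpD cexpN.
pose A := cmod (D / E z) + 1.
have A0 : 0 < A by rewrite /A; have := cmod_ge0 (D / E z); lra.
pose d := Num.min 2^-1 (e / (4 * A)).
have d0 : 0 < d by rewrite lt_min divr_gt0 ?mulr_gt0 // invr_gt0 ltr0n.
have d2 : d <= 2^-1 by rewrite ge_min lexx.
have de : d * (4 * A) <= e.
  by rewrite -ler_pdivlMr ?mulr_gt0 // ge_min lexx orbT.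
have [r1 r10 H1] := cexp_deriv 0 d0.
have [r2 r20 H2] := gc r1 r10.
have e2 : 0 < Num.min 1 (e / 2) * cmod (E z).
  by rewrite mulr_gt0 ?cmod_gt0 // lt_min ltr01; lra.
have [r3 r30 H3] := HE _ e2.
exists (Num.min r0 (Num.min r2 r3)); first by rewrite !lt_min r00 r20.
move=> h; rewrite !lt_min => /and3P[h0 h2 h3].
pose u := g (z + h) - g z.
have := H1 u (H2 h h2); rewrite !add0r cexp0 mulr1 -qu // -/u => U1.
(* Quantitative injectivity of the exponential at [0], from [|exp u - 1 - u| <= |u| / 2]. *)
have U2 : cmod u <= 2 * cmod (q h).
  have := cmod_subl u (q h); rewrite cmodB => U3.
  by have := cmod_ge0 u; nra.
have Q1 : cmod (q h - h * (D / E z)) <= Num.min 1 (e / 2) * cmod h.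
  rewrite (_ : _ - _ = (E (z + h) - E z - h * D) / E z); last by rewrite /q; field.
  rewrite cmodM cmodV ler_pdivrMr ?cmod_gt0 //.
  by apply: le_trans (H3 h h3) _; rewrite mulrAC.
have m1 : Num.min 1 (e / 2) <= 1 by rewrite ge_min lexx.
have m2 : Num.min 1 (e / 2) <= e / 2 by rewrite ge_min lexx orbT.
have hh := cmod_ge0 h.
have Q2 : cmod (q h) <= A * cmod h.
  have := cmod_subl (q h) (h * (D / E z)); rewrite cmodM /A.
  by nra.
rewrite -/u (_ : u - _ = (u - q h) + (q h - h * (D / E z))); last by ring.
apply: le_trans (cmodD _ _) _; rewrite (cmodB u).
have dA : d * cmod u <= d * (2 * (A * cmod h)) by rewrite ler_wpM2l ?(ltW d0) //; lra.
have : d * (4 * A) * cmod h <= e * cmod h by rewrite ler_wpM2r.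
have : Num.min 1 (e / 2) * cmod h <= e / 2 * cmod h by rewrite ler_wpM2r.
lra.
Qed.

End ComplexExponential.

(** * Geometry of the domains on a ray *)

Section Ray.
Variable R : realType.
Local Notation C := R[i].
Variables (a gam r c0 h kap : R).
Hypothesis a_gt0 : 0 < a.

(* On the ray [arg eps = 2 pi] of the universal covering the rotation angle
   [thetahat] vanishes, so the domains in the [t]-plane are horizontal strips. *)
Definition ray : C := ln (a ^+ 2) +i* (2 * pi).

Let a_neq0 : a != 0. Proof. exact: lt0r_neq0. Qed.

Lemma half_ray : ray / 2 = ln a +i* pi.
Proof.
have -> : (2 : C) = (2 : R)%:C by rewrite rmorph_nat.
rewrite -fmorphV /= /ray lnXn //; apply: eq_ReIm; rewrite ?re_mul ?im_mul /= !mulr0 ?subr0 ?add0r.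
  by rewrite -[ln a *+ 2]mulr_natr; field.
by field.
Qed.

Lemma sqrte_ray : Defs.sqrte ray = (- a)%:C.
Proof.
rewrite /Defs.sqrte half_ray; apply: eq_ReIm; rewrite ?Re_cexp ?Im_cexp /= lnK ?posrE //.
  by rewrite cospi mulrN1.
by rewrite sinpi mulr0.
Qed.

Lemma cexp_ray : cexp ray = (a ^+ 2)%:C.
Proof.
rewrite /ray; apply: eq_ReIm; rewrite ?Re_cexp ?Im_cexp /= lnK ?posrE ?exprn_gt0 //.
  by rewrite mulr_natl cos2pi mulr1.
by rewrite mulr_natl sin2pi mulr0.
Qed.

Lemma modulus_ray : Defs.modulus ray = a ^+ 2.
Proof. by rewrite /Defs.modulus /= lnK ?posrE ?exprn_gt0. Qed.

Lemma thetahat_ray : thetahat gam ray = 0.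
Proof.
by rewrite /thetahat /= (_ : 2 * pi / 2 = pi) ?subrr ?mulr0 //; field.
Qed.

Lemma sigma_ray u : sigma gam c0 ray u = 0.
Proof. by rewrite /sigma thetahat_ray tan0 mulr0; case: ifP. Qed.

Lemma period_ray : period ray = 0 +i* (pi / a).
Proof.
rewrite /period sqrte_ray rmorphN invrN mulrN mulNr opprK -fmorphV.
by apply: eq_ReIm; rewrite ?re_mul ?im_mul /= ?mul0r ?mulr0 ?subrr ?addr0 ?add0r.
Qed.

Lemma expi_ray : expi (- thetahat gam ray) = 1 :> C.
Proof. by rewrite thetahat_ray oppr0 /expi -[RHS]cexp0. Qed.

Lemma sectorS_ray rho : 0 < gam -> a ^+ 2 < rho -> sectorS gam rho ray.
Proof.
move=> g0 ar; split; first by rewrite modulus_ray.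
by rewrite /=; have := @pi_gt0 R => p0; apply/andP; split; lra.
Qed.

Let bnd : R := (2^-1 + kap) * (pi / a).

Lemma GammaD_ray t : ~ hole r ray t -> - bnd < complex.Im t < h ->
  GammaD gam r c0 h kap ray t.
Proof.
move=> Ht /andP[t1 t2]; split=> //; first by rewrite sigma_ray addr0.
rewrite expi_ray mulr1 im_add period_ray im_mul /= mul0r addr0.
by move: t1; rewrite /bnd; lra.
Qed.

Lemma GammaU_ray t : ~ hole r ray t -> - h < complex.Im t < bnd ->
  GammaU gam r c0 h kap ray t.
Proof.
move=> Ht /andP[t1 t2]; split=> //; first by rewrite sigma_ray addr0.
rewrite expi_ray mulr1 im_add im_opp period_ray im_mul /= mul0r addr0.
by move: t2; rewrite /bnd; lra.
Qed.

(** This is [sinh(a Re t)^2], the common part of [|cosh(a t)|^2] and [|sinh(a t)|^2]. *)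
Let sh (t : C) : R := ((expR (a * complex.Re t) - expR (- (a * complex.Re t))) / 2) ^+ 2.

Lemma cmod_ccosh_ray t :
  cmod (ccosh (Defs.sqrte ray * t)) ^+ 2 = sh t + cos (a * complex.Im t) ^+ 2.
Proof.
rewrite /ccosh sqrte_ray rmorphN mulNr opprK cmodM cmodV cmod_nat exprMn.
rewrite sqr_cmod re_add im_add !Re_cexp !Im_cexp !re_opp !im_opp cosN sinN.
rewrite !re_mul !im_mul /= !mul0r subr0 addr0 /sh.
set E := expR _; set F := expR _.
have EF : E * F = 1 by rewrite /E /F expRN ?divff ?mulVf // gt_eqF // expR_gt0.
have cs := cos2Dsin2 (a * complex.Im t).
move: (cos _) (sin _) E F EF cs => c s E F EF cs.
rewrite (_ : _ + _ = (E - F) ^+ 2 * (c ^+ 2 + s ^+ 2) + 4 * (E * F) * c ^+ 2); last by ring.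
by rewrite cs EF; field.
Qed.

Lemma cmod_csinh_ray t :
  cmod (csinh (Defs.sqrte ray * t)) ^+ 2 = sh t + sin (a * complex.Im t) ^+ 2.
Proof.
rewrite /csinh sqrte_ray rmorphN mulNr opprK cmodM cmodV cmod_nat exprMn.
rewrite sqr_cmod re_add im_add re_opp im_opp !Re_cexp !Im_cexp !re_opp !im_opp cosN sinN.
rewrite !re_mul !im_mul /= !mul0r subr0 addr0 /sh.
set E := expR _; set F := expR _.
have EF : E * F = 1 by rewrite /E /F expRN ?divff ?mulVf // gt_eqF // expR_gt0.
have cs := cos2Dsin2 (a * complex.Im t).
move: (cos _) (sin _) E F EF cs => c s E F EF cs.
rewrite (_ : _ + _ = (E - F) ^+ 2 * (c ^+ 2 + s ^+ 2) + 4 * (E * F) * s ^+ 2); last by ring.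
by rewrite cs EF; field.
Qed.

Definition outside t :=
  cmod (Defs.sqrte ray * ccosh (Defs.sqrte ray * t)) < r * cmod (csinh (Defs.sqrte ray * t)).

(** The hole is a component of the set [|x(t)| >= r] and so lies inside it, whatever its shape. *)
Lemma outside_not_hole t : outside t -> ~ hole r ray t.
Proof.
move=> Ot /connected_component_sub /=.
by rewrite !cmodE -rmorphM lecR leNgt -/(outside t) Ot.
Qed.

Lemma outsideE t : 0 < r -> outside t =
  (a ^+ 2 * (sh t + cos (a * complex.Im t) ^+ 2) <
   r ^+ 2 * (sh t + sin (a * complex.Im t) ^+ 2)).
Proof.
move=> r0; rewrite /outside -cmod_ccosh_ray -cmod_csinh_ray.
rewrite cmodM {1}sqrte_ray cmodR normrN gtr0_norm //.
by rewrite -!exprMn ltr_pXn2r // nnegrE mulr_ge0 ?cmod_ge0 // ltW.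
Qed.

Lemma sh_mono t u : `|complex.Re t| <= `|complex.Re u| -> sh t <= sh u.
Proof.
move=> tu; have shE v : sh v = ((expR (a * `|complex.Re v|) - expR (- (a * `|complex.Re v|))) / 2) ^+ 2.
  rewrite /sh; have [v0|v0] := leP 0 (complex.Re v); first by rewrite ger0_norm.
  by rewrite ltr0_norm // mulrN opprK; ring.
have a0 := ltW a_gt0.
rewrite !shE lerXn2r ?nnegrE ?divr_ge0 ?subr_ge0 ?ler_expR //.
- by have := mulr_ge0 a0 (normr_ge0 (complex.Re t)); lra.
- by have := mulr_ge0 a0 (normr_ge0 (complex.Re u)); lra.
rewrite ler_wpM2r ?invr_ge0 // lerB // ler_expR ?lerN2 ler_wpM2l //.
Qed.

(** Moving horizontally away from the imaginary axis increases [(r^2 - a^2) sinh(a Re t)^2]. Hence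
    horizontal half-lines avoid the hole, as is needed to reach the unbounded components of the
    overlap. *)
Lemma outside_mono t u : 0 < r -> a < r -> complex.Im u = complex.Im t ->
  `|complex.Re t| <= `|complex.Re u| -> outside t -> outside u.
Proof.
move=> r0 ar ut tu; rewrite !outsideE // ut => H; have := sh_mono tu.
have : a ^+ 2 < r ^+ 2 by rewrite ltr_pXn2r // nnegrE ltW.
move: (a ^+ 2) (r ^+ 2) (sh t) (sh u) (cos _ ^+ 2) (sin _ ^+ 2) H => A B x y c s H AB xy.
by nra.
Qed.

(** On the ray [x(t) = - a coth(a t)], a Moebius function of [exp(2 a t)]. The times of a point are
    therefore the logarithms of a quotient, determined modulo the period [pi i / a]. *)
Lemma xt_ray (t x : C) : x ^+ 2 != (a ^+ 2)%:C ->
  cexp ((2 * a)%:C * t) = (x - a%:C) / (x + a%:C) ->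
  csinh (Defs.sqrte ray * t) != 0 /\ xt ray t = x.
Proof.
move=> xa; rewrite rmorphXn /= in xa.
have xp : x + a%:C != 0.
  by apply: contraNneq xa => xp; rewrite -subr_eq0 subr_sqr xp mulr0.
have aC0 : a%:C != 0 :> C by rewrite -(rmorph0 (real_complex R)) (inj_eq (@complexI _)).
rewrite /xt /csinh /ccosh sqrte_ray rmorphN mulNr opprK cexpN.
have -> : (2 * a)%:C * t = a%:C * t + a%:C * t by rewrite rmorphM rmorph_nat; ring.
rewrite cexpD; have := cexp_neq0 (a%:C * t); move: (cexp _) => E E0 EE.
have E2 : E * E * (x + a%:C) = x - a%:C by rewrite EE divfK.
have K1 : (1 - E * E) * (x + a%:C) = 2 * a%:C by rewrite mulrBl E2; ring.
have K1' : 1 - E * E != 0.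
  by apply: contraTneq isT => z; move: K1; rewrite z mul0r => /esym/eqP; rewrite mulf_eq0 (negbTE aC0) orbF pnatr_eq0.
have S0 : (E^-1 - E) / 2 != 0.
  rewrite mulf_neq0 ?invr_neq0 ?pnatr_eq0 //.
  by apply: contra K1' => /eqP z; apply/eqP; rewrite -[1](mulVf E0) -mulrBl z mul0r.
split=> //; apply: (mulIf S0); rewrite divfK // ?opprK.
apply: (mulIf (mulf_neq0 (mulf_neq0 E0 xp) (_ : (2 : C) != 0))); first by rewrite pnatr_eq0.
have -> : a%:C * ((E^-1 + E) / 2) * (E * (x + a%:C) * 2) = a%:C * ((x + a%:C) + E * E * (x + a%:C)).
  by field.
have -> : x * ((E^-1 - E) / 2) * (E * (x + a%:C) * 2) = x * ((x + a%:C) - E * E * (x + a%:C)).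
  by field.
by rewrite E2; ring.
Qed.

Lemma outside_xt t : csinh (Defs.sqrte ray * t) != 0 -> cmod (xt ray t) < r -> outside t.
Proof.
move=> s0; rewrite /xt /outside [cmod (_ / _)]cmodM mulNr cmodN cmodV.
by rewrite ltr_pdivrMr ?cmod_gt0.
Qed.

Definition inD t := - bnd < complex.Im t < h.
Definition inU t := - h < complex.Im t < bnd.
(* Equivalently [x(t) = x] when [x] is not a root of [x^2 - a^2], see [xt_ray]. *)
Definition time_at x t := cexp ((2 * a)%:C * t) = (x - a%:C) / (x + a%:C).

Lemma time_at_D (x t : C) : x ^+ 2 != (a ^+ 2)%:C -> cmod x < r -> time_at x t -> inD t ->
  GammaD gam r c0 h kap ray t /\ xt ray t = x.
Proof.
move=> xa xr tx tD; have [s0 E] := xt_ray xa tx; split=> //.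
by apply: GammaD_ray => //; apply: outside_not_hole; apply: outside_xt; rewrite ?E.
Qed.

Lemma time_at_U (x t : C) : x ^+ 2 != (a ^+ 2)%:C -> cmod x < r -> time_at x t -> inU t ->
  GammaU gam r c0 h kap ray t /\ xt ray t = x.
Proof.
move=> xa xr tx tD; have [s0 E] := xt_ray xa tx; split=> //.
by apply: GammaU_ray => //; apply: outside_not_hole; apply: outside_xt; rewrite ?E.
Qed.

Lemma roots_neq0 (x : C) : x ^+ 2 != (a ^+ 2)%:C -> (x - a%:C != 0) /\ (x + a%:C != 0).
Proof.
rewrite rmorphXn /= -subr_eq0 subr_sqr mulf_eq0 negb_or => /andP[].
by [].
Qed.

Hypothesis kap0 : 0 < kap.
Hypothesis h0 : 0 < h.

Let scale_C (y : R) u : complex.Im ((y%:C)^-1 * u) = complex.Im u / y.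
Proof. by rewrite -fmorphV im_mul /= mul0r addr0 mulrC. Qed.

Let a2 : 0 < 2 * a. Proof. by rewrite mulr_gt0. Qed.

Let a2C : (2 * a)%:C != 0 :> C.
Proof. by rewrite -(rmorph0 (real_complex R)) (inj_eq (@complexI _)) gt_eqF. Qed.

(** The principal logarithm gives a time with [|Im t| <= pi / (2 a)], which is less than the strip
    height [bnd] since [kap > 0]. It belongs to the lower strip if [Im t < h], to the upper one
    otherwise. *)
Lemma time_at_exists (x : C) : x ^+ 2 != (a ^+ 2)%:C ->
  exists t, time_at x t /\ (inD t \/ inU t).
Proof.
move=> /roots_neq0 [x1 x2].
have [|u [uE /andP[u1 u2] _]] := cexp_log (y := (x - a%:C) / (x + a%:C)).
  by rewrite mulf_neq0 // invr_neq0.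
exists (((2 * a)%:C)^-1 * u); split; first by rewrite /time_at mulVKf.
rewrite /inD /inU scale_C.
have b1 : - (pi / a / 2) <= complex.Im u / (2 * a).
  by rewrite ler_pdivlMr // (_ : _ * _ = - pi) //; field.
have b2 : complex.Im u / (2 * a) <= pi / a / 2.
  by rewrite ler_pdivrMr // (_ : pi / a / 2 * _ = pi) //; field.
have pa : 0 < pi / a by rewrite divr_gt0 // pi_gt0.
have : pi / a / 2 < bnd.
  rewrite /bnd; move: (pi / a) pa => y y0.
  have ky : 0 < kap * y by rewrite mulr_gt0.
  lra.
move: (complex.Im u / (2 * a)) (pi / a / 2) (bnd) b1 b2 => v y B b1 b2 yb.
have [iu|iu] := ltP v h; [left | right]; apply/andP; split=> //; have := h0; lra.
Qed.

Lemma time_at_near (x t : C) : x ^+ 2 != (a ^+ 2)%:C -> time_at x t ->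
  forall eta : R, 0 < eta -> exists2 d : R, 0 < d & forall y, cmod y < d ->
    (x + y) ^+ 2 != (a ^+ 2)%:C /\ exists2 t' : C, time_at (x + y) t' & `|complex.Im t' - complex.Im t| < eta.
Proof.
move=> xa tx eta eta0; have [x1 x2] := roots_neq0 xa.
pose q z := (z - a%:C) / (z + a%:C) / ((x - a%:C) / (x + a%:C)).
have q0 : (x - a%:C) / (x + a%:C) != 0 by rewrite mulf_neq0 // invr_neq0.
have gq : germ q x.
  apply: germM (germ2_cst _ _ _); apply: germM.
    by apply: germD (germ_id x) (germ2_cst _ _ _).
  by apply: germ2_V => //; apply: germD (germ_id x) (germ2_cst _ _ _).
have gp : germ (fun z => z ^+ 2 - (a ^+ 2)%:C) x := germ_poly2 _ _.
have e1 : 0 < eta * (2 * a) by rewrite mulr_gt0.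
have [d d0 Hd] := cexp_log_near1 e1.
have [r1 r10 H1] := germ_continuous gq d0.
have pa : 0 < cmod (x ^+ 2 - (a ^+ 2)%:C) by rewrite cmod_gt0 subr_eq0.
have [r2 r20 H2] := germ_continuous gp pa.
exists (Num.min r1 r2); first by rewrite lt_min r10.
move=> y; rewrite lt_min => /andP[y1 y2].
have xy : (x + y) ^+ 2 != (a ^+ 2)%:C.
  apply/eqP => E; have := H2 y y2; rewrite E subrr sub0r cmodN ltxx //.
split=> //; have := H1 y y1; rewrite {2}/q divff // => /Hd [u uE uI].
exists (t + ((2 * a)%:C)^-1 * u).
  by rewrite /time_at mulrDr mulVKf // cexpD tx uE /q [LHS]mulrC divfK.
rewrite im_add scale_C addrC addKr normrM normfV (gtr0_norm a2).
by rewrite ltr_pdivrMr.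
Qed.


Lemma cos_eq1 (y : R) : cos y = 1 -> - pi < y < 3 * pi -> y = 0 \/ y = 2 * pi.
Proof.
have p0 := @pi_gt0 R.
have near0 (v : R) : cos v = 1 -> `|v| <= pi -> v = 0.
  move=> v1 vp; apply/eqP; rewrite -normr_eq0; apply/eqP.
  have := @cos_inj R `|v| 0; rewrite !in_itv /= normr_ge0 lexx vp (ltW p0) => /(_ isT isT) H; apply: H.
  by rewrite cos0 -v1; have [v0|v0] := leP 0 v; [rewrite ger0_norm|rewrite ltr0_norm ?cosN].
move=> y1 /andP[ya yb]; have [yp|yp] := leP y pi.
  by left; apply: near0 => //; rewrite ler_norml yp ltW.
right; apply/eqP; rewrite -subr_eq0; apply/eqP; apply: near0.
  by move: y1; rewrite -{1}(subrK (2 * pi) y) mulr_natl cosD2pi.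
by rewrite ler_norml; apply/andP; split; lra.
Qed.

(** The connecting set is the horizontal segment, which leaves the imaginary axis and stays outside
    the hole by [outside_mono]. *)
Lemma GammaDU_connected t u : 0 < r -> a < r -> outside t ->
  - h < complex.Im t < h -> - bnd < complex.Im t < bnd -> complex.Im u = complex.Im t ->
  (0 <= complex.Re t <= complex.Re u) \/ (complex.Re u <= complex.Re t <= 0) ->
  connected_component (GammaDU gam r c0 h kap ray) t u.
Proof.
move=> r0 ar Ot /andP[th1 th2] /andP[tb1 tb2] ut tu.
pose f (s : R) : C := t + s%:C * (u - t).
exists (f @` `[0, 1]%classic).
  split.
  - by exists 0; rewrite /= ?in_itv /= ?lexx ?ler01 // /f mul0r addr0.
  - move=> _ [s /= + <-]; rewrite in_itv /= => /andP[s0 s1].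
    have fi : complex.Im (f s) = complex.Im t.
      by rewrite /f im_add im_mul im_add im_opp ut subrr /= mulr0 mul0r !addr0.
    have fr : complex.Re (f s) = complex.Re t + s * (complex.Re u - complex.Re t).
      by rewrite /f re_add re_mul re_add re_opp /= mul0r subr0.
    have Of : outside (f s).
      apply: outside_mono Ot => //; rewrite fr; case: tu => /andP[tu1 tu2].
        by rewrite !ger0_norm //; nra.
      by rewrite !ler0_norm //; nra.
    have nf := outside_not_hole Of.
    split; [apply: GammaD_ray => // | apply: GammaU_ray => //]; rewrite fi.
      by rewrite tb1.
    by rewrite th1.
  - apply: connected_continuous_connected; first exact: segment_connected.
    apply: continuous_in_subspaceT => s _; apply/cvg_cmod => e e0.
    pose K := cmod (u - t) + 1; have K0 : 0 < K by rewrite ltr_wpDl ?cmod_ge0.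
    have eK : 0 < e / K by rewrite divr_gt0.
    near=> s'.
    have : `|s - s'| < e / K by near: s'; exact: cvgr_dist_lt.
    rewrite ltr_pdivlMr // => se.
    rewrite (_ : f s' - f s = (s' - s)%:C * (u - t)); last first.
      by rewrite /f rmorphB /=; ring.
    rewrite cmodM cmodR distrC; apply: le_lt_trans se.
    by rewrite ler_wpM2l // /K lerDl.
by exists 1; rewrite /= ?in_itv /= ?lexx ?ler01 // /f mul1r addrC subrK.
Unshelve. all: by end_near. Qed.

(** Two times of one point differ by a multiple of the period. If they coincide, a horizontal
    half-line from [t] shows that it lies in the left or right component; if [u] is one period above
    [t], the point lies in [OmegaC]. *)
Lemma overlap x t u : 0 < r -> a < r -> kap < 4^-1 -> a * h < pi / 4 ->
  x ^+ 2 != (a ^+ 2)%:C -> cmod x < r -> time_at x t -> inD t -> time_at x u -> inU u ->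
  [\/ OmegaR gam r c0 h kap ray x, OmegaL gam r c0 h kap ray x |
      OmegaC gam r c0 h kap ray x].
Proof.
move=> r0 ar k4 ah xa xr xt tD xu uU.
have [GD tx] := time_at_D xa xr xt tD; have [GU ux] := time_at_U xa xr xu uU.
have : cexp ((2 * a)%:C * (u - t)) = 1.
  rewrite mulrBr cexpD cexpN xt xu divff //.
  by have [x1 x2] := roots_neq0 xa; rewrite mulf_neq0 // invr_neq0.
move=> /cexp_eq1; rewrite re_mul im_mul /= !mul0r subr0 addr0 re_add im_add re_opp im_opp.
move=> [/eqP]; rewrite mulf_eq0 gt_eqF //= subr_eq0 => /eqP reE.
have /andP[t1 t2] := tD; have /andP[u1 u2] := uU.
have p0 := @pi_gt0 R; have ba : bnd * a = (2^-1 + kap) * pi by rewrite /bnd; field.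
have kp : kap * pi < 4^-1 * pi by rewrite ltr_pM2r.
have ta : complex.Im t * a < h * a by rewrite ltr_pM2r.
have ta' : - bnd * a < complex.Im t * a by rewrite ltr_pM2r.
have ua : - h * a < complex.Im u * a by rewrite ltr_pM2r.
have ua' : complex.Im u * a < bnd * a by rewrite ltr_pM2r.
(* The strips give [- 4 a h < 2 a Im (u - t) < (2 + 4 kap) pi]; with [a h < pi / 4] and
   [kap < 1 / 4] only the multiples [0] and [2 pi] remain. *)
move=> /cos_eq1 [|E|E].
- by apply/andP; split; lra.
- have imE : complex.Im u = complex.Im t.
    apply/eqP; rewrite -subr_eq0; move/eqP: E; rewrite mulf_eq0 (gt_eqF a2) //=.
  have tu : t = u by apply: eq_ReIm.
  have [s0 _] := xt_ray xa xt.
  have Ot : outside t by apply: outside_xt; rewrite ?tx.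
  have GU' : GammaU gam r c0 h kap ray t by rewrite tu.
  have connect s : (0 <= complex.Re t <= complex.Re t + s) \/ (complex.Re t + s <= complex.Re t <= 0) ->
      connected_component (GammaDU gam r c0 h kap ray) t (t + s%:C).
    move=> Hs; apply: GammaDU_connected; rewrite ?re_add ?im_add /= ?addr0 //.
      by rewrite t2 -imE u1.
    by rewrite t1 -imE u2.
  have [t0|t0] := leP 0 (complex.Re t).
    apply: Or32; exists t => //; split=> // M.
    exists (t + (`|M| + 1)%:C); last by rewrite re_add /=; have := ler_norm M; lra.
    by apply: connect; left; rewrite t0 /= lerDl addr_ge0.
  apply: Or31; exists t => //; split=> // M.
  exists (t + (- (`|M| + 1))%:C); last by rewrite re_add /=; have := ler_norm (- M); rewrite normrN; lra.
  by apply: connect; right; rewrite (ltW t0) andbT gerDl oppr_le0 addr_ge0.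
apply: Or33; exists t => //; split=> //.
rewrite period_ray; suff <- : u = t + (0 +i* (pi / a)) by [].
apply: eq_ReIm; rewrite ?re_add ?im_add /= ?addr0 // -[LHS](subrK (complex.Im t)) addrC.
congr (_ + _); apply: (mulfI (_ : 2 * a != 0)); first by rewrite gt_eqF.
by rewrite E; field.
Qed.

End Ray.

(** * Matrices of analytic germs *)

Section Families.
Variable R : realType.
Local Notation C := R[i].

Lemma geometric_small (K e : R) : 0 < e -> \forall N \near \oo, K * 2^-1 ^+ N < e.
Proof.
move=> e0; have q1 : `|2^-1| < 1 :> R by rewrite ger0_norm ?invr_ge0 // invf_lt1 // ltr1n.
have L : K * 2^-1 ^+ N @[N --> \oo] --> (0 : R).
  rewrite -(mulr0 K); apply: (@cvgM _ _ _ _ (fun=> K) (GRing.exp 2^-1)); first exact: cvg_cst.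
  exact: cvg_expr.
have /cvgrPdist_lt /(_ e e0) := L; apply: filterS => N; rewrite sub0r normrN; apply: le_lt_trans.
exact: ler_norm.
Qed.

Lemma limit_unique (S : nat -> C) (l l' : C) (K : R) :
  (forall e : R, 0 < e -> \forall N \near \oo, cmod (S N - l) < e) ->
  (forall N, cmod (S N - l') <= K * 2^-1 ^+ N) -> l = l'.
Proof.
move=> L1 L2; apply/eqP; rewrite -subr_eq0 -cmod_eq0 eq_le cmod_ge0 andbT leNgt.
apply/negP => e0; have e2 : 0 < cmod (l - l') / 2 by rewrite divr_gt0.
near \oo => N.
have N1 : cmod (S N - l) < cmod (l - l') / 2 by near: N; exact: L1.
have N2 : K * 2^-1 ^+ N < cmod (l - l') / 2 by near: N; exact: geometric_small.
have N3 := L2 N; have := cmod_tri (S N) l l'; rewrite (cmodB l (S N)) => N4.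
have E (P u w t : R) : P < t / 2 -> u <= P -> w < t / 2 -> t <= w + u -> False by move=> *; lra.
exact: E N2 N3 N1 N4.
Unshelve. all: by end_near. Qed.

Lemma germ2_family (I : finType) (F : I -> C -> C -> C) y0 z0 :
  (forall i, germ2 (F i) y0 z0) ->
  exists (c : I -> nat -> nat -> C) (d M : R),
  [/\ 0 < d, forall i, coef_bound2 d M (c i) &
      forall i e x, cmod e < d -> cmod x < d -> F i (y0 + e) (z0 + x) = psum2 (c i) e x].
Proof.
move=> H.
have /choice[f Hf] : forall i, exists p : (nat -> nat -> C) * (R * R),
    [/\ 0 < p.2.1, coef_bound2 p.2.1 p.2.2 p.1 &
     forall e x, cmod e < p.2.1 -> cmod x < p.2.1 -> F i (y0 + e) (z0 + x) = psum2 p.1 e x].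
  by move=> i; have [c [d [M Hi]]] := H i; exists (c, (d, M)).
have M0 i : 0 <= (f i).2.2 by have [_ /coef_bound2_ge0] := Hf i.
have d0 i : 0 < (f i).2.1 by have [] := Hf i.
(* [S^-1] is below every radius; the summand [1] keeps [S] positive when the index type is empty. *)
pose S := \sum_i ((f i).2.1)^-1 + 1.
have S0 : 0 < S by rewrite ltr_wpDl // sumr_ge0 // => i _; rewrite invr_ge0 ltW.
have Sd i : S^-1 <= (f i).2.1.
  rewrite -[leRHS]invrK lef_pV2 ?posrE ?invr_gt0 // /S (bigD1 i) //= -addrA lerDl.
  by rewrite addr_ge0 // sumr_ge0 // => k _; rewrite invr_ge0 ltW.
exists (fun i => (f i).1), S^-1, (\sum_i (f i).2.2); split; first by rewrite invr_gt0.
  move=> i; have [_ Hb _] := Hf i; apply: coef_bound2W Hb.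
    by rewrite invr_ge0 (ltW S0) Sd.
  by rewrite (bigD1 i) //= lerDl sumr_ge0.
move=> i e x ed xd; have [_ _ HF] := Hf i; apply: HF.
  exact: lt_le_trans ed (Sd i).
exact: lt_le_trans xd (Sd i).
Qed.

End Families.

(** * Matrix norms, limits and analyticity in terms of entries *)

Section MatrixEntries.
Variable R : realType.
Local Notation C := R[i].
Variables (m n : nat).
Implicit Types A : 'M[C]_(m, n).

Lemma mx_norm_entry A i k : `|A i k| <= `|A|.
Proof.
rewrite [leRHS]/Num.Def.normr /= mx_normE -[leLHS]nngE num_le.
exact: (le_bigmax _ (fun i => `|A i.1 i.2|%:nng) (i, k)).
Qed.

Lemma mx_norm_le A (b : R) : 0 <= b -> (forall i k, cmod (A i k) <= b) -> `|A| <= b%:C.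
Proof.
move=> b0 H; have bC : 0 <= b%:C by rewrite lecR.
rewrite [leLHS]/Num.Def.normr /= mx_normE -[b%:C]/(NngNum bC)%:num num_le.
apply/bigmax_leP; split=> [|[i k] _]; rewrite -num_le //=.
by rewrite cmodE lecR.
Qed.

Lemma cvg_entry (T : Type) (F : set_system T) {FF : Filter F} (f : T -> 'M[C]_(m, n)) A :
  f @ F --> A -> forall i k (e : R), 0 < e -> \forall x \near F, cmod (f x i k - A i k) < e.
Proof.
move=> fA i k; apply/cvg_cmod.
exact: (cvg_comp f (fun B : 'M[C]_(m, n) => B i k) fA (@coord_continuous C m n i k A)).
Qed.

Lemma cvg_mx (T : Type) (F : set_system T) {FF : Filter F} (f : T -> 'M[C]_(m, n)) A :
  (forall i k (e : R), 0 < e -> \forall x \near F, cmod (f x i k - A i k) < e) -> f @ F --> A.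
Proof.
move=> H; apply/cvg_ballP => e e0.
have eE : e = (complex.Re e)%:C by rewrite RRe_real ?gtr0_real.
have er : 0 < complex.Re e by move: e0; rewrite {1}eE ltcR.
have : \forall x \near F, forall i k, cmod (f x i k - A i k) < complex.Re e.
  by apply: filter_forall => i; apply: filter_forall => k; exact: H.
apply: filterS => x Hx; split=> // i k.
by rewrite -ball_normE /= distrC cmodE eE ltcR.
Qed.

Lemma is_derive_entry (f : C -> 'M[C]_(m, n)) (x : C) (D : 'M[C]_(m, n)) :
  is_derive x (1 : C) f D -> forall i k, has_cderiv (fun y => f y i k) x (D i k).
Proof.
move=> [fd <-] i k e e0.
have : (fun h => h^-1 *: (f (h *: (1 : C) + x) - f x)) @ (0 : C)^' --> 'D_1 f x by exact: fd.
move=> /cvg_entry /(_ i k e e0); rewrite /dnbhs /within /= => /near_cmod [r r0 Hr].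
exists r => // h hr; have [->|h0] := eqVneq h 0.
  by rewrite addr0 subrr mul0r subr0 cmod0 mulr0.
have := Hr h; rewrite subr0 => /(_ hr h0) /ltW.
rewrite -(ler_pM2r (_ : 0 < cmod h)) ?cmod_gt0 // -cmodM; congr (cmod _ <= _).
rewrite !mxE /GRing.scale /= mulr1 (addrC h).
by field.
Qed.

Lemma derive1_mx (f : C -> 'M[C]_(m, n)) (x : C) (D : 'M[C]_(m, n)) :
  (forall i k, has_cderiv (fun y => f y i k) x (D i k)) -> derive1 f x = D.
Proof.
move=> H; rewrite derive1E.
have L : (fun h => h^-1 *: (f (h *: (1 : C) + x) - f x)) @ (0 : C)^' --> D.
  apply: cvg_mx => i k e e0; have e2 : 0 < e / 2 by rewrite divr_gt0.
  have [r r0 Hr] := H i k _ e2; rewrite /dnbhs /within /=; apply/near_cmod.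
  exists r => // h; rewrite subr0 => hr /eqP/eqP h0.
  apply: (@le_lt_trans _ _ (e / 2)); last by rewrite ltr_pdivrMr // ltr_pMr // ltr1n.
  rewrite -(ler_pM2r (_ : 0 < cmod h)) ?cmod_gt0 // -cmodM.
  apply: le_trans (Hr h hr); rewrite le_eqVlt; apply/orP; left; apply/eqP.
  congr cmod; rewrite !mxE /GRing.scale /= mulr1 (addrC h).
  by field.
exact: cvg_lim L.
Qed.

Lemma analytic2_germ2 (F : C -> C -> 'M[C]_(m, n)) y0 z0 : analytic2_at F y0 z0 ->
  forall i k, germ2 (fun y z => F y z i k) y0 z0.
Proof.
move=> [a [d [M [d0 aM H]]]] i k.
have cM : coef_bound2 d M (fun p q => a p q i k).
  move=> p q; rewrite -lecR rmorphM rmorphXn /= -cmodE; apply: le_trans (aM p q).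
  by rewrite ler_wpM2r ?exprn_ge0 ?lecR ?(ltW d0) // mx_norm_entry.
have d2 : 0 < d / 2 by rewrite divr_gt0.
have dd : d / 2 < d by rewrite ltr_pdivrMr // ltr_pMr // ltr1n.
exists (fun p q => a p q i k), (d / 2), M; split=> //.
  by apply: coef_bound2_shrink cM => //; exact: ltW.
move=> y z yd zd; have yd' := ltW yd; have zd' := ltW zd.
have := H (y0 + y) (z0 + z); rewrite !(addrC _ _ : _ + y = y + _) !(addrC z0) !addrK.
rewrite !cmodE !ltcR => /(_ (lt_trans yd dd) (lt_trans zd dd)) L.
apply: (limit_unique (cvg_entry L i k)) => N.
have := psum2_square_err N d0 yd' zd' cM; congr (cmod (_ - _) <= _).
rewrite summxE big_mkord; apply: eq_bigr => p _; rewrite summxE big_mkord.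
by apply: eq_bigr => q _; rewrite mxE mulrC.
Qed.

Lemma germ2_analytic2 (F : C -> C -> 'M[C]_(m, n)) y0 z0 :
  (forall i k, germ2 (fun y z => F y z i k) y0 z0) -> analytic2_at F y0 z0.
Proof.
move=> H.
have [c [d [M [d0 cM FE]]]] := germ2_family (F := fun (ik : 'I_m * 'I_n) y z => F y z ik.1 ik.2)
  (fun ik => H ik.1 ik.2).
have d2 : 0 < d / 2 by rewrite divr_gt0.
have dd : d / 2 < d by rewrite ltr_pdivrMr // ltr_pMr // ltr1n.
have M0 : 0 <= Num.max M 0 by rewrite le_max lexx orbT.
exists (fun p q => \matrix_(i, k) c (i, k) p q), (d / 2), (Num.max M 0); split=> //.
  move=> p q.
  have dpq : 0 < (d / 2) ^+ (p + q) by rewrite exprn_gt0.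
  rewrite -rmorphXn /= -ler_pdivlMr ?ltcR // -fmorphV -rmorphM /=.
  apply: mx_norm_le => [|i k]; first by rewrite divr_ge0 // ltW.
  rewrite mxE ler_pdivlMr // le_max; apply/orP; left.
  exact: (coef_bound2_shrink d2 (ltW dd) (cM (i, k))).
move=> y z; rewrite !cmodE !ltcR => yd zd.
apply: cvg_mx => i k e e0.
have L2 := geometric_small (8 * M) e0.
near=> N; have : 8 * M * 2^-1 ^+ N < e by near: N; exact: L2.
apply: le_lt_trans.
have := psum2_square_err N d0 (ltW yd) (ltW zd) (cM (i, k)).
rewrite -(FE (i, k)) ?(lt_trans _ dd) // !(addrC _ (_ - _)) !subrK /=.
congr (cmod (_ - _) <= _); rewrite summxE big_mkord; apply: eq_bigr => p _.
rewrite summxE big_mkord; apply: eq_bigr => q _.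
by rewrite !mxE mulrC.
Unshelve. all: by end_near. Qed.

End MatrixEntries.

Section MatrixGerms.
Variable R : realType.
Local Notation C := R[i].

Lemma analytic_germ (m n : nat) (F : C -> 'M[C]_(m, n)) z0 : analytic_at F z0 ->
  forall i k, germ (fun z => F z i k) z0.
Proof.
move=> [a [d [d0 H]]] i k.
have d2 : 0 < d / 2 by rewrite divr_gt0.
have d4 : 0 < d / 4 by rewrite divr_gt0.
have dd : d / 2 < d by rewrite ltr_pdivrMr // ltr_pMr // ltr1n.
have L z : cmod z < d -> forall e : R, 0 < e -> \forall N \near \oo,
    cmod (\sum_(q < N) a q i k * z ^+ q - F (z0 + z) i k) < e.
  move=> zd e e0; have := H (z0 + z); rewrite (addrAC z0 z) subrr add0r cmodE ltcR => /(_ zd).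
  move=> /cvg_entry /(_ i k e e0); apply: filterS => N; congr (cmod (_ - _) < _).
  by rewrite /series /= summxE big_mkord; apply: eq_bigr => q _; rewrite mxE mulrC.
(* [analytic_at] provides convergence but no bound. The terms at the point [d / 2] are differences
   of convergent partial sums, hence bounded. *)
have [M aM] : exists M, coef_bound (d / 2) M (fun q => a q i k).
  have dC : cmod ((d / 2)%:C : C) < d by rewrite cmodR gtr0_norm.
  have [N0 _ HN] := L _ dC 1 ltr01.
  pose u q := cmod (a q i k) * (d / 2) ^+ q.
  have u0 q : 0 <= u q by rewrite mulr_ge0 ?cmod_ge0 // exprn_ge0 // ltW.
  exists (\sum_(q < N0) u q + 2) => q; rewrite -/(u q).
  have [qN|qN] := ltnP q N0.
    by rewrite (bigD1 (Ordinal qN)) //= -addrA lerDl addr_ge0 // sumr_ge0.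
  apply: (@le_trans _ _ 2); last by rewrite lerDr sumr_ge0.
  have := HN q qN; have := HN q.+1 (leqW qN); rewrite /= big_ord_recr /=.
  move: (\sum_(_ < q) _) (F _ _ _) => S l h1 h2.
  have -> : u q = cmod (a q i k * ((d / 2)%:C) ^+ q).
    by rewrite /u cmodM cmodX cmodR gtr0_norm.
  move: (a q i k * _) h1 => t h1.
  have := cmod_triB (S + t - l) (S - l).
  by rewrite (_ : S + t - l - (S - l) = t); [lra | ring].
apply/germP; exists (fun q => a q i k), (d / 4), M; split=> //.
  move=> q; apply: le_trans (aM q); rewrite ler_wpM2l ?cmod_ge0 //.
  rewrite lerXn2r ?nnegrE ?(ltW d2) ?(ltW d4) //; lra.
move=> z zd; apply: (limit_unique (L z _)); first lra.
by move=> N; apply: psum_err aM; lra.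
Qed.

Lemma germ_det n (F : C -> 'M[C]_n) z0 : (forall i k, germ (fun z => F z i k) z0) ->
  germ (fun z => \det (F z)) z0.
Proof.
move=> H; rewrite /germ /determinant.
apply: germ2_sum => s; apply: germ2_M; first exact: germ2_cst.
by apply: germ2_prod => i; exact: H.
Qed.

(** Cramer's rule: the entries are cofactors divided by the determinant. *)
Lemma germ_invmx n (F : C -> 'M[C]_n) z0 : (forall i k, germ (fun z => F z i k) z0) ->
  (exists2 r : R, 0 < r & forall x, cmod x < r -> F (z0 + x) \in unitmx) ->
  forall i k, germ (fun z => invmx (F z) i k) z0.
Proof.
move=> H [r r0 U] i k.
apply: (@germ_near _ (fun z => (\det (F z))^-1 *
   ((-1) ^+ (k + i) * \det (row' k (col' i (F z)))))); last first.
  by exists r => // x /U Ux; rewrite /invmx Ux !mxE /cofactor.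
have U0 : \det (F z0) != 0 by have := U 0; rewrite cmod0 addr0 => /(_ r0); rewrite unitmxE unitfE.
apply: germM; first by apply: germ2_V => //; exact: germ_det.
apply: germM; first exact: germ2_cst.
apply: germ_det => p q; apply: germ_near (H (lift k p) (lift i q)) _.
by exists 1 => // x _; rewrite !mxE.
Qed.

End MatrixGerms.

(** * Gluing the rows of the inverse normalizations *)

Section RowOfInverse.
Variable R : realType.
Local Notation C := R[i].
Variables (n : nat) (j : 'I_n).

(** Conjugation by the diagonal [F] preserves a trivial [j]-th row, so row [j] of [A^-1 B] is that
    of the identity; multiply by [B^-1] on the right. *)
Lemma row_invmx_jump (A B F M : 'M[C]_n) (d : 'rV[C]_n) :
  A \in unitmx -> B \in unitmx -> F \in unitmx -> F = diag_mx d -> row j M = row j 1%:M ->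
  invmx A *m B = F *m M *m invmx F -> row j (invmx A) = row j (invmx B).
Proof.
move=> uA uB uF FE ME E.
have rF : row j F = d 0 j *: row j 1%:M by rewrite FE row_diag_mx row1.
have rE : row j (invmx A) *m B = row j 1%:M.
  rewrite -row_mul E !row_mul rF -!scalemxAl -(row_mul j 1%:M) mul1mx ME.
  by rewrite scalemxAl -rF -row_mul mulmxV.
by rewrite -[LHS](mulmxK uB) rE -row_mul mul1mx.
Qed.

(** Row [j] of the inverse satisfies [y = (e_j - y (H - K)) K^-1]. For [H] close to [K] the term in
    [y] on the right has at most half the size of [y] and is absorbed on the left. *)
Lemma invmx_bounded (H : C -> 'M[C]_n) (K : 'M[C]_n) (Om : set C) (z : C) :
  H x @[x --> within Om (nbhs z)] --> K -> K \in unitmx ->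
  exists (r B : R), 0 < r /\ forall x, cmod (x - z) < r -> Om x -> H x \in unitmx ->
    forall i, cmod (invmx (H x) j i) <= B.
Proof.
move=> HK uK.
pose kp : R := \sum_l \sum_i cmod (invmx K l i).
have kp0 : 0 <= kp by rewrite sumr_ge0 // => l _; rewrite sumr_ge0 // => i _; exact: cmod_ge0.
have kpE l i : cmod (invmx K l i) <= kp.
  rewrite /kp (bigD1 l) //= (bigD1 i) //= -addrA lerDl addr_ge0 // sumr_ge0 // => *.
    exact: cmod_ge0.
  by rewrite sumr_ge0 // => *; exact: cmod_ge0.
pose eta : R := (2 * (n%:R * n%:R * kp + 1))^-1.
have nk0 : 0 <= n%:R * n%:R * kp :> R by rewrite !mulr_ge0.
have eta0 : 0 < eta by rewrite invr_gt0 mulr_gt0 // ltr_wpDl.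
have etaE : n%:R * n%:R * kp * eta <= 2^-1.
  by rewrite /eta ler_pdivrMr; lra.
have : \forall x \near within Om (nbhs z), forall l i, cmod (H x l i - K l i) < eta.
  by apply: filter_forall => l; apply: filter_forall => i; exact: (cvg_entry HK).
rewrite /within /= => /near_cmod [r r0 Hr].
exists r, (2 * (n%:R * n%:R * kp)); split=> // x xr Ox uH i.
have {Hr}Hr := Hr x xr Ox.
pose y l := invmx (H x) j l; pose N : R := \sum_l cmod (y l).
have yE q : y q = \sum_l ((j == l)%:R - \sum_m y m * (H x m l - K m l)) * invmx K l q.
  have E : invmx (H x) = (1%:M - invmx (H x) *m (H x - K)) *m invmx K.
    by rewrite mulmxBr mulVmx // opprB addrC subrK mulmxK.
  rewrite {1}/y {1}E mxE; apply: eq_bigr => l _; rewrite !mxE.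
  by congr ((_ - _) * _); apply: eq_bigr => m _; rewrite !mxE.
have N0 : 0 <= N by rewrite sumr_ge0 // => *; exact: cmod_ge0.
have yb q : cmod (y q) <= n%:R * ((1 + N * eta) * kp).
  rewrite yE; apply: le_trans (cmod_sum _ _ _) _.
  rewrite -[n in leRHS]card_ord -sumr_const mulr_suml.
  apply: ler_sum => l _; rewrite mul1r cmodM ler_pM ?cmod_ge0 //.
  apply: le_trans (cmod_triB _ _) _; apply: lerD.
    by rewrite cmod_nat; case: eqP.
  apply: le_trans (cmod_sum _ _ _) _; rewrite mulr_suml; apply: ler_sum => m _.
  by rewrite cmodM ler_wpM2l ?cmod_ge0 // ltW.
have NE : N <= n%:R * n%:R * kp + n%:R * n%:R * kp * eta * N.
  apply: le_trans (_ : n%:R * (n%:R * ((1 + N * eta) * kp)) <= _); last by rewrite le_eqVlt; apply/orP; left; apply/eqP; ring.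
  apply: le_trans (ler_sum _ (fun l _ => yb l)) _.
  by rewrite sumr_const card_ord -[leLHS]mulr_natl lexx.
have iN : cmod (y i) <= N.
  by rewrite /N (bigD1 i) //= lerDl sumr_ge0 // => *; exact: cmod_ge0.
apply: le_trans iN _; move: (n%:R * n%:R * kp) etaE NE nk0 => P etaE NE P0.
have : P * eta * N <= 2^-1 * N by rewrite ler_wpM2r.
lra.
Qed.

End RowOfInverse.

(** * Differentiation with respect to the time *)

Section TimeDerivative.
Variable R : realType.
Local Notation C := R[i].
Variables (a gam r c0 h kap rho del : R).
Hypothesis a_gt0 : 0 < a.

Lemma xt_deriv (t : C) : csinh (Defs.sqrte (ray a) * t) != 0 ->
  has_cderiv (xt (ray a)) t (xt (ray a) t ^+ 2 - (a ^+ 2)%:C) /\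
  has_cderiv (fun s => csinh (Defs.sqrte (ray a) * s)) t
    (Defs.sqrte (ray a) * ccosh (Defs.sqrte (ray a) * t)).
Proof.
have qa : Defs.sqrte (ray a) ^+ 2 = (a ^+ 2)%:C.
  by rewrite sqrte_ray // -rmorphXn /= sqrrN.
rewrite -qa /xt; move: (Defs.sqrte _) => q s0.
have dl (z : C) : has_cderiv (fun s => z * s) t z.
  by have := has_cderivM (has_cderiv_cst z t) (has_cderiv_id t); rewrite mul0r add0r mulr1.
have d1 := has_cderiv_comp (dl q) (cexp_deriv (q * t)).
have d2 : has_cderiv (fun s => cexp (- (q * s))) t (- q * cexp (- (q * t))).
  apply: (has_cderiv_near (f := fun s => cexp (- q * s))); last first.
    by exists 1 => // y _; rewrite mulNr.
  by have := has_cderiv_comp (dl (- q)) (cexp_deriv (- q * t)); rewrite (mulNr q t).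
have ds : has_cderiv (fun s => csinh (q * s)) t (q * ccosh (q * t)).
  apply: (has_cderiv_near (f := fun s => (cexp (q * s) + (-1) * cexp (- (q * s))) * 2^-1)); last first.
    by exists 1 => // y _; rewrite /csinh mulN1r.
  have := has_cderivM (has_cderivD d1 (has_cderivM (has_cderiv_cst (-1) t) d2)) (has_cderiv_cst 2^-1 t).
  by congr has_cderiv; rewrite /ccosh; field.
have dc : has_cderiv (fun s => ccosh (q * s)) t (q * csinh (q * t)).
  apply: (has_cderiv_near (f := fun s => (cexp (q * s) + cexp (- (q * s))) * 2^-1)); last first.
    by exists 1 => // y _.
  have := has_cderivM (has_cderivD d1 d2) (has_cderiv_cst 2^-1 t).
  by congr has_cderiv; rewrite /csinh; field.
split=> //.
have := has_cderivM (has_cderivM (has_cderiv_cst (- q) t) dc) (has_cderiv_comp ds (has_cderiv_inv s0)).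
congr has_cderiv; field.
exact: s0.
Qed.

Lemma GammaD_near (t : C) : 0 < r -> csinh (Defs.sqrte (ray a) * t) != 0 ->
  cmod (xt (ray a) t) < r -> inD a h kap t ->
  exists2 d : R, 0 < d & forall s, cmod s < d -> GammaD gam r c0 h kap (ray a) (t + s).
Proof.
move=> r0 s0 tr /andP[t1 t2]; have [dx ds] := xt_deriv s0.
have s1 : 0 < cmod (csinh (Defs.sqrte (ray a) * t)) by rewrite cmod_gt0.
have [d1 d10 H1] := has_cderiv_continuous ds s1.
have r1 : 0 < r - cmod (xt (ray a) t) by rewrite subr_gt0.
have [d2 d20 H2] := has_cderiv_continuous dx r1.
pose eta := Num.min (complex.Im t - (- ((2^-1 + kap) * (pi / a)))) (h - complex.Im t).
have eta0 : 0 < eta by rewrite lt_min !subr_gt0 t1 t2.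
exists (Num.min (Num.min d1 d2) eta); first by rewrite !lt_min d10 d20 !subr_gt0 t1 t2.
move=> s; rewrite !lt_min => /andP[/andP[h1 h2] /andP[h3 h4]].
apply: GammaD_ray => //.
  apply: outside_not_hole; apply: outside_xt.
    apply/eqP => E; have := H1 s h1; rewrite E sub0r cmodN ltxx //.
  by apply: le_lt_trans (cmod_subl _ (xt (ray a) t)) _; have := H2 s h2; lra.
have := Im_le_cmod s; rewrite im_add ler_norml => /andP[i1 i2].
by apply/andP; split; lra.
Qed.

(** Since [2 lg] is a continuous logarithm of [x^2 - e] and [x' = x^2 - e], its derivative is
    [2 x x' / (x^2 - e) = 2 x]. *)
Lemma branch_deriv (lg : C -> C -> C) (t : C) :
  is_branchD gam r c0 h kap rho del lg -> sectorS gam rho (ray a) ->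
  0 < r -> csinh (Defs.sqrte (ray a) * t) != 0 ->
  cmod (xt (ray a) t) < r -> inD a h kap t -> xt (ray a) t ^+ 2 != (a ^+ 2)%:C ->
  has_cderiv (lg (ray a)) t (xt (ray a) t).
Proof.
move=> [lc lE _] Sw r0 s0 tr tD xa; set x := xt (ray a) t in xa tr *.
have [d d0 Hd] := GammaD_near r0 s0 tr tD; have [dx _] := xt_deriv s0.
have cl : continuous_cmod (lg (ray a)) t.
  move=> e e0; have Gt : GammaD gam r c0 h kap (ray a) t by rewrite -[t]addr0; apply: Hd; rewrite cmod0.
  pose A := [set p : C * C | sectorS gam rho p.1 /\ GammaD gam r c0 h kap p.1 p.2].
  have : (fun p : C * C => lg p.1 p.2) @ within A (nbhs (ray a, t)) --> lg (ray a) t.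
    have := lc (ray a, t); rewrite /continuous_at /= nbhs_subspace_in //.
  move=> /cvg_cmod /(_ e e0); rewrite /within /= => -[[P Q] /= [/near_cmod [p p0 Hp] /near_cmod [q q0 Hq]] PQ].
  exists (Num.min d q); first by rewrite lt_min d0.
  move=> s; rewrite lt_min => /andP[sd sq].
  have := PQ (ray a, t + s); apply=> //=; last by split=> //; exact: Hd.
  split; first by apply: Hp; rewrite subrr cmod0.
  by apply: Hq; rewrite (addrAC t s) subrr add0r.
have c2 : continuous_cmod (fun s => 2 * lg (ray a) s) t.
  move=> e e0; have e2 : 0 < e / 2 by rewrite divr_gt0.
  have [q q0 Hq] := cl _ e2; exists q => // s /Hq.
  by rewrite -mulrBr cmodM cmod_nat ltr_pdivlMr // mulrC.
have dE : has_cderiv (fun s => xt (ray a) s ^+ 2 - (a ^+ 2)%:C) t (2 * x * (x ^+ 2 - (a ^+ 2)%:C)).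
  apply: (has_cderiv_near (f := fun s => xt (ray a) s * xt (ray a) s + - (a ^+ 2)%:C)); last first.
    by exists 1.
  have := has_cderivD (has_cderivM dx dx) (has_cderiv_cst (- (a ^+ 2)%:C) t).
  by congr has_cderiv; rewrite -/x; ring.
have lift : exists2 q : R, 0 < q & forall s, cmod s < q ->
    cexp (2 * lg (ray a) (t + s)) = xt (ray a) (t + s) ^+ 2 - (a ^+ 2)%:C.
  by exists d => // s sd; rewrite lE ?cexp_ray //; exact: Hd.
have := has_cderivM (has_cderiv_cst 2^-1 t) (cexp_lift_deriv c2 dE lift).
rewrite -/x mul0r add0r mulfK ?subr_eq0 // mulKf ?pnatr_eq0 //.
move=> /has_cderiv_near; apply; exists 1 => // y _.
by rewrite mulKf ?pnatr_eq0.
Qed.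

End TimeDerivative.

(** * From the differential equation to equations for coefficients *)

Section EquationsFromODE.
Variable R : realType.
Local Notation C := R[i].
Variables (n : nat) (j : 'I_n) (Te : 'I_n -> 'I_n -> nat -> C) (Re : 'I_n -> nat -> C).
Variables (e : C) (y : 'I_n -> nat -> C) (D : R).
Hypothesis D_gt0 : 0 < D.
Hypothesis bT : forall l i, bounded_coef D (Te l i).
Hypothesis bR : forall l, bounded_coef D (Re l).
Hypothesis bY : forall l, bounded_coef D (y l).
Hypothesis ode : exists2 r : R, 0 < r & forall x, x != 0 -> cmod x < r ->
  exists dv : 'I_n -> C, [/\ forall i, has_cderiv (psum (y i)) x (dv i),
    forall i, i != j -> (x ^+ 2 - e) * dv i = \sum_l psum (Te l i) x * psum (y l) x &
    dv j = - \sum_l psum (Re l) x * psum (y l) x].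

Lemma psum_zero_near (d : R) (a : nat -> C) : 0 < d -> bounded_coef d a ->
  (exists2 r : R, 0 < r & forall x, x != 0 -> cmod x < r -> psum a x = 0) ->
  forall k, a k = 0.
Proof.
move=> d0 [M aM] [r r0 H]; apply: psum_zero_seq d0 aM _ => s s0.
have m0 : 0 < Num.min r s by rewrite lt_min r0.
have ms : Num.min r s / 2 < r /\ Num.min r s / 2 < s.
  by have : Num.min r s <= r /\ Num.min r s <= s; [rewrite !ge_min !lexx orbT | lra].
have cm : cmod ((Num.min r s / 2)%:C : C) = Num.min r s / 2.
  by rewrite cmodR ger0_norm // divr_ge0 // ltW.
have z0 : (Num.min r s / 2)%:C != 0 :> C by rewrite -cmod_gt0 cm divr_gt0.
by exists (Num.min r s / 2)%:C; split; rewrite ?cm ?(proj2 ms) // H ?cm ?(proj1 ms).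
Qed.

Let D2 : 0 <= D / 2. Proof. by rewrite divr_ge0 // ltW. Qed.
Let D2' : 0 < D / 2. Proof. by rewrite divr_gt0. Qed.

Let bY2 l : bounded_coef (D / 2) (y l).
Proof. by apply: bounded_coefW (bY l); have D0 := D_gt0; apply/andP; split; lra. Qed.

Let bdY l : bounded_coef (D / 2) (dcoef (y l)).
Proof. by have [M H] := bY l; exists (M / D); exact: coef_bound_dcoef. Qed.

Let bsum (F : 'I_n -> nat -> C) : (forall l, bounded_coef D (F l)) ->
  bounded_coef (D / 2) (fun k => \sum_l cprod (F l) (y l) k).
Proof.
move=> bF; apply: (@bounded_coef_sum _ _ _ _ (fun l => cprod (F l) (y l))) => // l.
by apply: bounded_coef_cprod => //; exact: ltW.
Qed.

Let psumsum (F : 'I_n -> nat -> C) x : (forall l, bounded_coef D (F l)) -> cmod x <= D / 4 ->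
  psum (fun k => \sum_l cprod (F l) (y l) k) x = \sum_l psum (F l) x * psum (y l) x.
Proof.
move=> bF xD; rewrite (@psum_sum _ (D / 2)); first 1 last.
- by move: xD; rewrite (_ : D / 2 / 2 = D / 4) //; field.
- by move=> l; apply: bounded_coef_cprod => //; exact: ltW.
apply: eq_bigr => l _; have [M HM] := bF l; have [N HN] := bY l.
exact: psumM xD HM HN.
Qed.

Let dvE x (dv : 'I_n -> C) : cmod x < D / 8 ->
  (forall i, has_cderiv (psum (y i)) x (dv i)) -> forall i, dv i = psum (dcoef (y i)) x.
Proof.
move=> xD H i; have [M HM] := bY i.
exact: has_cderiv_unique (H i) (psum_deriv D_gt0 HM xD).
Qed.

Lemma eqR_of_ode k : eqR j Re y k = 0.
Proof.
move: k; apply: (psum_zero_near D2').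
  by apply: bounded_coefD => //; [exact: bdY | exact: bsum].
have [r r0 H] := ode; have D0 := D_gt0.
exists (Num.min r (D / 8)); first by rewrite lt_min r0 divr_gt0.
move=> x x0; rewrite lt_min => /andP[xr xD]; have [dv [dY _ dj]] := H x x0 xr.
have x4 : cmod x <= D / 4 by lra.
rewrite -[LHS]/(psum (fun k => dcoef (y j) k + \sum_l cprod (Re l) (y l) k) x).
rewrite (@bcpsumD _ (D / 2)) ?psumsum -?(dvE xD dY) ?dj ?addNr //; first lra.
exact: bsum.
Qed.

Lemma eqT_of_ode i k : i != j -> eqT Te e y i k = 0.
Proof.
move=> ij; move: k.
(* Multiplication by [x] on coefficients, so that [(x^2 - e) y'] becomes [sh (sh y') - e y']. *)
pose sh (u : nat -> C) k := if k is k'.+1 then u k' else 0.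
have bs u : bounded_coef (D / 2) u -> bounded_coef (D / 2) (sh u).
  exact: bounded_coef_shift.
have bA : bounded_coef (D / 2) (fun k => sh (sh (dcoef (y i))) k + - e * dcoef (y i) k).
  by apply: bounded_coefD => //; [apply/bs/bs | apply: bounded_coefZ].
have EE : eqT Te e y i = fun k => (sh (sh (dcoef (y i))) k + - e * dcoef (y i) k) +
    (-1) * \sum_l cprod (Te l i) (y l) k.
  apply/funext => k; rewrite /eqT mulN1r mulNr; congr (_ - _ - _).
  by case: k => [|[|k]] //=; rewrite mul0r.
rewrite EE; apply: (psum_zero_near D2').
  by apply: bounded_coefD => //; apply: bounded_coefZ; apply: bsum => l; exact: bT.
have [r r0 H] := ode; have D0 := D_gt0.
exists (Num.min r (D / 8)); first by rewrite lt_min r0 divr_gt0.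
move=> x x0; rewrite lt_min => /andP[xr xD]; have [dv [dY /(_ i ij) di _]] := H x x0 xr.
have x4 : cmod x <= D / 4 by lra.
have x2 : cmod x <= D / 2 / 2 by lra.
rewrite (bcpsumD x2) //; last by apply: bounded_coefZ; apply: bsum => l; exact: bT.
rewrite (bcpsumD x2) //; [|by apply/bs/bs|exact: bounded_coefZ].
rewrite (bcpsumZ _ x2) // (bcpsumZ _ x2); last by apply: bsum => l; exact: bT.
rewrite (psumsum (fun l => bT l i)) // -di (dvE xD dY).
have [M1 B1] := bs _ (bdY i); have [M0 B0] := bdY i.
by rewrite (psum_shift D2' x2 B1) (psum_shift D2' x2 B0); ring.
Qed.

End EquationsFromODE.

(** * The row obtained from the normalizations at epsilon = [a^2] *)

Section Gluing.
Variable R : realType.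
Local Notation C := R[i].
Variables (a gam r c0 h kap rho del : R).
Variables (n : nat) (l0 l1 : C -> 'rV[C]_n) (Rm : C -> C -> 'M[C]_n) (j : 'I_n).
Variables (FD FU HD HU : C -> C -> 'M[C]_n) (CR CL : C -> 'M[C]_n).
Hypothesis a_gt0 : 0 < a.
Hypothesis gam_gt0 : 0 < gam.
Hypothesis a_rho : a ^+ 2 < rho.
Hypothesis a_r : 2 * a < r.
Hypothesis kap_gt0 : 0 < kap.
Hypothesis kap_lt : kap < 4^-1.
Hypothesis h_gt0 : 0 < h.
Hypothesis a_h : a * h < pi / 4.
Hypothesis FD_def : is_FD gam r c0 h kap rho del l0 l1 FD.
Hypothesis HD_norm : normalizing_at gam rho l0 l1 Rm (OmegaD gam r c0 h kap) FD HD.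
Hypothesis HU_norm : normalizing_at gam rho l0 l1 Rm (OmegaU gam r c0 h kap) FU HU.
Hypothesis limL : diag_limit gam r c0 h kap rho (@xL R) HD HU.
Hypothesis limR : diag_limit gam r c0 h kap rho (@xR R) HD HU.
Hypothesis stokes : unfolded_stokes gam r c0 h kap rho FD HD HU CR CL.
Hypothesis rows : forall w, sectorS gam rho w ->
  row j (CR w) = row j 1%:M /\ row j (CL w) = row j 1%:M.

Let w := ray a.
Let e : C := (a ^+ 2)%:C.

Let Sw : sectorS gam rho w. Proof. exact: sectorS_ray. Qed.
Let r_gt0 : 0 < r. Proof. by have a0 := a_gt0; have ar := a_r; lra. Qed.
Let a_lt_r : a < r. Proof. by have a0 := a_gt0; have ar := a_r; lra. Qed.

Definition punctured (x : C) := cmod x < r /\ x ^+ 2 != (a ^+ 2)%:C.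
Definition onD (x : C) := exists2 t, time_at a x t & inD a h kap t.
Definition onU (x : C) := exists2 t, time_at a x t & inU a h kap t.

Lemma onD_Omega x : punctured x -> onD x -> OmegaD gam r c0 h kap w x.
Proof.
move=> [xr xa] [t tx tD].
by have [Gt Et] := time_at_D gam c0 a_gt0 xa xr tx tD; exists t.
Qed.

Lemma onU_Omega x : punctured x -> onU x -> OmegaU gam r c0 h kap w x.
Proof.
move=> [xr xa] [t tx tU].
by have [Gt Et] := time_at_U gam c0 a_gt0 xa xr tx tU; exists t.
Qed.

Lemma onDU x : punctured x -> onD x \/ onU x.
Proof.
move=> [xr xa]; have [t [tx [tD|tU]]] := time_at_exists a_gt0 kap_gt0 h_gt0 xa.
  by left; exists t.
by right; exists t.
Qed.

Lemma punctured_near x : punctured x -> exists2 d : R, 0 < d & forall y, cmod y < d -> punctured (x + y).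
Proof.
move=> [xr xa].
have pa : 0 < cmod (x ^+ 2 - (a ^+ 2)%:C) by rewrite cmod_gt0 subr_eq0.
have [d d0 Hd] := germ_continuous (germ_poly2 (a ^+ 2)%:C x) pa.
exists (Num.min d (r - cmod x)); first by rewrite lt_min d0 subr_gt0.
move=> y; rewrite lt_min => /andP[y1 y2]; split.
  by apply: le_lt_trans (cmodD _ _) _; lra.
by apply/eqP => E; have := Hd y y1; rewrite E subrr sub0r cmodN ltxx.
Qed.

Lemma onD_near x : punctured x -> onD x ->
  exists2 d : R, 0 < d & forall y, cmod y < d -> punctured (x + y) /\ onD (x + y).
Proof.
move=> nx [t tx /andP[t1 t2]]; have [d d0 Hd] := punctured_near nx.
pose eta := Num.min (complex.Im t - (- ((2^-1 + kap) * (pi / a)))) (h - complex.Im t).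
have eta0 : 0 < eta by rewrite lt_min !subr_gt0 t1 t2.
have [d' d'0 Hd'] := time_at_near a_gt0 (proj2 nx) tx eta0.
exists (Num.min d d'); first by rewrite lt_min d0.
move=> y; rewrite lt_min => /andP[y1 y2]; split; first exact: Hd.
have [_ [t' tx']] := Hd' y y2; rewrite /eta lt_min !ltr_norml => /andP[/andP[u1 _] /andP[_ u2]].
by exists t' => //; apply/andP; split; lra.
Qed.

Lemma onU_near x : punctured x -> onU x ->
  exists2 d : R, 0 < d & forall y, cmod y < d -> punctured (x + y) /\ onU (x + y).
Proof.
move=> nx [t tx /andP[t1 t2]]; have [d d0 Hd] := punctured_near nx.
pose eta := Num.min (complex.Im t - - h) ((2^-1 + kap) * (pi / a) - complex.Im t).
have eta0 : 0 < eta by rewrite lt_min !subr_gt0 t1 t2.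
have [d' d'0 Hd'] := time_at_near a_gt0 (proj2 nx) tx eta0.
exists (Num.min d d'); first by rewrite lt_min d0.
move=> y; rewrite lt_min => /andP[y1 y2]; split; first exact: Hd.
have [_ [t' tx']] := Hd' y y2; rewrite /eta lt_min !ltr_norml => /andP[/andP[u1 _] /andP[_ u2]].
by exists t' => //; apply/andP; split; lra.
Qed.

Lemma unitHD x : OmegaD gam r c0 h kap w x -> HD w x \in unitmx /\ FD w x \in unitmx.
Proof.
move=> /(normalizing_solution HD_norm Sw) [] /=.
by rewrite unitmx_mul => /andP[].
Qed.

Lemma unitHU x : OmegaU gam r c0 h kap w x -> HU w x \in unitmx.
Proof.
move=> /(normalizing_solution HU_norm Sw) [] /=.
by rewrite unitmx_mul => /andP[].
Qed.

Lemma FD_diag x : OmegaD gam r c0 h kap w x -> exists d, FD w x = diag_mx d.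
Proof. by move=> [t Gt <-]; have [lg _ ->] := FD_def => //; eexists. Qed.

Lemma row_agree x : punctured x -> onD x -> onU x ->
  row j (invmx (HD w x)) = row j (invmx (HU w x)).
Proof.
move=> nx Dx Ux; have OD := onD_Omega nx Dx; have OU := onU_Omega nx Ux.
have [uH uF] := unitHD OD; have uU := unitHU OU; have [d dE] := FD_diag OD.
have [_ _ jR jL jC] := stokes Sw; have [rR rL] := rows Sw.
have [xr xa] := nx; have [t tx tD] := Dx; have [u ux uU'] := Ux.
have : [\/ OmegaR gam r c0 h kap w x, OmegaL gam r c0 h kap w x | OmegaC gam r c0 h kap w x].
  exact: (overlap gam c0 _ _ _ _ _ xa xr tx tD ux uU').
case=> Ox.
- exact: row_invmx_jump uH uU uF dE rR (jR x Ox).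
- exact: row_invmx_jump uH uU uF dE rL (jL x Ox).
(* On [OmegaC] the jump is the identity, so the identity matrix can stand for [F]. *)
- apply: row_invmx_jump uH uU (unitmx1 _ _) _ _ _.
  + by rewrite -diag_const_mx.
  + by [].
  + by rewrite jC // invmx1 !mulmx1.
Qed.

(* The [j]-th rows of [HD^-1] and [HU^-1] agree on the overlaps, because the
   [j]-th rows of the Stokes matrices are trivial. *)
Definition glued (x : C) : 'M[C]_n := if `[< onD x >] then invmx (HD w x) else invmx (HU w x).
(** On the D side this row times [HD FD] is row [j] of [FD]. Paired with a solution it thus gives a
    constant multiple of the model solution [F_jj]: a first integral up to that factor. *)
Definition first_int (i : 'I_n) (x : C) : C := glued x j i.

Lemma first_intD x i : onD x -> first_int i x = invmx (HD w x) j i.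
Proof. by move=> Dx; rewrite /first_int /glued; case: asboolP. Qed.

Lemma first_intU x i : punctured x -> onU x -> first_int i x = invmx (HU w x) j i.
Proof.
move=> nx Ux; rewrite /first_int /glued; case: asboolP => // Dx.
by have /rowP/(_ i) := row_agree nx Dx Ux; rewrite !mxE.
Qed.

(** In a neighbourhood covered by the U side the definition may still switch to [HD]; by [row_agree]
    the row is nevertheless that of [HU^-1] throughout. *)
Lemma first_int_germ i x : punctured x -> germ (first_int i) x.
Proof.
move=> nx; case: (onDU nx) => [Dx|Ux].
  have [d d0 Hd] := onD_near nx Dx; have OD := onD_Omega nx Dx.
  apply: (germ_near (f := fun z => invmx (HD w z) j i)); last first.
    by exists d => // y /Hd[_ Dy]; rewrite first_intD.
  apply: germ_invmx.
    move=> p q; apply: (germ2_slice (f := fun y z => HD y z p q)).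
    by apply: analytic2_germ2; exact: (normalizing_analytic HD_norm).
  by exists d => // y /Hd[ny Dy]; have [] := unitHD (onD_Omega ny Dy).
have [d d0 Hd] := onU_near nx Ux; have OU := onU_Omega nx Ux.
apply: (germ_near (f := fun z => invmx (HU w z) j i)); last first.
  by exists d => // y /Hd[ny Dy]; rewrite first_intU.
apply: germ_invmx.
  move=> p q; apply: (germ2_slice (f := fun y z => HU y z p q)).
  by apply: analytic2_germ2; exact: (normalizing_analytic HU_norm).
by exists d => // y /Hd[ny Dy]; exact: unitHU (onU_Omega ny Dy).
Qed.

Lemma first_int_bounded i z : z ^+ 2 = e -> locally_bounded (first_int i) z.
Proof.
move=> ze; have zr : cmod z = a.
  have : cmod z ^+ 2 = a ^+ 2 by rewrite -cmodX ze cmodR gtr0_norm ?exprn_gt0.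
  by move=> /eqP; rewrite eqrXn2 // ?cmod_ge0 ?ltW // => /eqP.
have zc : z = xL w \/ z = xR w.
  have aw : xL w = - a%:C by rewrite /xL sqrte_ray // rmorphN.
  have -> : xR w = a%:C by rewrite /xR -/(xL w) aw opprK.
  move/eqP: ze; rewrite aw /e rmorphXn /= -subr_eq0 subr_sqr mulf_eq0 subr_eq0 addr_eq0.
  by move=> /orP[]/eqP ->; [right | left].
have [K HK] : exists K : 'M[C]_n, [/\ HD w x @[x --> within (OmegaD gam r c0 h kap w) (nbhs z)] --> K,
   HU w x @[x --> within (OmegaU gam r c0 h kap w) (nbhs z)] --> K & K \in unitmx].
  case: zc => ->.
    by have [K [/(_ w Sw) [h1 h2 _ h3 _] _]] := limL; exists (K w).
  by have [K [/(_ w Sw) [h1 h2 _ h3 _] _]] := limR; exists (K w).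
have [LD LU uK] := HK.
have [r1 [B1 [r10 H1]]] := invmx_bounded j LD uK.
have [r2 [B2 [r20 H2]]] := invmx_bounded j LU uK.
(* The roots are [2 a] apart, so within distance [a] only [z] itself is singular. The value assigned
   at [z] is arbitrary and is included in the bound. *)
exists (Num.min (Num.min r1 r2) a), (Num.max (Num.max B1 B2) (cmod (first_int i z))).
split; first by rewrite !lt_min r10 r20.
move=> y; rewrite !lt_min => /andP[/andP[y1 y2] ya].
have [->|y0] := eqVneq y 0; first by rewrite addr0 le_max lexx orbT.
have ny : punctured (z + y).
  split; first by apply: le_lt_trans (cmodD _ _) _; rewrite zr; have := a_r; lra.
  rewrite -[(a ^+ 2)%:C]/e -ze -subr_eq0 subr_sqr mulf_neq0 ?(addrAC z y) ?subrr ?add0r //.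
  rewrite -cmod_gt0 (_ : z + z + y = 2 * z - (- y)); last by ring.
  have := cmod_subl (2 * z) (- y); rewrite cmodN cmodM cmod_nat zr; have := a_gt0; lra.
have yE : cmod (z + y - z) = cmod y by rewrite (addrAC z y) subrr add0r.
case: (onDU ny) => [Dy|Uy].
  rewrite first_intD // !le_max H1 ?yE //; first exact: onD_Omega.
  by have [] := unitHD (onD_Omega ny Dy).
rewrite first_intU // !le_max H2 ?orbT ?yE //; first exact: onU_Omega.
exact: unitHU (onU_Omega ny Uy).
Qed.

(** In the square of half-side [r / 2] one has [|z|^2 <= r^2 / 2], so it fits into the disc of
    radius [r]. *)
Lemma first_int_off_roots i : germ_off_roots (r / 2) e (first_int i).
Proof.
split; last exact: first_int_bounded.
move=> z /square_cmod zr ze; apply: first_int_germ; split=> //.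
rewrite -(ltr_pXn2r (n := 2)) ?nnegrE ?cmod_ge0 ?(ltW r_gt0) //.
apply: le_lt_trans zr _; have : 0 < r ^+ 2 by rewrite exprn_gt0.
by rewrite expr_div_n; lra.
Qed.

Lemma onD0 : onD 0.
Proof.
have p0 := @pi_gt0 R; have pa : 0 < pi / a by rewrite divr_gt0.
(* At [x = 0] the quotient is [-1], whose logarithm [- i pi] gives a time in the lower strip. *)
exists (0 +i* (- (pi / a / 2))).
  have aC0 : a%:C != 0 :> C by rewrite -(rmorph0 (real_complex R)) (inj_eq (@complexI _)) gt_eqF.
  rewrite /time_at sub0r add0r mulNr divff //.
  apply: eq_ReIm; rewrite ?Re_cexp ?Im_cexp !re_mul !im_mul /= !mulr0 !mul0r subr0 expR0 !mul1r addr0.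
    rewrite (_ : 2 * a * - (pi / a / 2) = - pi); last by field; rewrite gt_eqF.
    by rewrite cosN cospi.
  rewrite (_ : 2 * a * - (pi / a / 2) = - pi); last by field; rewrite gt_eqF.
  by rewrite sinN sinpi oppr0.
rewrite /inD /=; move: (pi / a) pa => y y0.
have ky : 0 < kap * y by rewrite mulr_gt0.
by have h0 := h_gt0; apply/andP; split; lra.
Qed.

Lemma punctured0 : punctured 0.
Proof.
split; first by rewrite cmod0.
by rewrite expr0n eq_sym fmorph_eq0 expf_eq0 gt_eqF.
Qed.


(** Along the time, [F_jj(x(t))] is differentiated by the chain rule and again through its
    exponential formula, whose exponent has derivative [l0 + x l1]. The two results must agree. *)
Lemma FD_deriv x D : punctured x -> onD x -> has_cderiv (fun y => FD w y j j) x D ->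
  (x ^+ 2 - e) * D = eigval l0 l1 e x j * FD w x j j.
Proof.
move=> [xr xa] [t tx tD] FDx; have [lg lgB FE] := FD_def.
have [s0 xE] := xt_ray a_gt0 xa tx.
have tr : cmod (xt w t) < r by rewrite xE.
have ta : xt w t ^+ 2 != (a ^+ 2)%:C by rewrite xE.
have dl := branch_deriv a_gt0 lgB Sw r_gt0 s0 tr tD ta.
have [dx _] := xt_deriv a_gt0 s0.
have [d d0 Hd] := GammaD_near gam c0 a_gt0 r_gt0 s0 tr tD.
have FE' s : cmod s < d -> FD w (xt w (t + s)) j j =
    cexp ((t + s) * l0 e 0 j + lg w (t + s) * l1 e 0 j).
  by move=> /Hd Gs; rewrite FE // cexp_ray // !mxE eqxx.
rewrite xE -/e in dx dl.
have L1 : has_cderiv (fun s => FD w (xt w s) j j) t ((x ^+ 2 - e) * D).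
  have FDt : has_cderiv (fun y => FD w y j j) (xt w t) D by rewrite xE.
  exact: has_cderiv_comp dx FDt.
have du := has_cderivD (has_cderivM (has_cderiv_id t) (has_cderiv_cst (l0 e 0 j) t))
  (has_cderivM dl (has_cderiv_cst (l1 e 0 j) t)).
have L2 : has_cderiv (fun s => FD w (xt w s) j j) t (eigval l0 l1 e x j * FD w x j j).
  have := has_cderiv_comp du (cexp_deriv _).
  rewrite -[FD w x j j](_ : FD w (xt w (t + 0)) j j = _); last by rewrite addr0 xE.
  rewrite FE' ?cmod0 // addr0 !mulr0 !addr0 mul1r -/(eigval l0 l1 e x j).
  by move=> /has_cderiv_near; apply; exists d => // s sd; rewrite FE'.
exact: has_cderiv_unique L1 L2.
Qed.

Lemma first_int_ode x : punctured x -> onD x -> exists dv : 'I_n -> C,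
  forall i, has_cderiv (first_int i) x (dv i) /\
    (x ^+ 2 - e) * dv i = eigval l0 l1 e x j * first_int i x -
      \sum_l first_int l x * system_mx l0 l1 Rm e x l i.
Proof.
move=> nx Dx; have OD := onD_Omega nx Dx.
have /choice[dv Hdv] : forall i, exists D, has_cderiv (first_int i) x D.
  by move=> i; apply: germ_has_cderiv; exact: first_int_germ.
exists dv => i; split=> //; pose W y := HD w y *m FD w y.
have [/= uW [dW WdW WE]] := normalizing_solution HD_norm Sw OD.
rewrite cexp_ray // -/e in WE; have dWe := is_derive_entry WdW.
have [d d0 Hd] := onD_near nx Dx.
have vW y k : punctured y -> onD y -> \sum_l first_int l y * W y l k = FD w y j k.
  move=> ny Dy; have [uH uF] := unitHD (onD_Omega ny Dy).
  have <- : invmx (HD w y) *m W y = FD w y by rewrite /W mulKmx.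
  by rewrite [RHS]mxE; apply: eq_bigr => l _; rewrite first_intD.
have sumd k : has_cderiv (fun y => FD w y j k) x
    (\sum_l (dv l * W x l k + first_int l x * dW l k)).
  apply: has_cderiv_near (has_cderiv_sum _ (fun l => has_cderivM (Hdv l) (dWe l k))) _.
  by exists d => // y /Hd[ny Dy]; rewrite -vW.
have offd y k : punctured y -> onD y -> k != j -> FD w y j k = 0.
  move=> ny Dy kj; have [dd ->] := FD_diag (onD_Omega ny Dy).
  by rewrite mxE eq_sym (negbTE kj).
(* Column [k] of the derivative of [v W], which is row [j] of [FD]: for [k = j] this is the model
   equation, for [k <> j] the entry is identically zero. *)
have key k : (x ^+ 2 - e) * \sum_l (dv l * W x l k + first_int l x * dW l k) =
    eigval l0 l1 e x j * \sum_l first_int l x * W x l k.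
  rewrite vW //; have [->|kj] := eqVneq k j; first exact: FD_deriv (sumd j).
  rewrite (offd x k) // mulr0; apply/eqP; rewrite mulf_eq0; apply/orP; right; apply/eqP.
  apply: has_cderiv_unique (sumd k) _.
  apply: has_cderiv_near (has_cderiv_cst 0 x) _.
  by exists d => // y /Hd[ny Dy]; rewrite offd.
(* The defect of the claimed equation is annihilated by the invertible matrix [W x], hence is
   zero. *)
pose z : 'rV[C]_n := \row_l ((x ^+ 2 - e) * dv l - (eigval l0 l1 e x j * first_int l x -
  \sum_m first_int m x * system_mx l0 l1 Rm e x m l)).
suff /rowP/(_ i) : z = 0 by rewrite !mxE => /eqP; rewrite subr_eq0 => /eqP.
suff : z *m W x = 0 by move=> /(congr1 (mulmx^~ (invmx (W x)))); rewrite mulmxK // mul0mx.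
apply/rowP => k; rewrite !mxE.
have WEk l : (x ^+ 2 - e) * dW l k = \sum_m system_mx l0 l1 Rm e x l m * W x m k.
  by have /matrixP/(_ l k) := WE; rewrite !mxE => ->; apply: eq_bigr => m _; rewrite !mxE.
have := key k; rewrite big_split /= mulrDr !mulr_sumr => K.
rewrite (eq_bigr (fun l => (x ^+ 2 - e) * (dv l * W x l k) - eigval l0 l1 e x j * (first_int l x * W x l k)
   + (\sum_m first_int m x * system_mx l0 l1 Rm e x m l) * W x l k)); last first.
  by move=> l _; rewrite mxE; ring.
rewrite big_split /= sumrB -K opprD addrA subrr add0r.
apply/eqP; rewrite addrC subr_eq0; apply/eqP.
rewrite (eq_bigr (fun l => \sum_m first_int m x * system_mx l0 l1 Rm e x m l * W x l k)); last first.
  by move=> l _; rewrite mulr_suml.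
rewrite exchange_big /=; apply: eq_bigr => l _.
by rewrite mulrCA WEk mulr_sumr; apply: eq_bigr => m _; rewrite mulrA.
Qed.

Lemma glued_solution (T : 'I_n -> 'I_n -> nat -> nat -> C) (Rj : 'I_n -> nat -> nat -> C) (d B : R) :
  0 < d -> cmod e <= d / 2 ->
  (forall l i, coef_bound2 d B (T l i)) -> (forall l, coef_bound2 d B (Rj l)) ->
  (forall l i x, cmod x < d -> psum2 (T l i) e x =
     (if l == i then eigval l0 l1 e x j else 0) - system_mx l0 l1 Rm e x l i) ->
  (forall l x, cmod x < d -> psum2 (Rj l) e x = Rm e x l j) ->
  exists (y : 'I_n -> nat -> C) (K : R),
    [/\ exists i k, y i k != 0,
        forall i k, cmod (y i k) * (r / 4) ^+ k <= K &
        (forall k, eqR j (R_at Rj e) y k = 0) /\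
        (forall i k, i != j -> eqT (T_at T e) e y i k = 0)].
Proof.
move=> d0 ed TB RB TE RE.
have gv i : germ2 (fun _ : C => first_int i) 0 0 := first_int_germ i punctured0.
have [c [d1 [M [d10 cM vE]]]] := germ2_family gv.
pose y i := c i 0%N.
have yM i : coef_bound d1 M (y i).
  by move=> k; have := cM i 0%N k; rewrite add0n.
have vy i x : cmod x < d1 -> first_int i x = psum (y i) x.
  by move=> xd; have := vE i 0 x; rewrite cmod0 !add0r psum2_e0 => /(_ d10 xd).
have r2 : 0 < r / 2 by rewrite divr_gt0.
have e0 : e != 0 by rewrite fmorph_eq0 expf_neq0 // gt_eqF.
have er : cmod e < (r / 2) ^+ 2.
  rewrite cmodR ger0_norm ?exprn_ge0 ?(ltW a_gt0) // ltr_pXn2r ?nnegrE ?(ltW r2) ?(ltW a_gt0) //.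
  by have := a_r; lra.
have /choice[K HK] : forall i, exists K : R, forall k, cmod (y i k) * (r / 2 / 2) ^+ k <= K.
  move=> i; apply: (coef_growth r2 e0 er (first_int_off_roots i) d10 (yM i)) => x xd.
  exact: vy.
have K0 i : 0 <= K i by apply: le_trans (HK i 0%N); rewrite mulr_ge0 ?cmod_ge0 // exprn_ge0 // ltW // divr_gt0.
exists y, (\sum_i K i); split.
(* A zero row of Taylor coefficients would give a zero row of the invertible matrix [HD^-1] at
   [x = 0]. *)
- apply: contrapT => H; have y0 i k : y i k = 0.
    by apply/eqP/negPn/negP => yi; apply: H; exists i, k.
  have [uH _] := unitHD (onD_Omega punctured0 onD0).
  have : row j (invmx (HD w 0)) *m HD w 0 = 0.
    rewrite (_ : row j _ = 0) ?mul0mx //; apply/rowP => i; rewrite !mxE.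
    by rewrite -first_intD ?vy ?cmod0 ?psum_at0 //; exact: onD0.
  rewrite -row_mul mulVmx // => /rowP/(_ j); rewrite !mxE eqxx => /eqP.
  by rewrite oner_eq0.
- move=> i k; rewrite (_ : r / 4 = r / 2 / 2); last by field.
  by apply: le_trans (HK i k) _; rewrite (bigD1 i) //= lerDl sumr_ge0.
pose D := Num.min d d1; have D0 : 0 < D by rewrite lt_min d0.
have Dd : 0 <= D <= d by rewrite (ltW D0) ge_min lexx.
have Dd1 : 0 <= D <= d1 by rewrite (ltW D0) ge_min lexx orbT.
have bT l i : bounded_coef D (T_at T e l i).
  by apply: bounded_coefW Dd _; exists (2 * B); exact: coef_bound2_rows.
have bR l : bounded_coef D (R_at Rj e l).
  by apply: bounded_coefW Dd _; exists (2 * B); exact: coef_bound2_rows.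
have bY l : bounded_coef D (y l) by apply: bounded_coefW Dd1 _; exists M.
have ode : exists2 q : R, 0 < q & forall x, x != 0 -> cmod x < q ->
  exists dv : 'I_n -> C, [/\ forall i, has_cderiv (psum (y i)) x (dv i),
    forall i, i != j -> (x ^+ 2 - e) * dv i = \sum_l psum (T_at T e l i) x * psum (y l) x &
    dv j = - \sum_l psum (R_at Rj e l) x * psum (y l) x].
  have [q q0 Hq] := onD_near punctured0 onD0.
  exists (Num.min q D); first by rewrite lt_min q0.
  move=> x _; rewrite !lt_min => /andP[xq /andP[xd xd1]].
  have [nx Dx] : punctured x /\ onD x by have := Hq x xq; rewrite add0r.
  have [dv Hdv] := first_int_ode nx Dx.
  have vT i : (x ^+ 2 - e) * dv i =
    \sum_l ((if l == i then eigval l0 l1 e x j else 0) - system_mx l0 l1 Rm e x l i) * psum (y l) x.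
    have [_ ->] := Hdv i; rewrite [RHS](eq_bigr (fun l => (if l == i then eigval l0 l1 e x j * first_int l x else 0)
      - first_int l x * system_mx l0 l1 Rm e x l i)).
      by rewrite sumrB -big_mkcond big_pred1_eq.
    by move=> l _; rewrite -vy // mulrBl; case: eqP => _; ring.
  exists dv; split=> [i|i ij|].
  - apply: has_cderiv_near (proj1 (Hdv i)) _.
    by exists (d1 - cmod x); [rewrite subr_gt0|move=> s sd; apply: vy; apply: le_lt_trans (cmodD _ _) _; lra].
  - by rewrite vT; apply: eq_bigr => l _; rewrite -TE.
  - have x0 : x ^+ 2 - e != 0 by rewrite subr_eq0; case: nx.
    apply: (mulfI x0); rewrite vT mulrN mulr_sumr -sumrN; apply: eq_bigr => l _.
    rewrite -[psum (R_at Rj e l) x]/(psum2 (Rj l) e x) RE // /system_mx /Lambda !mxE.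
    by have [->|lj] := eqVneq l j; rewrite ?mulr1n ?mulr0n; ring.
split=> [k|i k ij].
  exact: (eqR_of_ode D0 bR bY ode).
exact: (eqT_of_ode D0 bT bY ode).
Qed.

End Gluing.

(** * The decoupling gauge transformation *)

Section FormalToAnalytic.
Variable R : realType.
Local Notation C := R[i].

Lemma germ_fst (f : C -> C) y0 z0 : germ f y0 -> germ2 (fun y _ => f y) y0 z0.
Proof.
move=> /germP[a [d [M [d0 aM H]]]].
have M0 := coef_bound_ge0 aM.
exists (fun p q => if q == 0%N then a p else 0), d, M; split=> //.
  move=> p [|q] /=; first by rewrite addn0.
  by rewrite cmod0 mul0r.
move=> e x ed xd; rewrite (H e ed) /psum2 [RHS](@psum_fin _ 1); last first.
  by case=> [|k] // _; exact: psum0.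
by rewrite big_ord1 expr0 mulr1.
Qed.

Lemma germ2_psum2 (c : nat -> nat -> C) (d M : R) : 0 < d -> coef_bound2 d M c ->
  germ2 (psum2 c) 0 0.
Proof.
move=> d0 cM; exists c, d, M; split; [exact: d0 | exact: cM | move=> e x _ _].
by rewrite (add0r e) (add0r x).
Qed.

Lemma psum2_eq0 (c : nat -> nat -> C) e x : (forall a k, c a k = 0) -> psum2 c e x = 0.
Proof.
move=> H; have -> : c = fun _ _ => 0 by apply/funext => a; apply/funext => k; exact: H.
by rewrite /psum2 psum0 psum0.
Qed.

Lemma coef_bound2_dxcoef (c : nat -> nat -> C) (d M : R) : 0 < d -> coef_bound2 d M c ->
  coef_bound2 (d / 2) (M / d) (dxcoef c).
Proof.
move=> d0 cM a k; rewrite /dxcoef cmodM cmod_nat.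
have k2 : k.+1%:R * 2^-1 ^+ (a + k) <= 1 :> R.
  rewrite exprVn ler_pdivrMr ?exprn_gt0 // mul1r -natrX ler_nat.
  by apply: leq_trans (ltn_expl k (isT : 1 < 2)%N) _; rewrite leq_exp2l // leq_addl.
rewrite [leLHS](_ : _ = (k.+1%:R * 2^-1 ^+ (a + k)) * (cmod (c a k.+1) * d ^+ (a + k))); last first.
  by rewrite exprMn; ring.
apply: le_trans (ler_wpM2r _ k2) _; first by rewrite mulr_ge0 ?cmod_ge0 // exprn_ge0 // ltW.
rewrite mul1r ler_pdivlMr //; apply: le_trans (cM a k.+1).
by rewrite addnS exprSr mulrA.
Qed.

Variables (n : nat) (j : 'I_n) (T : 'I_n -> 'I_n -> nat -> nat -> C).
Variables (Rj : 'I_n -> nat -> nat -> C) (v : 'I_n -> nat -> nat -> C) (d B : R).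
Hypothesis d_gt0 : 0 < d.
Hypothesis TB : forall l i, coef_bound2 d B (T l i).
Hypothesis RB : forall l, coef_bound2 d B (Rj l).
Hypothesis vB : forall l, coef_bound2 d B (v l).

Let d2 : 0 < d / 2. Proof. by rewrite divr_gt0. Qed.

Let cprod2_sum (F : 'I_n -> nat -> nat -> C) e x : (forall l, coef_bound2 d B (F l)) ->
  cmod e <= d / 4 -> cmod x <= d / 4 ->
  (exists M, coef_bound2 (d / 2) M (fun a k => \sum_l cprod2 (F l) (v l) a k)) /\
  psum2 (fun a k => \sum_l cprod2 (F l) (v l) a k) e x = \sum_l psum2 (F l) e x * psum2 (v l) e x.
Proof.
move=> FB ed xd.
have e2 : cmod e <= d / 2 / 2 by lra.
have x2 : cmod x <= d / 2 / 2 by lra.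
have [|HM ->] := @psum2_sum _ _ _ (index_enum _) (fun l => cprod2 (F l) (v l)) _ _ d2 e2 x2.
  by move=> l; exists (B * B); exact: coef_bound2_cprod.
split=> //; apply: eq_bigr => l _; exact: psum2M (FB l) (vB l).
Qed.

Lemma formalR_analytic e x : (forall k a, formalR j Rj v k a = 0) ->
  cmod e <= d / 4 -> cmod x <= d / 4 ->
  psum2 (dxcoef (v j)) e x = - \sum_l psum2 (Rj l) e x * psum2 (v l) e x.
Proof.
move=> H ed xd; have [[M HM] E] := cprod2_sum RB ed xd.
have e2 : cmod e <= d / 2 / 2 by lra.
have x2 : cmod x <= d / 2 / 2 by lra.
have S : psum2 (fun a k => dxcoef (v j) a k + \sum_l cprod2 (Rj l) (v l) a k) e x =
    psum2 (dxcoef (v j)) e x + \sum_l psum2 (Rj l) e x * psum2 (v l) e x.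
  by rewrite -E; exact: psum2D d2 e2 x2 (coef_bound2_dxcoef d_gt0 (vB j)) HM.
by move: S; rewrite (psum2_eq0 e x (fun a k => H k a)) => /eqP; rewrite eq_sym addr_eq0 => /eqP.
Qed.

Lemma formalT_analytic i e x : (forall k a, formalT T v i k a = 0) ->
  cmod e <= d / 4 -> cmod x <= d / 4 ->
  (x ^+ 2 - e) * psum2 (dxcoef (v i)) e x = \sum_l psum2 (T l i) e x * psum2 (v l) e x.
Proof.
move=> H ed xd; have [[M HM] E] := cprod2_sum (fun l => TB l i) ed xd.
have e2 : cmod e <= d / 2 / 2 by lra.
have x2 : cmod x <= d / 2 / 2 by lra.
have D := coef_bound2_dxcoef d_gt0 (vB i).
have DX := coef_bound2_xshift (ltW d2) D.
have DXX := coef_bound2_xshift (ltW d2) DX.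
have DE := coef_bound2Z (-1) (coef_bound2_eshift (ltW d2) D).
have S : psum2 (fun a k => (xshift (xshift (dxcoef (v i))) a k + -1 * eshift (dxcoef (v i)) a k)
     + -1 * \sum_l cprod2 (T l i) (v l) a k) e x =
   (x ^+ 2 - e) * psum2 (dxcoef (v i)) e x - \sum_l psum2 (T l i) e x * psum2 (v l) e x.
  rewrite (psum2D d2 e2 x2 (coef_bound2D (ltW d2) DXX DE) (coef_bound2Z (-1) HM)).
  rewrite (psum2D d2 e2 x2 DXX DE) (psum2Z _ d2 e2 x2 (coef_bound2_eshift (ltW d2) D)).
  rewrite (psum2Z _ d2 e2 x2 HM) (psum2_xshift d2 e2 x2 DX) (psum2_xshift d2 e2 x2 D).
  by rewrite (psum2_eshift d2 e2 x2 D) E; ring.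
move: S; rewrite psum2_eq0; first by move=> /esym /eqP; rewrite subr_eq0 => /eqP.
move=> a k; rewrite -[RHS](H k a) /formalT !mulN1r; congr (_ - _ - _).
  by case: k => [|[|k]] //=; rewrite mul0r.
by case: a => [|a] //=; rewrite mulr0.
Qed.

End FormalToAnalytic.

(** * The gauge transformation built from an analytic row *)

Section Gauge.
Variable R : realType.
Local Notation C := R[i].
Variables (n : nat) (l0 l1 : C -> 'rV[C]_n) (Rm : C -> C -> 'M[C]_n) (j : 'I_n).
Variables (v dv : 'I_n -> C -> C -> C) (q : R).
Hypothesis pre : prenormal l0 l1 Rm.
Hypothesis q_gt0 : 0 < q.
Hypothesis v_germ : forall i, germ2 (v i) 0 0.
Hypothesis v0 : forall i, v i 0 0 = (i == j)%:R.
Hypothesis vj_neq0 : forall e x, cmod e < q -> cmod x < q -> v j e x != 0.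
Hypothesis v_deriv : forall i e x, cmod e < q -> cmod x < q -> has_cderiv (v i e) x (dv i e x).
Hypothesis v_ode : forall i e x, cmod e < q -> cmod x < q ->
  (x ^+ 2 - e) * dv i e x =
  eigval l0 l1 e x j * v i e x - \sum_l v l e x * system_mx l0 l1 Rm e x l i.

Definition gauge_inv e x : 'M[C]_n := \matrix_(i, k) (if i == j then v k e x else (i == k)%:R).
Definition gauge e x : 'M[C]_n :=
  \matrix_(i, k) (if i == j then (if k == j then (v j e x)^-1 else - v k e x * (v j e x)^-1)
                  else (i == k)%:R).
(** With [V = gauge_inv], the new matrix must satisfy [B' V = V B + (x^2 - e) V']. Row [j] of the
    right side is [lambda_j v] by the equation for [v], the others are rows of [B]. So
    [B' V = Lambda V + (x^2 - e) R_0], where [R_0] is [R] with row [j] erased: [Lambda] is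
    unchanged. *)
Definition decoupled e x : 'M[C]_n :=
  (\matrix_(i, k) (if i == j then 0 else Rm e x i k)) *m gauge e x.

Lemma gauge_invK e x : v j e x != 0 -> gauge_inv e x *m gauge e x = 1%:M.
Proof.
move=> vj; apply/matrixP => i k; rewrite !mxE; have [->|ij] := eqVneq i j; last first.
  rewrite (bigD1 i) //= !mxE (negbTE ij) eqxx mul1r big1 ?addr0 // => l li.
  by rewrite !mxE (negbTE ij) eq_sym (negbTE li) mul0r.
rewrite (bigD1 j) //= !mxE eqxx [j == k]eq_sym.
have [->|kj] := eqVneq k j.
  rewrite divff // big1 ?addr0 // => l lj.
  by rewrite !mxE (negbTE lj) mulr0.
rewrite (bigD1 k) //= !mxE eqxx (negbTE kj) eqxx mulr1 big1 ?addr0.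
  by field.
by move=> l /andP[lj lk]; rewrite !mxE eqxx (negbTE lj) (negbTE lk) mulr0.
Qed.

Lemma gauge_germ i k : germ2 (fun e x => gauge e x i k) 0 0.
Proof.
have vV : germ2 (fun e x => (v j e x)^-1) 0 0.
  by apply: germ2_V => //; rewrite v0 eqxx oner_eq0.
have ext f : germ2 f 0 0 -> (forall e x, f e x = gauge e x i k) ->
    germ2 (fun e x => gauge e x i k) 0 0.
  by move=> gf H; apply: germ2_near gf _; exists 1 => // e x _ _; rewrite H.
have [ij|ij] := eqVneq i j; last first.
  by apply: ext (germ2_cst (i == k)%:R 0 0) _ => e x; rewrite mxE (negbTE ij).
have [kj|kj] := eqVneq k j.
  by apply: ext vV _ => e x; rewrite mxE ij kj !eqxx.
apply: ext (germ2_M (germ2_cst (-1) 0 0) (germ2_M (v_germ k) vV)) _ => e x.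
by rewrite mxE ij eqxx (negbTE kj) mulN1r mulNr.
Qed.

Lemma decoupled_germ i k : germ2 (fun e x => decoupled e x i k) 0 0.
Proof.
have [_ _ aR _] := pre.
have g l : germ2 (fun e x => (if i == j then 0 else Rm e x i l) * gauge e x l k) 0 0.
  apply: germ2_M (gauge_germ l k); case: eqP => _; first exact: germ2_cst.
  exact: analytic2_germ2.
apply: germ2_near (germ2_sum (index_enum _) g) _; exists 1 => // e x _ _.
by rewrite /decoupled mxE; apply: eq_bigr => l _; rewrite [in RHS]mxE.
Qed.

Lemma decoupled_prenormal : prenormal l0 l1 decoupled.
Proof.
have [a0 a1 _ gap] := pre; split=> //.
exact: germ2_analytic2 decoupled_germ.
Qed.

Lemma decoupled_row e x i : i != j -> system_mx l0 l1 decoupled e x j i = 0.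
Proof.
move=> ij; rewrite /system_mx /decoupled !mxE [j == i]eq_sym (negbTE ij) mulr0n add0r big1 ?mulr0 // => l _.
by rewrite mxE eqxx mul0r.
Qed.

(** Differentiating [V P = 1] gives [V P' = - V' P]. The derivative of [P] exists entry by entry
    from the explicit formula, but its value is never computed. *)
Lemma gauge_deriv e x : cmod e < q -> cmod x < q ->
  exists2 dP : 'M[C]_n, derive1 (gauge e) x = dP &
    gauge_inv e x *m dP = - (\matrix_(i, k) (if i == j then dv k e x else 0)) *m gauge e x.
Proof.
move=> eq xq; have vj := vj_neq0 eq xq.
have [d d0 Hd] : exists2 d : R, 0 < d & forall y, cmod y < d -> cmod (x + y) < q.
  exists (q - cmod x); first by rewrite subr_gt0.
  by move=> y yd; apply: le_lt_trans (cmodD _ _) _; lra.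
have vV := has_cderiv_comp (v_deriv j eq xq) (has_cderiv_inv vj).
have ext i k f D : has_cderiv f x D -> (forall y, f y = gauge e y i k) ->
    has_cderiv (fun y => gauge e y i k) x D.
  by move=> gf H; apply: has_cderiv_near gf _; exists 1 => // y _; rewrite H.
have /choice[D HD] : forall ik : 'I_n * 'I_n, exists D,
    has_cderiv (fun y => gauge e y ik.1 ik.2) x D.
  move=> [i k] /=; have [ij|ij] := eqVneq i j; last first.
    by eexists; apply: ext (has_cderiv_cst (i == k)%:R x) _ => y; rewrite mxE (negbTE ij).
  have [kj|kj] := eqVneq k j.
    by eexists; apply: ext vV _ => y; rewrite mxE ij kj !eqxx.
  eexists; apply: ext (has_cderivM (has_cderiv_cst (-1) x) (has_cderivM (v_deriv k eq xq) vV)) _ => y.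
  by rewrite mxE ij eqxx (negbTE kj) mulN1r mulNr.
exists (\matrix_(i, k) D (i, k)).
  by apply: derive1_mx => i k; rewrite mxE; exact: (HD (i, k)).
apply/matrixP => i k; rewrite mulNmx !mxE; apply/eqP; rewrite -addr_eq0 -big_split /=; apply/eqP.
have Vd l : has_cderiv (fun y => gauge_inv e y i l) x (if i == j then dv l e x else 0).
  case: (eqVneq i j) => ij.
    apply: has_cderiv_near (v_deriv l eq xq) _.
    by exists 1 => // y _; rewrite mxE ij eqxx.
  apply: has_cderiv_near (has_cderiv_cst (i == l)%:R x) _.
  by exists 1 => // y _; rewrite mxE (negbTE ij).
have S := has_cderiv_sum (index_enum _) (fun l => has_cderivM (Vd l) (HD (l, k))).
have Z : has_cderiv (fun y => \sum_l gauge_inv e y i l * gauge e y l k) x 0.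
  apply: has_cderiv_near (has_cderiv_cst (i == k)%:R x) _; exists d => // y yd.
  have := gauge_invK (vj_neq0 eq (Hd y yd)) => /matrixP/(_ i k).
  by rewrite !mxE => <-.
rewrite -[RHS](has_cderiv_unique S Z); apply: eq_bigr => l _.
by rewrite !mxE addrC.
Qed.

Lemma gauge_intertwine e x : cmod e < q -> cmod x < q ->
  system_mx l0 l1 decoupled e x *m gauge_inv e x =
  gauge_inv e x *m system_mx l0 l1 Rm e x +
  (x ^+ 2 - e) *: (\matrix_(i, k) (if i == j then dv k e x else 0)).
Proof.
move=> eq xq; have PV := mulmx1C (gauge_invK (vj_neq0 eq xq)).
have VE i k : gauge_inv e x i k = if i == j then v k e x else (i == k)%:R by rewrite mxE.
rewrite {1}/system_mx mulmxDl -scalemxAl /decoupled -(mulmxA _ (gauge e x)) PV mulmx1 /Lambda mul_diag_mx.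
apply/matrixP => i k; rewrite [LHS]mxE [RHS]mxE.
rewrite [X in X + _ = _]mxE [X in X * _ + _ = _]mxE [X in _ + X = _]mxE [X in _ + _ * X = _]mxE.
rewrite [X in _ = X + _]mxE [X in _ = _ + X]mxE [X in _ = _ + _ * X]mxE VE.
have [ij|ij] := boolP (i == j).
  rewrite mulr0 addr0 v_ode // addrCA (eqP ij).
  rewrite [X in _ + (X - _)](eq_bigr (fun l => v l e x * system_mx l0 l1 Rm e x l k)).
    by rewrite subrr addr0.
  by move=> l _; rewrite VE eqxx.
rewrite mulr0 addr0 (bigD1 i) //= big1 ?addr0; last first.
  by move=> l li; rewrite VE (negbTE ij) eq_sym (negbTE li) mul0r.
rewrite VE (negbTE ij) eqxx mul1r /system_mx /Lambda [RHS]mxE [X in _ = X + _]mxE [X in _ = _ + X]mxE.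
by rewrite [X in _ = X *+ _ + _]mxE; case: (i == k); rewrite ?mulr1 ?mulr0.
Qed.

Lemma decoupled_equivalent :
  analytically_equivalent (system_mx l0 l1 Rm) (system_mx l0 l1 decoupled).
Proof.
have unit e x : cmod e < q -> cmod x < q ->
    gauge e x \in unitmx /\ invmx (gauge e x) = gauge_inv e x.
  move=> eq xq; have VP := gauge_invK (vj_neq0 eq xq); have [_ uP] := mulmx1_unit VP.
  by split=> //; rewrite -[LHS]mul1mx -VP mulmxK.
exists gauge; split.
- exact: germ2_analytic2 gauge_germ.
- by have [] := unit 0 0; rewrite ?cmod0.
exists ([set e | cmod e < q], [set e | cmod e < q]) => /=.
  by split; apply/near_cmod; exists q => // y; rewrite subr0.
move=> [e x] /= [eq xq]; have [uP ->] := unit e x eq xq.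
have [dP -> dPE] := gauge_deriv eq xq.
have VP := gauge_invK (vj_neq0 eq xq).
rewrite mulmxBr -scalemxAr dPE mulNmx scalerN opprK scalemxAl mulmxA -mulmxDl.
have /(congr1 (mulmx^~ (gauge e x))) /= <- := gauge_intertwine eq xq.
by rewrite -mulmxA VP mulmx1.
Qed.

End Gauge.

(** * Assembly of the data and the theorem *)

Section Conclusion.
Variable R : realType.
Local Notation C := R[i].

(** All entries are expanded as one finite family over a sum type, so that [T] and [Rj] share the
    radius [d] and the bound [B]. *)
Lemma system_series n (l0 l1 : C -> 'rV[C]_n) (Rm : C -> C -> 'M[C]_n) (j : 'I_n) :
  prenormal l0 l1 Rm ->
  exists (T : 'I_n -> 'I_n -> nat -> nat -> C) (Rj : 'I_n -> nat -> nat -> C) (d B : R),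
  [/\ 0 < d, forall l i, coef_bound2 d B (T l i), forall l, coef_bound2 d B (Rj l),
      forall l i e x, cmod e < d -> cmod x < d -> psum2 (T l i) e x =
        (if l == i then eigval l0 l1 e x j else 0) - system_mx l0 l1 Rm e x l i &
      forall l e x, cmod e < d -> cmod x < d -> psum2 (Rj l) e x = Rm e x l j].
Proof.
move=> [a0 a1 aR _].
have gR := analytic2_germ2 aR.
have ge : germ2 (fun e _ : C => e) 0 0 := germ_fst 0 (germ_id 0).
have gx : germ2 (fun _ x : C => x) 0 0 := germ_id 0.
have gl k : germ2 (fun e x => eigval l0 l1 e x k) 0 0.
  by apply: germ2_D (germ_fst 0 (analytic_germ a0 0 k)) (germ2_M gx (germ_fst 0 (analytic_germ a1 0 k))).
have gc := germ2_cst (-1 : C) 0 0.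
have gB l i : germ2 (fun e x => system_mx l0 l1 Rm e x l i) 0 0.
  have gL : germ2 (fun e x => if l == i then eigval l0 l1 e x i else 0) 0 0.
    by case: (l == i) => //; exact: germ2_cst.
  have g := germ2_D gL (germ2_M (germ2_D (germ2_M gx gx) (germ2_M gc ge)) (gR l i)).
  apply: germ2_near g _; exists 1 => // e x _ _; rewrite /system_mx /Lambda !mxE mulN1r.
  by case: eqVneq => [->|_]; rewrite ?mulr1n ?mulr0n.
have gT l i : germ2 (fun e x => (if l == i then eigval l0 l1 e x j else 0) +
    -1 * system_mx l0 l1 Rm e x l i) 0 0.
  apply: germ2_D (germ2_M gc (gB l i)).
  by case: (l == i) => //; exact: germ2_cst.
pose F (s : 'I_n * 'I_n + 'I_n) e x := match s with
  | inl p => (if p.1 == p.2 then eigval l0 l1 e x j else 0) + -1 * system_mx l0 l1 Rm e x p.1 p.2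
  | inr l => Rm e x l j end.
have gF s : germ2 (F s) 0 0 by case: s => [[l i]|l]; [exact: gT | exact: gR].
have [c [d [B [d0 cB cE]]]] := germ2_family gF.
exists (fun l i => c (inl (l, i))), (fun l => c (inr l)), d, B; split=> // [l i|l] e x ed xd.
  by rewrite -cE // !add0r /= mulN1r.
by rewrite -cE // !add0r.
Qed.

Lemma exists_small (r rho rho' d h : R) : 0 < r -> 0 < rho -> 0 < rho' -> 0 < d -> 0 < h ->
  exists a : R, [/\ 0 < a, 2 * a < r, a ^+ 2 < rho, a ^+ 2 < rho' & a ^+ 2 <= d / 2 /\ a * h < pi / 4].
Proof.
move=> r0 rho0 rho0' d0 h0; have p0 := divr_gt0 (@pi_gt0 R) h0.
pose m := Num.min (Num.min (Num.min 1 r) (Num.min rho rho')) (Num.min d (pi / h)).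
have m0 : 0 < m by rewrite !lt_min r0 rho0 rho0' d0 p0 ltr01.
have [m1 mr mrho] : [/\ m <= 1, m <= r & m <= rho] by rewrite !ge_min !lexx !orbT.
have [mrho' md mh] : [/\ m <= rho', m <= d & m <= pi / h] by rewrite !ge_min !lexx !orbT.
move: m m0 m1 mr mrho mrho' md mh => m m0 m1 mr mrho mrho' md mh.
have m2 : (m / 8) ^+ 2 <= m / 8.
  by rewrite expr2 ler_piMr //; lra.
have mhE : m * h <= pi by rewrite -ler_pdivlMr.
exists (m / 8); split; [lra|lra|lra|lra|split; first lra].
have : 0 < pi :> R := @pi_gt0 R.
by move: (pi : R) mhE => p mhE; rewrite mulrAC; lra.
Qed.

Lemma psum2_nonzero (c : nat -> nat -> C) (d M : R) : 0 < d -> coef_bound2 d M c ->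
  (forall k, c k 0%N = (k == 0%N)%:R) ->
  exists2 q : R, 0 < q & forall e x, cmod e < q -> cmod x < q -> psum2 c e x != 0.
Proof.
move=> d0 cM c0; have M0 := coef_bound2_ge0 cM.
have q0 : 0 < d / (8 * (M + 1)) by rewrite divr_gt0 // mulr_gt0 // ltr_wpDl.
exists (Num.min (d / 2) (d / (8 * (M + 1)))); first by rewrite lt_min q0 divr_gt0.
move=> e x; rewrite !lt_min => /andP[ed _] /andP[xd xq].
have bM := coef_bound2_rows d0 cM (ltW ed).
(* The series is [1 + x S] with [S] bounded by [4 M / d], and the radius is chosen to make
   [|x S| < 1]. *)
rewrite /psum2 (psum_split 1 d0 bM (ltW xd)) big_ord1 expr0 mulr1 expr1.
have -> : psum (c ^~ 0%N) e = 1.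
  rewrite (@psum_fin _ 1); first by rewrite big_ord1 c0 expr0 mulr1.
  by case=> [|k] // _; rewrite c0.
have bS : coef_bound d (2 * M / d) (fun k => psum (c ^~ (1 + k)%N) e).
  move=> k; rewrite ler_pdivlMr // -mulrA -exprSr; exact: bM.
have := psum_le (ltW xd) bS; move: (psum _ x) => S SM.
apply/eqP => /eqP; rewrite addr_eq0 => /eqP /(congr1 (@cmod R)).
rewrite cmod1 cmodN cmodM => E.
have : cmod x * cmod S <= d / (8 * (M + 1)) * (2 * (2 * M / d)).
  by rewrite ler_pM ?cmod_ge0 // ltW.
rewrite -E leNgt => /negP; apply.
rewrite (_ : _ * _ = M / (M + 1) / 2); last by field; rewrite !gt_eqF // ltr_wpDl.
have : M / (M + 1) <= 1 by rewrite ler_pdivrMr; lra.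
lra.
Qed.

End Conclusion.

Theorem theorem4p61 (R : realType) (n : nat) (n_ge2 : (1 < n)%N)
    (l0 l1 : R[i] -> 'rV[R[i]]_n) (Rm : R[i] -> R[i] -> 'M[R[i]]_n)
    (Hpre : prenormal l0 l1 Rm) (j : 'I_n)
    (gam : R) (gam_gt0 : 0 < gam)
    (gam_small : gam * (1 + 2 * gam / pi) < theta0 l0 l1) :
  exists2 r0 : R, 0 < r0 &
  forall r : R, 0 < r < r0 ->
  forall del : R, 0 < del < pi / 2 -> no_opposite_ray l0 l1 r del ->
  exists2 k0 : R, 0 < k0 &
  forall c0 h kap : R,
    0 < c0 < k0 -> 0 < h < k0 -> h < r^-1 -> 0 < kap < k0 -> kap < 2^-1 ->
  exists2 rho0 : R, 0 < rho0 &
  forall rho : R, 0 < rho < rho0 -> spectral_gap l0 l1 gam rho ->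
  forall FD FU HD HU : R[i] -> R[i] -> 'M[R[i]]_n,
    is_FD gam r c0 h kap rho del l0 l1 FD ->
    is_FU gam r c0 h kap rho FD FU ->
    normalizing_at gam rho l0 l1 Rm (OmegaD gam r c0 h kap) FD HD ->
    normalizing_at gam rho l0 l1 Rm (OmegaU gam r c0 h kap) FU HU ->
    diag_limit gam r c0 h kap rho (@xL R) HD HU ->
    diag_limit gam r c0 h kap rho (@xR R) HD HU ->
  forall CR CL : R[i] -> 'M[R[i]]_n,
    unfolded_stokes gam r c0 h kap rho FD HD HU CR CL ->
    (forall w, sectorS gam rho w ->
       row j (CR w) = row j 1%:M /\ row j (CL w) = row j 1%:M) ->
  exists (l0' l1' : R[i] -> 'rV[R[i]]_n) (Rm' : R[i] -> R[i] -> 'M[R[i]]_n),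
    [/\ prenormal l0' l1' Rm',
        (\forall e & x \near (0 : R[i]), forall i : 'I_n, i != j ->
           system_mx l0' l1' Rm' e x j i = 0) &
        analytically_equivalent (system_mx l0 l1 Rm)
                                (system_mx l0' l1' Rm')].
Proof.
(* The value [1 / 4] is the bound on [kap] used in [overlap]; the remaining smallness is obtained
   from the choice of [a]. *)
exists 1 => // r /andP[r0 _] del _ _; exists 4^-1; first by rewrite invr_gt0.
move=> c0 h kap _ /andP[h0 _] _ /andP[kap0 kap4] _; exists 1 => // rho /andP[rho_gt0 _] _.
move=> FD FU HD HU HFD HFU HHD HHU HL HR CR CL HS rows.
have [T [Rj [d [B [d0 TB RB TE RE]]]]] := system_series j Hpre.
pose mu i := eigval l0 l1 0 0 i - eigval l0 l1 0 0 j.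
have T00 l i : T l i 0%N 0%N = if l == i then - mu i else 0.
  rewrite -(psum2_at0 (T l i)) TE ?cmod0 // /system_mx /Lambda !mxE expr0n subrr mul0r addr0.
  by case: eqVneq => [->|_]; rewrite ?mulr1n ?mulr0n ?subrr // /mu opprB.
(* The eigenvalues at the origin have strictly ordered real parts, in particular they are
   distinct. *)
have mu0 i : i != j -> mu i != 0.
  have [_ _ _ gap] := Hpre; move=> ij; apply/eqP => E.
  have [l|l] := ltnP i j; first by have := gap i j l; rewrite -/(mu i) E ltxx.
  have l' : (j < i)%N by rewrite ltn_neqAle eq_sym ij l.
  by have := gap j i l'; rewrite -opprB -/(mu i) E oppr0 ltxx.
have r4 : 0 < r / 4 by rewrite divr_gt0.
have sols (rho' : R) : 0 < rho' ->
  exists (e : R[i]) (y : 'I_n -> nat -> R[i]) (K : R),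
    [/\ e != 0, cmod e < rho', exists i k, y i k != 0,
        forall i k, cmod (y i k) * (r / 4) ^+ k <= K &
        (forall k, eqR j (R_at Rj e) y k = 0) /\
        (forall i k, i != j -> eqT (T_at T e) e y i k = 0)].
  move=> rho0'; have [a [a0 ar arho arho' [ad ah]]] := exists_small r0 rho_gt0 rho0' d0 h0.
  have ae : cmod (a ^+ 2)%:C = a ^+ 2 :> R by rewrite cmodR ger0_norm // exprn_ge0 // ltW.
  have ed2 : cmod ((a ^+ 2)%:C : R[i]) <= d / 2 by rewrite ae.
  have ed : cmod ((a ^+ 2)%:C : R[i]) < d by rewrite ae; lra.
  have [y [K [y0 yK yE]]] := glued_solution a0 gam_gt0 arho ar kap0 kap4 h0 ah HFD HHD HHU HL HR HS rows
    d0 ed2 TB RB (fun l i x => TE l i _ x ed) (fun l x => RE l _ x ed).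
  exists (a ^+ 2)%:C, y, K; split=> //; last by rewrite ae.
  by rewrite fmorph_eq0 expf_neq0 // gt_eqF.
have [v [s [K [s0 vK vj [vR vT]]]]] := formal_solution d0 r4 TB RB T00 mu0 sols.
have B0 := coef_bound2_ge0 (RB j); have K0 := coef_bound2_ge0 (vK j).
pose D := Num.min d s; pose M := Num.max B K.
have D0 : 0 < D by rewrite lt_min d0.
have Dd : 0 <= D <= d by rewrite (ltW D0) ge_min lexx.
have Ds : 0 <= D <= s by rewrite (ltW D0) ge_min lexx orbT.
have BM : B <= M by rewrite le_max lexx.
have KM : K <= M by rewrite le_max lexx orbT.
have TM l i := coef_bound2W Dd BM (TB l i).
have RM l := coef_bound2W Dd BM (RB l).
have vM l := coef_bound2W Ds KM (vK l).
have [q1 q10 vnz] := psum2_nonzero D0 (vM j) vj.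
pose q := Num.min q1 (D / 8).
have q0 : 0 < q by rewrite lt_min q10 divr_gt0.
have qD : q <= D / 8 by rewrite ge_min lexx orbT.
have qq1 : q <= q1 by rewrite ge_min lexx.
have Ddd : D <= d by case/andP: Dd.
pose vf i e x := psum2 (v i) e x; pose dv i e x := psum2 (dxcoef (v i)) e x.
have gv i : germ2 (vf i) 0 0 by apply: germ2_psum2 (vM i).
have v00 i : vf i 0 0 = (i == j)%:R.
  rewrite /vf psum2_at0; have [->|ij] := eqVneq i j; first by rewrite vj.
  (* The lowest coefficient of equation [i] reads [mu i v_i(0, 0) = 0]. *)
  have := vT i 0%N 0%N ij; rewrite /formalT /= mulr0 subr0 add0r => /eqP.
  rewrite oppr_eq0 (eq_bigr (fun l => T l i 0%N 0%N * v l 0%N 0%N)); last first.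
    by move=> l _; rewrite /cprod2 !big_ord1.
  rewrite (bigD1 i) //= big1 ?addr0.
    by rewrite T00 eqxx mulf_eq0 oppr_eq0 (negbTE (mu0 i ij)) => /eqP.
  by move=> l li; rewrite T00 (negbTE li) mul0r.
have vnz' e x : cmod e < q -> cmod x < q -> vf j e x != 0.
  by move=> eq xq; apply: vnz; lra.
have dvE i e x : cmod e < q -> cmod x < q -> has_cderiv (vf i e) x (dv i e x).
  by move=> eq xq; apply: psum2_deriv (vM i) => //; lra.
have vode i e x : cmod e < q -> cmod x < q -> (x ^+ 2 - e) * dv i e x =
    eigval l0 l1 e x j * vf i e x - \sum_l vf l e x * system_mx l0 l1 Rm e x l i.
  move=> eq xq.
  have [ed xd] : cmod e < d /\ cmod x < d by split; lra.
  have [e4 x4] : cmod e <= D / 4 /\ cmod x <= D / 4 by split; lra.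
  have -> : eigval l0 l1 e x j * vf i e x - \sum_l vf l e x * system_mx l0 l1 Rm e x l i =
      \sum_l psum2 (T l i) e x * vf l e x.
    rewrite [RHS](eq_bigr (fun l => (if l == i then eigval l0 l1 e x j * vf l e x else 0)
      - vf l e x * system_mx l0 l1 Rm e x l i)).
      by rewrite sumrB -big_mkcond big_pred1_eq.
    by move=> l _; rewrite TE // mulrBl; case: eqP => _; ring.
  have [->|ij] := eqVneq i j; last by rewrite (formalT_analytic D0 TM vM _ e4 x4) // => k a; exact: vT.
  (* Column [j] of [T] is [- (x^2 - e)] times column [j] of [R], so equation [j] is
     [v_j' = - (v R)_j] multiplied by [x^2 - e]. *)
  rewrite /dv (formalR_analytic D0 RM vM vR e4 x4) mulrN mulr_sumr -sumrN; apply: eq_bigr => l _.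
  rewrite TE // RE // /system_mx /Lambda !mxE -/(vf l e x).
  by have [->|lj] := eqVneq l j; rewrite ?mulr1n ?mulr0n; ring.
exists l0, l1, (decoupled Rm j vf); split.
- exact: decoupled_prenormal Hpre gv v00.
- near=> e x => i ij; exact: decoupled_row.
- exact: decoupled_equivalent q0 gv v00 vnz' dvE vode.
Unshelve. all: by end_near. Qed.
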